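(* Let $p\geq 4$ and $\kappa_p=\frac{p-4}{p-2}$. Let $r,m$ be integers with $1\leq m\leq r$, set $R=2r$, let $Q^R\subseteq\mathbb{R}^2$ be a square of side length $2^R$, and let $F:\mathbb{R}^2\to\mathbb{C}$ with $\mathrm{supp}(\widehat F)\subseteq\mathcal{N}(4^{-r})$. Then for every $\varepsilon>0$, $$M_{p,2}(m,m)\lesssim_{\varepsilon} 2^{m\varepsilon}M_{p,2}(2m,2m)^{1-\kappa_p}M_{p,p}(2r,m)^{\kappa_p},$$ with implicit constant depending only on $\varepsilon$ and $p$.
   Context: $\mathcal{N}(\delta)=\{(x,x^2+t):x\in[0,1],t\in[0,\delta]\}$. Fix $I_1=[0,\frac14]$ and $I_2=[\frac12,1]$. For a dyadic interval $I$, $\mathbb{I}_\sigma(I)$ is the set of dyadic subintervals of $I$ of length $2^{-\sigma}$; $\mathcal{P}_I$ is the Fourier projection onto $I\times\mathbb{R}$. For $s\leq R$, $\mathcal{Q}_s(Q^R)$ is the partition of $Q^R$ into squares of side length $2^s$. For a square $Q$ with center $c_Q$ and side length $\ell$, $w_Q(x)=(1+|x-c_Q|/\ell)^{-200}$ and $\|G\|_{L^q_\#(w_Q)}=\big(\frac{1}{|Q|}\int|G|^qw_Q\big)^{1/q}$. For $s\leq R$ and $\sigma\geq0$ define $$M_{p,q}(s,\sigma)=\Big[\frac{1}{|\mathcal{Q}_s(Q^R)|}\sum_{Q^s\in\mathcal{Q}_s(Q^R)}\prod_{i=1}^2\Big(\sum_{I\in\mathbb{I}_\sigma(I_i)}\|\mathcal{P}_IF\|_{L^q_\#(w_{Q^s})}^2\Big)^{p/4}\Big]^{1/p}.$$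 *)

(* Defs.v *)
From HB Require Import structures.
From mathcomp Require Import all_boot all_order all_algebra.
From mathcomp Require Import all_classical all_reals all_analysis.
From mathcomp.real_closed Require Import complex.
Set Implicit Arguments. Unset Strict Implicit. Unset Printing Implicit Defensive.
Import Order.TTheory GRing.Theory Num.Theory.
Import numFieldNormedType.Exports.
Local Open Scope classical_set_scope.
Local Open Scope ring_scope.

Section Defs.
Context {R : realType}.

Definition leb2 := (@lebesgue_measure R \x @lebesgue_measure R)%E.

Definition dot2 (x y : R * R) : R := x.1 * y.1 + x.2 * y.2.

Definition expi (t : R) : R[i] := Complex (cos t) (sin t).

Definition cint (D : set (R * R)) (f : R * R -> R[i]) : R[i] :=
  Complex (Rintegral leb2 D (fun x => complex.Re (f x)))
          (Rintegral leb2 D (fun x => complex.Im (f x))).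

Definition fourier (F : R * R -> R[i]) (xi : R * R) : R[i] :=
  cint setT (fun x => F x * expi (- (2 * pi * dot2 x xi))).

Definition fproj (a b : R) (F : R * R -> R[i]) (x : R * R) : R[i] :=
  cint [set xi | a <= xi.1 <= b]
       (fun xi => fourier F xi * expi (2 * pi * dot2 x xi)).

Definition Nbhd (delta : R) : set (R * R) :=
  [set xi | 0 <= xi.1 <= 1 /\ xi.1 ^+ 2 <= xi.2 <= xi.1 ^+ 2 + delta].

Definition support2 (G : R * R -> R[i]) : set (R * R) :=
  closure [set xi | G xi != 0].

(* an axis-parallel square [c1,c1+l) x [c2,c2+l) given by lower-left corner c and side l *)
Record square := Square { corner : R * R; side : R }.

Definition sq_center (Q : square) : R * R :=
  ((corner Q).1 + side Q / 2, (corner Q).2 + side Q / 2).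

Definition sq_area (Q : square) : R := side Q ^+ 2.

Definition wQ (Q : square) (x : R * R) : R :=
  ((1 + Num.sqrt ((x.1 - (sq_center Q).1) ^+ 2 + (x.2 - (sq_center Q).2) ^+ 2)
        / side Q) ^- 200).

Definition cmod (z : R[i]) : R := Num.sqrt (complex.Re z ^+ 2 + complex.Im z ^+ 2).

Definition Lqavg (q : R) (Q : square) (G : R * R -> R[i]) : R :=
  ((sq_area Q)^-1 * Rintegral leb2 setT (fun x => cmod (G x) `^ q * wQ Q x))
    `^ (q^-1).

(* the partition Q_s(Q) of a square Q of side 2^Rr into squares of side 2^s
   (s <= Rr): the (i,j)-th subsquare, i, j < 2^(Rr - s) *)
Definition subsquare (Q : square) (s : nat) (i j : nat) : square :=
  Square ((corner Q).1 + i%:R * 2 ^+ s, (corner Q).2 + j%:R * 2 ^+ s) (2 ^+ s).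

(* sum over the dyadic subintervals of [a,b] (a, b in [0,1]) of length 2^-sigma:
   the intervals [k 2^-sigma, (k+1) 2^-sigma] contained in [a,b] *)
Definition dyadic_sum (sigma : nat) (a b : R) (f : R -> R -> R) : R :=
  \sum_(k < 2 ^ sigma |
        (a <= k%:R / 2 ^+ sigma) && ((k.+1)%:R / 2 ^+ sigma <= b))
     f (k%:R / 2 ^+ sigma) ((k.+1)%:R / 2 ^+ sigma).

Definition I1 : R * R := (0, 4^-1).
Definition I2 : R * R := (2^-1, 1).

(* M_{p,q}(s, sigma) relative to the square QR of side 2^Rr *)
Definition Mpq (p q : R) (Rr : nat) (QR : square) (F : R * R -> R[i])
  (s sigma : nat) : R :=
  ((4 ^+ (Rr - s))%:R^-1 *
    \sum_(i < 2 ^ (Rr - s)) \sum_(j < 2 ^ (Rr - s))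
      ((dyadic_sum sigma I1.1 I1.2
          (fun a b => Lqavg q (subsquare QR s i j) (fproj a b F) ^+ 2)) `^ (p / 4) *
       (dyadic_sum sigma I2.1 I2.2
          (fun a b => Lqavg q (subsquare QR s i j) (fproj a b F) ^+ 2)) `^ (p / 4)))
  `^ (p^-1).

Definition kappa (p : R) : R := (p - 4) / (p - 2).

End Defs.

(* Main.v *)
(* Put theta = p/4 and q = p/2.  Expanding the product of the two sums over caps and applying
   Minkowski's inequality in l^theta reduces the passage from squares of side 2^m to squares
   Q' of side 4^m to one pair of caps (I, J): the mean over the squares Q inside Q' of
   ||f_I||_{L^q(Q)}^q ||f_J||_{L^q(Q)}^q is at most a constant times the same product on Q'.
   Indeed, on Q' each |f_I|^q is dominated by its average over tubes of direction (-2a, 1),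
   a the left endpoint of I, because modulating f_I by a constant frequency puts its
   spectrum, paired with 4^m (-2a, 1), into a bounded interval, where a Schwartz-like kernel
   reproduces it; tubes over I and over J are transverse.  Hoelder's inequality interpolates
   the L^q mean between the L^2 and the L^p means, first on each cap, then in the sums over
   caps and squares.  The L^2 mean passes to caps of length 4^-m by orthogonality at scale 4^m,
   and the L^p factor passes to the big square by Minkowski, Cauchy-Schwarz and the bound
   sum_Q' w_Q' <~ w.  None of these steps loses more than a constant. *)

Require Import Defs.
From HB Require Import structures.
From mathcomp Require Import all_boot all_order all_algebra.
From mathcomp Require Import all_classical all_reals all_analysis.
From mathcomp Require Import measurable_realfun ring lra zify.
From mathcomp.real_closed Require Import complex.
Set Implicit Arguments. Unset Strict Implicit. Unset Printing Implicit Defensive.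
Import Order.TTheory GRing.Theory Num.Theory.
Import numFieldNormedType.Exports.
Local Open Scope classical_set_scope.
Local Open Scope ring_scope.

(** * Integration on the line and on the plane *)

(** The projections [fproj] are built from the Fourier transform of [F], which is bounded and
    vanishes off a bounded set, so each is an absolutely convergent oscillatory integral. Splitting
    the transform into real and imaginary parts [u], [v] makes the argument real: |f| becomes
    [amp u v], and cosines with a free phase replace complex exponentials.

    The weights shape the proof: they decay only like the power -200, and a displacement by t side
    lengths costs (1 + |t|)^200. The kernels therefore decay to order 202, and the two spare powers
    leave the integrable function 1 / (1 + t^2). Fejer kernels times powers of a sinc provide them
    explicitly.

    The direction (-2a, 1) comes from y - 2ax + a^2 = (y - x^2) + (x - a)^2: over a cap of length
    2^-m both terms are at most 4^-m. The gap between [I1] and [I2] enters as 2 (b - a) >= 1/2 for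
    left endpoints a, b. The exponent [kappa p] solves 2/p = (1 - kappa)/2 + kappa/p, so the same
    exponent serves for the norms, the sum over caps and the sum over squares. *)

Section AffineSubstitution.
Context {R : realType}.
Notation mu := (@lebesgue_measure R).

Lemma measurable_affine (a b : R) :
  measurable_fun setT (fun t : measurableTypeR R => a * t + b : measurableTypeR R).
Proof. by apply: measurable_funD => //; exact: measurable_funM. Qed.

Let pm (a b : R) : {measure set (measurableTypeR R) -> \bar R} :=
  measure_function_pushforward__canonical__measure_function_Measure mu
    (measurable_affine a b).

(** The pushforward of Lebesgue measure scaled by |a| is a measure that agrees with Lebesgue measure
    on half-open intervals; uniqueness extends this to all measurable sets. *)
Lemma lebesgue_measure_affine (a b : R) (A : set R) : a != 0 -> measurable A ->
  mu A = (`|a|%:E * mu ((fun t : R => a * t + b)%R @^-1` A))%E.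
Proof.
move=> a0 mA.
have n0 : (0 <= `|a|) by [].
suff itv (c d : R) : mu [set` `]c, d]] =
    (`|a|%:E * mu ((fun t : R => a * t + b)%R @^-1` [set` `]c, d]]))%E.
  pose m := mscale (NngNum n0) (pm a b).
  rewrite (@lebesgue_measure_unique R m) // => _ [[c d]] _ <-.
  exact: itv.
rewrite lebesgue_measure_itv /= lte_fin.
case: (ltrgtP a 0) => [an|ap|a00]; last by rewrite a00 eqxx in a0.
- rewrite [X in mu X](_ : _ = [set` `[(d - b) / a, (c - b) / a[]); last first.
    apply/seteqP; split=> t /=; rewrite !in_itv/= => /andP[h1 h2]; apply/andP; split.
    + by rewrite ler_ndivrMr // lerBrDr mulrC.
    + by rewrite ltr_ndivlMr // ltrBlDr mulrC.
    + by rewrite ltr_ndivlMr // ltrBlDr mulrC in h2.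
    + by rewrite ler_ndivrMr // lerBrDr mulrC in h1.
  rewrite lebesgue_measure_itv /= lte_fin ltr_nM2r ?invr_lt0 // ltrD2r.
  case: ifP => _; last by rewrite mule0.
  by rewrite -!EFinD -EFinM; congr EFin; rewrite ltr0_norm //; field; rewrite lt_eqF.
- rewrite [X in mu X](_ : _ = [set` `](c - b) / a, (d - b) / a]]); last first.
    apply/seteqP; split=> t /=; rewrite !in_itv/= => /andP[h1 h2]; apply/andP; split.
    + by rewrite ltr_pdivrMr // ltrBlDr mulrC.
    + by rewrite ler_pdivlMr // lerBrDr mulrC.
    + by rewrite ltr_pdivrMr // ltrBlDr mulrC in h1.
    + by rewrite ler_pdivlMr // lerBrDr mulrC in h2.
  rewrite lebesgue_measure_itv /= lte_fin ltr_pM2r ?invr_gt0 // ltrD2r.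
  case: ifP => _; last by rewrite mule0.
  by rewrite -!EFinD -EFinM; congr EFin; rewrite gtr0_norm //; field; rewrite gt_eqF.
Qed.

Lemma ge0_integral_affine (a b : R) (f : R -> \bar R) : a != 0 ->
  measurable_fun setT f -> (forall t, 0 <= f t)%E ->
  (\int[mu]_t f t = `|a|%:E * \int[mu]_t f (a * t + b)%R)%E.
Proof.
move=> a0 mf f0.
have n0 : (0 <= `|a|) by [].
transitivity (\int[mscale (NngNum n0) (pm a b)]_t f t)%E.
  by apply: eq_measure_integral => A mA _; exact: (lebesgue_measure_affine b a0 mA).
rewrite ge0_integral_mscale //= ge0_integral_pushforward //.
exact: measurable_affine.
Qed.

End AffineSubstitution.

(** * Measurability of inverses, roots, powers and trigonometric functions *)

Section MeasurabilityTools.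
Context {R : realType} {d : measure_display} {T : measurableType d}.

Lemma measurable_funV (f : T -> R) :
  measurable_fun setT f -> measurable_fun setT (fun x => (f x)^-1).
Proof.
move=> mf.
(* This reduces inversion to a real power of a nonnegative function; where [f] vanishes both sides
   are 0 by the convention for the inverse of 0. *)
rewrite (_ : (fun x => (f x)^-1) = (fun x => f x * (f x ^+ 2) `^ (-1))); last first.
  apply/funext => x; have [->|fx0] := eqVneq (f x) 0; first by rewrite invr0 mul0r.
  by rewrite powR_inv1 ?sqr_ge0 // expr2 invfM mulrA divff // mul1r.
apply: measurable_funM => //.
exact: (measurableT_comp (measurable_powR (-1)) (measurable_funX 2 mf)).
Qed.

Lemma measurable_funsqrt (f : T -> R) :
  measurable_fun setT f -> measurable_fun setT (fun x => Num.sqrt (f x)).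
Proof.
move=> mf.
rewrite (_ : (fun x => Num.sqrt (f x)) = (fun x => (Num.max (f x) 0) `^ (2^-1))); last first.
  apply/funext => x; rewrite powR12_sqrt ?le_max ?lexx ?orbT //.
  have [//|h] := leP 0 (f x).
  by rewrite ltr0_sqrtr // sqrtr0.
apply: (measurableT_comp (measurable_powR _)).
exact: measurable_maxr.
Qed.

Lemma measurable_funpowR (f : T -> R) q :
  measurable_fun setT f -> measurable_fun setT (fun x => f x `^ q).
Proof. exact: (measurableT_comp (measurable_powR _)). Qed.

Lemma measurable_funcos (f : T -> R) :
  measurable_fun setT f -> measurable_fun setT (fun x => cos (f x)).
Proof. by apply: measurableT_comp; apply: continuous_measurable_fun => x; exact: continuous_cos. Qed.

Lemma measurable_funsin (f : T -> R) :
  measurable_fun setT f -> measurable_fun setT (fun x => sin (f x)).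
Proof. by apply: measurableT_comp; apply: continuous_measurable_fun => x; exact: continuous_sin. Qed.

End MeasurabilityTools.

(** * Integrals depending on a parameter, and Fubini for bounded kernels *)

Section ParametricIntegrals.
Context {R : realType} {d1 d2 : measure_display}.
Context {T1 : measurableType d1} {T2 : measurableType d2}.
Variables (m1 : {sigma_finite_measure set T1 -> \bar R}).
Variables (m2 : {sigma_finite_measure set T2 -> \bar R}).

(** Measurability alone suffices: Tonelli handles the positive and negative parts separately, and
    [fine] is a measurable map even at infinite values. *)
Lemma measurable_Rintegral_param (f : T1 * T2 -> R) :
  measurable_fun setT f ->
  measurable_fun setT (fun t => Rintegral m2 setT (fun s => f (t, s))).
Proof.
move=> mf.
have mE : measurable_fun setT (EFin \o f) by exact/measurable_EFinP.
apply: (measurableT_comp (@fine_measurable R _ measurableT)) => //=.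
under eq_fun do rewrite integralE.
apply: emeasurable_funB.
- rewrite (_ : (fun t => _) = fubini_F m2 ((EFin \o f)^\+)%E); last first.
    by apply/funext => t; apply: eq_integral => y _; rewrite !funeposE.
  apply: measurable_fun_fubini_tonelli_F => //; exact: measurable_funepos.
- rewrite (_ : (fun t => _) = fubini_F m2 ((EFin \o f)^\-)%E); last first.
    by apply/funext => t; apply: eq_integral => y _; rewrite !funenegE.
  apply: measurable_fun_fubini_tonelli_F => //; exact: measurable_funeneg.
Qed.

(** The shape in which the oscillatory integrals are exchanged later: integrable factors in separate
    variables and a bounded kernel, so that M |psi| |g| is an integrable majorant on the product. *)
Lemma Rintegral_fubini (psi : T1 -> R) (g : T2 -> R) (B : T1 * T2 -> R) (M : R) :
  m1.-integrable setT (EFin \o psi) -> m2.-integrable setT (EFin \o g) ->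
  measurable_fun setT B -> (forall z, `|B z| <= M) ->
  Rintegral m1 setT (fun t => psi t * Rintegral m2 setT (fun s => g s * B (t, s)))
  = Rintegral m2 setT (fun s => g s * Rintegral m1 setT (fun t => psi t * B (t, s))).
Proof.
move=> ip ig mB BM.
have mp : measurable_fun setT psi by exact/measurable_EFinP/(measurable_int _ ip).
have mg : measurable_fun setT g by exact/measurable_EFinP/(measurable_int _ ig).
have M0 : 0 <= M by exact: le_trans (normr_ge0 _) (BM (point, point)).
pose f (z : T1 * T2) := (psi z.1 * (g z.2 * B z))%:E.
have mf : measurable_fun setT f.
  apply/measurable_EFinP; apply: measurable_funM; first exact: measurableT_comp.
  by apply: measurable_funM => //; exact: measurableT_comp.
have i1 s : m1.-integrable setT (fun t => (psi t * B (t, s))%:E).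
  apply: (@le_integrable _ _ _ m1 _ _ _ (fun t => M%:E * (psi t)%:E)%E) => //.
  - apply/measurable_EFinP; apply: measurable_funM => //.
    exact: (measurableT_comp mB (pair2_measurable _)).
  - move=> t _; rewrite abse_EFin -EFinM abse_EFin lee_fin !normrM mulrC ler_wpM2r //.
    by rewrite (ger0_norm M0).
  - exact: integrableZl.
have i2 t : m2.-integrable setT (fun s => (g s * B (t, s))%:E).
  apply: (@le_integrable _ _ _ m2 _ _ _ (fun t => M%:E * (g t)%:E)%E) => //.
  - apply/measurable_EFinP; apply: measurable_funM => //.
    exact: (measurableT_comp mB (pair1_measurable _)).
  - move=> s _; rewrite abse_EFin -EFinM abse_EFin lee_fin !normrM mulrC ler_wpM2r //.
    by rewrite (ger0_norm M0).
  - exact: integrableZl.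
have intf : (m1 \x m2)%E.-integrable setT f.
  apply/(integrable12ltyP _ _ mf).
  apply: (@le_lt_trans _ _ (\int[m1]_t \int[m2]_s (`|psi t * (M * g s)|%:E)))%E.
    apply: ge0_le_integral => //.
    - by move=> t _; exact: integral_ge0.
    - apply: (measurable_fun_fubini_tonelli_F (fun z => abse (f z))) => //.
      exact: measurableT_comp.
    - apply: (measurable_fun_fubini_tonelli_F (fun z => `|psi z.1 * (M * g z.2)|%:E)) => //.
      apply/measurable_EFinP; apply: measurableT_comp => //; apply: measurable_funM.
        exact: measurableT_comp.
      by apply: measurable_funM => //; exact: measurableT_comp.
    - move=> t _; apply: ge0_le_integral => //.
      + apply: measurableT_comp => //.
        exact: (measurableT_comp mf (pair1_measurable _)).
      + apply/measurable_EFinP; apply: measurableT_comp => //; apply: measurable_funM => //.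
        by apply: measurable_funM.
      + move=> s _; rewrite /f /= lee_fin !normrM ler_wpM2l // mulrC ler_wpM2r //.
        by rewrite (ger0_norm M0).
  have -> : (\int[m1]_t \int[m2]_s (`|psi t * (M * g s)|%:E) =
    \int[m1]_t ((\int[m2]_s (`|M * g s|%:E)) * `|psi t|%:E))%E.
    apply: eq_integral => t _.
    rewrite muleC -ge0_integralZl //.
    - by apply: eq_integral => s _; rewrite normrM EFinM.
    - apply/measurable_EFinP; apply: measurableT_comp => //; exact: measurable_funM.
  rewrite ge0_integralZl //; last 2 first.
    - by apply/measurable_EFinP; apply: measurableT_comp.
    - exact: integral_ge0.
  have Mg : m2.-integrable setT (fun s => (M%:E * (g s)%:E)%E) by exact: integrableZl.
  move/integrableP: Mg => [_ Mg]; move/integrableP: ip => [_ ip].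
  rewrite lte_mul_pinfty //.
    exact: integral_ge0.
  by rewrite ge0_fin_numE //; exact: integral_ge0.
have := Fubini intf.
rewrite /Rintegral => E; congr fine.
transitivity (\int[m1]_x \int[m2]_y f (x, y))%E.
  apply: eq_integral => t _.
  rewrite EFinM fineK; last by apply: integrable_fin_num.
  rewrite -integralZl //.
rewrite E; apply: eq_integral => s _.
rewrite EFinM fineK; last by apply: integrable_fin_num.
rewrite -integralZl //; apply: eq_integral => t _.
by rewrite /f /= -EFinM mulrCA.
Qed.

End ParametricIntegrals.

(** * Kernels with prescribed Fourier transforms *)

Section Japanese.
Context {R : realType}.
Notation mu := (@lebesgue_measure R).

(** The inverse square of the Japanese bracket. It is the common majorant of all estimates because
    both its integral and its sums over integer translates are bounded. *)
Definition jap (t : R) : R := (1 + t ^+ 2)^-1.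

Lemma jap_gt0 t : 0 < jap t.
Proof. by rewrite invr_gt0 ltr_pwDl // sqr_ge0. Qed.

Lemma jap_ge0 t : 0 <= jap t. Proof. exact/ltW/jap_gt0. Qed.

Lemma jap_le1 t : jap t <= 1.
Proof. by rewrite invf_le1 ?lerDl ?sqr_ge0 // ltr_pwDl // sqr_ge0. Qed.

Lemma japN t : jap (- t) = jap t. Proof. by rewrite /jap sqrrN. Qed.

Lemma measurable_jap {d} {T : measurableType d} (f : T -> R) :
  measurable_fun setT f -> measurable_fun setT (fun x => jap (f x)).
Proof.
move=> mf; apply: measurable_funV; apply: measurable_funD => //.
exact: measurable_funX.
Qed.

Lemma integral_jap : (\int[mu]_t (jap t)%:E = pi%:E)%E.
Proof.
rewrite ge0_symfun_integralT //; last 3 first.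
- exact: jap_ge0.
- by move=> x; exact: continuous_oneDsqrV.
- by move=> t /=; rewrite japN.
rewrite -set_itvcy integral0y_oneDsqr -EFinM; congr EFin.
by rewrite mulrC divfK.
Qed.

Lemma integrable_jap : mu.-integrable setT (EFin \o jap).
Proof.
apply/integrableP; split; first exact/measurable_EFinP/measurable_jap.
under eq_integral => t _ do rewrite /= ger0_norm ?jap_ge0 //.
by rewrite integral_jap ltry.
Qed.

Lemma integral_jap_affine (a b : R) : a != 0 ->
  (\int[mu]_t (jap (a * t + b))%:E = (pi / `|a|)%:E)%E.
Proof.
move=> a0; have a1 : `|a| != 0 by rewrite normr_eq0.
have mj : measurable_fun setT (EFin \o jap) by exact/measurable_EFinP/measurable_jap.
have E := ge0_integral_affine b a0 mj (fun t => jap_ge0 t).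
rewrite integral_jap in E.
by rewrite mulrC EFinM E muleA -EFinM mulVf // mul1e.
Qed.

(* Comparison with the telescoping sum of [t / (1 + |t|)]. *)
Lemma sum_jap_le (A : R) (n : nat) : \sum_(i < n) jap (A - i%:R) <= 8.
Proof.
pose phi (t : R) := t / (1 + `|t|).
have phi1 t : `|phi t| <= 1.
  rewrite normrM normfV (ger0_norm (_ : 0 <= 1 + `|t|)) ?addr_ge0 //.
  by rewrite ler_pdivrMr ?mul1r ?lerDr // ltr_pwDl.
have step t : jap t <= 4 * (phi (t + 1) - phi t).
  have q : 0 < 1 + t ^+ 2 by rewrite ltr_pwDl // sqr_ge0.
  rewrite /jap /phi; have [t0|t0] := leP 0 t.
    rewrite (ger0_norm t0) ger0_norm ?addr_ge0 //.
    have -> : (t + 1) / (1 + (t + 1)) - t / (1 + t) = ((1 + t) * (2 + t))^-1.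
      by field; rewrite !gt_eqF //; lra.
    rewrite ler_pdivlMr ?mulr_gt0 //; try lra; rewrite ler_pdivrMl //; nra.
  have [t1|t1] := leP t (-1).
    rewrite (ltr0_norm t0) ler0_norm; last by lra.
    have [s [tE s1]] : exists s, t = - s /\ 1 <= s by exists (- t); lra.
    have -> : (t + 1) / (1 - (t + 1)) - t / (1 - t) = ((1 + s) * s)^-1.
      by rewrite tE; field; rewrite !gt_eqF //; lra.
    rewrite tE sqrrN ler_pdivlMr ?mulr_gt0 //; try lra; rewrite ler_pdivrMl; nra.
  rewrite (ltr0_norm t0) gtr0_norm; last by lra.
  have -> : (t + 1) / (1 + (t + 1)) - t / (1 - t) = (1 - 2 * t - 2 * t ^+ 2) / ((2 + t) * (1 - t)).
    by field; rewrite !gt_eqF //; lra.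
  rewrite mulrA ler_pdivlMr ?mulr_gt0 //; try lra.
  rewrite ler_pdivrMl //; nra.
suff H : \sum_(i < n) jap (A - i%:R) <= 4 * (phi (n%:R - A) - phi (- A)).
  apply: (le_trans H); have := phi1 (n%:R - A); have := phi1 (- A).
  by rewrite !ler_norml; lra.
elim: n => [|n IH]; first by rewrite big_ord0 sub0r subrr mulr0.
rewrite big_ord_recr /=.
have := step (n%:R - A); rewrite -japN opprB => s.
have -> : n.+1%:R - A = n%:R - A + 1 by rewrite -natr1; ring.
lra.
Qed.

End Japanese.

Section SineBounds.
Context {R : realType}.

Lemma sin_le_id (x : R) : `|sin x| <= `|x|.
Proof.
wlog x0 : x / 0 <= x.
  move=> H; have [/H //|x0] := leP 0 x.
  by have := H (- x); rewrite sinN !normrN; apply; rewrite oppr_ge0 ltW.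
have [xle0|x0'] := leP x 0.
  have -> : x = 0 by apply/eqP; rewrite eq_le xle0 x0.
  by rewrite sin0.
have [c _] := @MVT R sin cos 0 x x0' (fun y _ => is_derive_sin y)
  (continuous_subspaceT (@continuous_sin R)).
rewrite sin0 !subr0 => ->; rewrite normrM.
by rewrite -[leRHS]mul1r ler_wpM2r // cos_max.
Qed.

Lemma one_sub_cos (x : R) : 1 - cos x = 2 * sin (x / 2) ^+ 2.
Proof.
have {1}-> : x = (x / 2) *+ 2 by rewrite -mulr_natr divfK.
rewrite cos_mulr2n cos2sin2 mulr2n; ring.
Qed.

Lemma one_sub_cos_le_sqr (x : R) : 1 - cos x <= x ^+ 2 / 2.
Proof.
rewrite one_sub_cos; have := sin_le_id (x / 2).
move=> h; have : sin (x / 2) ^+ 2 <= (x / 2) ^+ 2.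
  by rewrite -(real_normK (num_real (sin _))) -(real_normK (num_real (x / 2))) ler_sqr ?nnegrE.
lra.
Qed.

End SineBounds.

(** * Fourier transforms of real kernels at one frequency; the Fejer kernel *)

Section FourierAt.
Context {R : realType}.
Notation mu := (@lebesgue_measure R).

Lemma integrable_bounded_mul {d} {T : measurableType d} (m : {measure set T -> \bar R})
    (psi B : T -> R) (M : R) :
  m.-integrable setT (EFin \o psi) -> measurable_fun setT B ->
  (forall t, `|B t| <= M) -> m.-integrable setT (fun t => (psi t * B t)%:E).
Proof.
move=> ip mB BM.
have mp : measurable_fun setT psi by exact/measurable_EFinP/(measurable_int _ ip).
apply: (@le_integrable _ _ _ m _ _ _ (fun t => M%:E * (psi t)%:E)%E) => //.
- by apply/measurable_EFinP; apply: measurable_funM.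
- move=> t _; rewrite abse_EFin -EFinM abse_EFin lee_fin !normrM mulrC ler_wpM2r //.
  by rewrite (le_trans (BM t)) // ler_norm.
- exact: integrableZl.
Qed.

Lemma integrable_scale {d} {T : measurableType d} (m : {measure set T -> \bar R})
    (k : R) (f : T -> R) : m.-integrable setT (EFin \o f) ->
  m.-integrable setT (EFin \o (fun t => k * f t)).
Proof. exact: integrableZl. Qed.

(** Says that the integral of psi(t) exp(i t w) equals the real number [c]. Letting the phase [th]
    vary encodes the real and the imaginary part at once, and is the form in which the identity is
    substituted into waves. *)
Definition ftat (psi : R -> R) (w c : R) := forall th : R,
  Rintegral mu setT (fun t => psi t * cos (th + t * w)) = c * cos th.

Lemma Rintegral_odd (f : R -> R) : mu.-integrable setT (EFin \o f) ->
  (forall t, f (- t) = - f t) -> Rintegral mu setT f = 0.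
Proof.
move=> intf fodd.
have mf : measurable_fun setT (EFin \o f) := measurable_int _ intf.
rewrite /Rintegral integralE.
have -> : (\int[mu]_t (EFin \o f)^\+ t = \int[mu]_t (EFin \o f)^\- t)%E.
  have n1 : -1 != 0 :> R by rewrite oppr_eq0 oner_eq0.
  rewrite (ge0_integral_affine 0 n1) //; last exact: measurable_funepos.
  rewrite normrN1 mul1e; apply: eq_integral => t _.
  by rewrite funeposE funenegE /= addr0 mulN1r fodd EFinN.
have := integrable_neg_fin_num measurableT intf.
by move=> h; rewrite subee.
Qed.

(** Evenness kills the sine part, so one cosine integral decides the transform at [w]. *)
Lemma ftat_even (psi : R -> R) (w c : R) : mu.-integrable setT (EFin \o psi) ->
  (forall t, psi (- t) = psi t) ->
  Rintegral mu setT (fun t => psi t * cos (t * w)) = c -> ftat psi w c.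
Proof.
move=> ip pe <- th.
have mw : measurable_fun setT (fun t : R => t * w) by exact: measurable_funM.
have ic : mu.-integrable setT (fun t => (psi t * cos (t * w))%:E).
  apply: (@integrable_bounded_mul _ _ _ _ _ 1) => //; first exact: measurable_funcos.
  by move=> t; exact: cos_max.
have isn : mu.-integrable setT (fun t => (psi t * sin (t * w))%:E).
  apply: (@integrable_bounded_mul _ _ _ _ _ 1) => //; first exact: measurable_funsin.
  by move=> t; exact: sin_max.
transitivity (Rintegral mu setT (fun t => cos th * (psi t * cos (t * w)) - sin th * (psi t * sin (t * w)))).
  by apply: eq_Rintegral => t _; rewrite cosD; ring.
rewrite RintegralB //; try by exact: integrable_scale.
rewrite RintegralZl // RintegralZl // (@Rintegral_odd (fun t => psi t * sin (t * w))) //.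
  by rewrite mulr0 subr0 mulrC.
by move=> t; rewrite pe mulNr sinN mulrN.
Qed.

Lemma ftat_lin (psi phi : R -> R) (a b w c c' : R) :
  mu.-integrable setT (EFin \o psi) -> mu.-integrable setT (EFin \o phi) ->
  ftat psi w c -> ftat phi w c' -> ftat (fun t => a * psi t + b * phi t) w (a * c + b * c').
Proof.
move=> ip iq hp hq th.
have mw : measurable_fun setT (fun t : R => th + t * w).
  by apply: measurable_funD => //; exact: measurable_funM.
have ic : mu.-integrable setT (fun t => (psi t * cos (th + t * w))%:E).
  apply: (@integrable_bounded_mul _ _ _ _ _ 1) => //; first exact: measurable_funcos.
  by move=> t; exact: cos_max.
have ic' : mu.-integrable setT (fun t => (phi t * cos (th + t * w))%:E).
  apply: (@integrable_bounded_mul _ _ _ _ _ 1) => //; first exact: measurable_funcos.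
  by move=> t; exact: cos_max.
transitivity (Rintegral mu setT (fun t => a * (psi t * cos (th + t * w)) + b * (phi t * cos (th + t * w)))).
  by apply: eq_Rintegral => t _; ring.
rewrite RintegralD //; try by exact: integrable_scale.
by rewrite RintegralZl // RintegralZl // hp hq; ring.
Qed.

(** The unnormalised Fejer kernel, whose transform is a tent of half-width |s|. The division
    convention gives it the value 0 at t = 0 instead of s^2 / 2; [ftat_sinc] relies on this
    value. *)
Definition fejer (s t : R) : R := (1 - cos (s * t)) / t ^+ 2.

Lemma fejer_ge0 s t : 0 <= fejer s t.
Proof. by rewrite divr_ge0 ?sqr_ge0 // subr_ge0 cos_le1. Qed.

Lemma fejerN s t : fejer s (- t) = fejer s t.
Proof. by rewrite /fejer mulrN cosN sqrrN. Qed.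

Lemma fejer0 s : fejer s 0 = 0.
Proof. by rewrite /fejer expr0n /= invr0 mulr0. Qed.

Lemma fejer_le s t : fejer s t <= (s ^+ 2 / 2 + 2) * jap t.
Proof.
have [->|t0] := eqVneq t 0.
  rewrite fejer0 mulr_ge0 ?jap_ge0 // addr_ge0 //.
  by rewrite divr_ge0 // sqr_ge0.
have t2 : 0 < t ^+ 2 by rewrite exprn_even_gt0.
rewrite /jap ler_pdivlMr; last by rewrite ltr_pwDl // sqr_ge0.
rewrite /fejer mulrDr mulr1 divfK ?gt_eqF // lerD //.
  rewrite ler_pdivrMr //; have := one_sub_cos_le_sqr (s * t).
  by rewrite exprMn mulrAC.
have := cos_geN1 (s * t); lra.
Qed.

Lemma measurable_fejer s : measurable_fun setT (fejer s).
Proof.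
apply: measurable_funM.
  apply: measurable_funB => //; apply: measurable_funcos; exact: measurable_funM.
by apply: measurable_funV; exact: measurable_funX.
Qed.

Lemma integrable_fejer s : mu.-integrable setT (EFin \o fejer s).
Proof.
apply: (@le_integrable _ _ _ mu _ _ _ (fun t => (s ^+ 2 / 2 + 2)%:E * (jap t)%:E)%E) => //.
- by apply/measurable_EFinP; exact: measurable_fejer.
- move=> t _; rewrite abse_EFin -EFinM abse_EFin lee_fin !ger0_norm ?fejer_ge0 ?fejer_le //.
  by rewrite (le_trans (fejer_ge0 s t)) // fejer_le.
- by apply: integrableZl => //; exact: integrable_jap.
Qed.

Definition fejer_mass : R := Rintegral mu setT (fejer 1).

Lemma fejer_massE : fejer_mass%:E = (\int[mu]_t (fejer 1 t)%:E)%E.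
Proof. by rewrite /fejer_mass /Rintegral fineK // integrable_fin_num //; exact: integrable_fejer. Qed.

Lemma cos_le_cos1 (t : R) : 1 <= t <= 2 -> cos t <= cos 1.
Proof.
move=> /andP[t1 t2]; have := @pi_ge2 R => p2.
have [->//|t1'] := eqVneq t 1.
apply/ltW; rewrite ltr_cos ?in_itv /=; first by rewrite lt_neqAle eq_sym t1' t1.
  by apply/andP; split; lra.
by apply/andP; split; lra.
Qed.

Lemma fejer_lower (t : R) : 1 <= t <= 2 -> (1 - cos 1) / 4 <= fejer 1 t.
Proof.
move=> t12; have := cos_le_cos1 t12; have := cos_le1 (1 : R).
move: t12 => /andP[t1 t2] c1 ct.
rewrite /fejer mul1r ler_pdivlMr ?exprn_gt0 //; last by lra.
have : t ^+ 2 <= 4 by nra.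
nra.
Qed.

Lemma cos1_lt1 : cos 1 < 1 :> R.
Proof.
have := @pi_ge2 R => p2.
rewrite -[ltRHS]cos0 ltr_cos ?in_itv /= ?ltr01 //; by apply/andP; split; lra.
Qed.

(** The interval [1, 2] already contributes a positive amount, since 2 <= pi keeps cos t <= cos 1 <
    1 there. Positivity is what allows kernels to be normalised by [fejer_mass]. *)
Lemma fejer_mass_gt0 : 0 < fejer_mass.
Proof.
have c1 := cos1_lt1.
have q : 0 < (1 - cos 1) / 4 :> R by lra.
apply: (lt_le_trans q); rewrite -lee_fin fejer_massE.
have -> : ((1 - cos 1) / 4)%:E = (\int[mu]_(t in `[1%R, 2%R]) ((1 - cos 1) / 4)%:E)%E.
  rewrite integral_cst //= lebesgue_measure_itv /= lte_fin ltr1n -EFinD -EFinM.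
  by congr EFin; ring.
apply: (@le_trans _ _ (\int[mu]_(t in `[1%R, 2%R]) (fejer 1 t)%:E)%E).
  apply: ge0_le_integral => //.
  - apply/measurable_EFinP; apply: measurable_funTS; exact: measurable_fejer.
  - by move=> t /=; rewrite in_itv /= => h; rewrite lee_fin fejer_lower.
apply: ge0_subset_integral => //.
  apply/measurable_EFinP; exact: measurable_fejer.
by move=> t _; rewrite lee_fin fejer_ge0.
Qed.

Lemma Rintegral_fejer s : Rintegral mu setT (fejer s) = `|s| * fejer_mass.
Proof.
have [->|s0] := eqVneq s 0.
  rewrite normr0 mul0r /Rintegral integral0_eq // => t _.
  by rewrite /fejer mul0r cos0 subrr mul0r.
have s1 : `|s| != 0 by rewrite normr_eq0.
have mF : measurable_fun setT (EFin \o fejer 1) by apply/measurable_EFinP; exact: measurable_fejer.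
have E := ge0_integral_affine 0 s0 mF (fun t => fejer_ge0 1 t).
apply: EFin_inj; rewrite EFinM fejer_massE.
rewrite /Rintegral fineK; last by apply: integrable_fin_num => //; exact: integrable_fejer.
transitivity (\int[mu]_t ((s ^+ 2)%:E * (EFin \o fejer 1) (s * t + 0)%R))%E.
  apply: eq_integral => t _; rewrite /= addr0 -EFinM; congr EFin.
  have sK : s ^+ 2 / s ^+ 2 = 1 by rewrite divff // expf_neq0.
  rewrite /fejer mul1r exprMn (invfM (s ^+ 2) (t ^+ 2)).
  transitivity (s ^+ 2 / s ^+ 2 * ((1 - cos (s * t)) * t ^- 2)); first by rewrite sK mul1r.
  by rewrite -mulrA; congr (_ * _); exact: mulrCA.
rewrite ge0_integralZl //; last 3 first.
- apply: (measurableT_comp mF); exact: measurable_affine.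
- by move=> t _; rewrite lee_fin fejer_ge0.
- by rewrite lee_fin sqr_ge0.
rewrite [in RHS]E muleA -EFinM -normrM ger0_norm -?expr2 //.
exact: sqr_ge0.
Qed.

(** The product-to-sum formula turns (1 - cos(s t)) cos(w t) into a combination of three numerators
    of the same kind, with parameters s + w, s - w and w; each integral is then known by scaling.
    For s > 0 the result is [fejer_mass] times the positive part of s - |w|. *)
Lemma ftat_fejer s w :
  ftat (fejer s) w (fejer_mass * ((`|s + w| + `|s - w|) / 2 - `|w|)).
Proof.
apply: ftat_even; [exact: integrable_fejer|exact: fejerN|].
transitivity (Rintegral mu setT (fun t =>
    2^-1 * (fejer (s + w) t + fejer (s - w) t) - fejer w t)).
  apply: eq_Rintegral => t _; rewrite /fejer.
  rewrite (mulrDl s w t) (mulrBl t s w) cosD cosB [w * t]mulrC.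
  by move: (t ^+ 2)^-1 => u; field.
have i1 := integrable_fejer (s + w); have i2 := integrable_fejer (s - w).
have i3 : mu.-integrable setT (EFin \o (fun t => fejer (s + w) t + fejer (s - w) t)).
  exact: (integrableD measurableT i1 i2).
rewrite RintegralB //; last 2 first.
- exact: integrable_scale.
- exact: integrable_fejer.
rewrite RintegralZl // RintegralD //.
by rewrite !Rintegral_fejer; field.

Qed.

End FourierAt.

(** * Rapidly decaying kernels: one with a plateau, one with compact spectrum *)

Section Kernels.
Context {R : realType}.
Notation mu := (@lebesgue_measure R).

Definition sinc (b t : R) : R := sin (b * t) / (b * t).

Lemma sinc_le1 b t : `|sinc b t| <= 1.
Proof.
rewrite /sinc normrM normfV; have [->|bt0] := eqVneq (b * t) 0.
  by rewrite normr0 invr0 mulr0.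
by rewrite ler_pdivrMr ?normr_gt0 // mul1r sin_le_id.
Qed.

Lemma measurable_sinc b : measurable_fun setT (sinc b).
Proof.
apply: measurable_funM; first by apply: measurable_funsin; exact: measurable_funM.
by apply: measurable_funV; exact: measurable_funM.
Qed.

Lemma sinc_decay b t : 0 < b -> `|sinc b t| * (1 + `|t|) <= 1 + b^-1.
Proof.
move=> b0; rewrite mulrDr mulr1 lerD ?sinc_le1 //.
have [->|t0] := eqVneq t 0; first by rewrite normr0 mulr0 invr_ge0 ltW.
rewrite /sinc normrM normfV normrM (gtr0_norm b0).
have -> : `|sin (b * t)| / (b * `|t|) * `|t| = `|sin (b * t)| * b^-1.
  by field; rewrite normr_eq0 t0 gt_eqF.
by rewrite ler_piMl ?invr_ge0 ?sin_max // ltW.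
Qed.

Lemma integral_cos_sym (b t : R) : 0 < b -> t != 0 ->
  Rintegral mu `[- b, b] (fun s => cos (t * s)) = 2 * b * sinc b t.
Proof.
move=> b0 t0.
have dF (x : R) : is_derive x (1 : R) (fun s => sin (t * s) / t) (cos (t * x)).
  have d1 : is_derive x (1 : R) (t \*: (@id R)) (t *: 1) by apply: is_deriveZ; exact: is_derive_id.
  have d2 := @is_derive1_comp R sin (t \*: (@id R)) x _ _ (is_derive_sin (t *: x)) d1.
  have d3 := is_deriveZ t^-1 d2.
  have -> : (fun s => sin (t * s) / t) = t^-1 \*: (sin \o (t \*: (@id R))).
    by apply/funext => s; rewrite mulrC.
  apply: (is_derive_eq d3).
  by rewrite /GRing.scale /=; field.
have cF : continuous (fun s : R => sin (t * s) / t).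
  move=> x; apply/differentiable_continuous/derivable1_diffP.
  by have h := dF x; exact: ex_derive.
have cf : continuous (fun s => cos (t * s)).
  by move=> x; apply: continuous_comp; [exact: mulrl_continuous|exact: continuous_cos].
rewrite /Rintegral (@continuous_FTC2 _ _ (fun s => sin (t * s) / t)) /=.
- rewrite /sinc mulrN sinN [t * b]mulrC; field.
  by rewrite t0 gt_eqF.
- lra.
- exact: continuous_subspaceT.
- split.
  + by move=> x _; exact: ex_derive.
  + apply: cvg_at_right_filter; exact: cF.
  + apply: cvg_at_left_filter; exact: cF.
- by move=> x _; rewrite derive1E; exact: derive_val.
Qed.

(* [sinc b t] is the average of [cos (t * s)] over [s] in [[-b, b]], so multiplying by it
   averages the Fourier transform over a window of radius [b]. *)
Lemma ftat_sinc (psi : R -> R) (b w c : R) : 0 < b -> psi 0 = 0 ->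
  mu.-integrable setT (EFin \o psi) ->
  (forall w', `|w' - w| <= b -> ftat psi w' c) ->
  ftat (fun t => psi t * sinc b t) w c.
Proof.
move=> b0 psi0 ip hp th.
set I := `[- b, b]%classic.
have mI : measurable (I : set (measurableTypeR R)) by exact: measurable_itv.
have lI : mu I = (2 * b)%:E.
  rewrite /I lebesgue_measure_itv /= lte_fin ifT ?gtrN // -EFinD.
  by congr EFin; ring.
have i1 : mu.-integrable setT (EFin \o (\1_I : R -> R)).
  apply/integrableP; split; first by apply/measurable_EFinP; exact: measurable_indic.
  under eq_integral => t _ do rewrite /= ger0_norm //.
  rewrite integral_indic // setIT.
  by have := ltry (2 * b); rewrite -lI.
pose g (s : R) : R := (2 * b)^-1 * \1_I s.
have ig : mu.-integrable setT (EFin \o g) by exact: integrable_scale.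
pose B (z : R * R) : R := cos (z.1 * z.2) * cos (th + z.1 * w).
have mB : measurable_fun setT B.
  apply: measurable_funM; apply: measurable_funcos.
    exact: measurable_funM.
  by apply: measurable_funD => //; exact: measurable_funM.
have BM z : `|B z| <= 1.
  by rewrite normrM -[leRHS]mulr1 ler_pM // cos_max.
transitivity (Rintegral mu setT (fun t => psi t * Rintegral mu setT (fun s => g s * B (t, s)))).
  apply: eq_Rintegral => t _; rewrite -mulrA.
  (* At t = 0 the convention 0 / 0 = 0 makes [sinc] vanish although the average of the cosine is 1;
     [psi 0 = 0] makes both sides agree there. *)
  have [->|t0] := eqVneq t 0; first by rewrite psi0 !mul0r.
  congr (_ * _).
  have it : mu.-integrable setT (EFin \o (fun s => \1_I s * cos (t * s))).
    apply: (@integrable_bounded_mul _ _ _ _ _ _ 1) => //; last by move=> s; exact: cos_max.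
    by apply: measurable_funcos; exact: measurable_funM.
  transitivity (Rintegral mu setT (fun s => (2 * b)^-1 * cos (th + t * w) * (\1_I s * cos (t * s)))).
    rewrite RintegralZl //.
    have -> : Rintegral mu setT (fun s => \1_I s * cos (t * s)) = 2 * b * sinc b t.
      rewrite -integral_cos_sym // [RHS]Rintegral_mkcond; apply: eq_Rintegral => s _.
      by rewrite /patch indicE -/I; case: ifP => _; rewrite ?mul1r ?mul0r.
    by field; rewrite gt_eqF.
  by apply: eq_Rintegral => s _; rewrite /g /B /=; ring.
rewrite (Rintegral_fubini ip ig mB BM).
transitivity (Rintegral mu setT (fun s => (c * cos th) * g s)).
  apply: eq_Rintegral => s _; rewrite /g indicE.
  have [sb|] := boolP (s \in I); last by rewrite !(mulr0, mul0r).
  rewrite mulr1 mulrC; congr (_ * _).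
  have /andP[s1 s2] : - b <= s <= b by move: sb; rewrite inE /I /= in_itv.
  have h1 : ftat psi (w + s) c by apply: hp; rewrite addrAC subrr add0r ler_norml s1 s2.
  have h2 : ftat psi (w - s) c.
    by apply: hp; rewrite addrAC subrr add0r normrN ler_norml s1 s2.
  have ii w' : mu.-integrable setT (EFin \o (fun t => psi t * cos (th + t * w'))).
    apply: (@integrable_bounded_mul _ _ _ _ _ _ 1) => //; last by move=> t; exact: cos_max.
    by apply: measurable_funcos; apply: measurable_funD => //; exact: measurable_funM.
  (* The product of cosines splits into the frequencies w + s and w - s, both inside the window
     where the transform is known to be [c]. *)
  transitivity (Rintegral mu setT (fun t => 2^-1 * (psi t * cos (th + t * (w + s)))
      + 2^-1 * (psi t * cos (th + t * (w - s))))).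
    apply: eq_Rintegral => t _; rewrite /B /=.
    have -> : th + t * (w + s) = (th + t * w) + t * s by ring.
    have -> : th + t * (w - s) = (th + t * w) - t * s by ring.
    by rewrite (cosD (th + t * w)) (cosB (th + t * w)); field.
  rewrite RintegralD //; try by exact: integrable_scale.
  by rewrite RintegralZl // RintegralZl // h1 h2; field.
rewrite RintegralZl // -[RHS]mulr1; congr (_ * _).
rewrite /g RintegralZl //.
rewrite /Rintegral integral_indic // setIT.
transitivity ((2 * b)^-1 * fine (mu I)); first by [].
by rewrite lI mulVf // gt_eqF // mulr_gt0.
Qed.

Lemma integrable_sinc_mul (psi : R -> R) (b : R) N :
  mu.-integrable setT (EFin \o psi) ->
  mu.-integrable setT (EFin \o (fun t => psi t * sinc b t ^+ N)).
Proof.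
move=> ip; apply: (@integrable_bounded_mul _ _ _ _ _ _ 1) => //.
  by apply: measurable_funX; exact: measurable_sinc.
by move=> t; rewrite normrX exprn_ile1 // sinc_le1.
Qed.

(** Each factor averages once more over a window of radius [b], so N factors consume a margin b N in
    frequency; in return each one gains a power of decay. *)
Lemma ftat_sincX (psi : R -> R) (b w c : R) N : 0 < b -> psi 0 = 0 ->
  mu.-integrable setT (EFin \o psi) ->
  (forall w', `|w' - w| <= b * N%:R -> ftat psi w' c) ->
  ftat (fun t => psi t * sinc b t ^+ N) w c.
Proof.
move=> b0 psi0 ip; elim: N w => [|N IH] w hp.
  have := hp w; rewrite subrr normr0 mulr0 lexx => /(_ isT) h th.
  by rewrite -h; apply: eq_Rintegral => t _; rewrite expr0 mulr1.
have -> : (fun t => psi t * sinc b t ^+ N.+1) = (fun t => (psi t * sinc b t ^+ N) * sinc b t).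
  by apply/funext => t; rewrite exprSr mulrA.
apply: ftat_sinc => //; first by rewrite psi0 mul0r.
  exact: integrable_sinc_mul.
move=> w' w'b; apply: IH => w'' h; apply: hp.
have -> : w'' - w = (w'' - w') + (w' - w) by ring.
by rewrite (le_trans (ler_normD _ _)) // -natr1 mulrDr mulr1 lerD.
Qed.

Lemma sincX_decay (b t : R) N : 0 < b ->
  `|sinc b t ^+ N| <= (1 + b^-1) ^+ N * ((1 + `|t|) ^+ N)^-1.
Proof.
move=> b0; have q : 0 < 1 + `|t| by rewrite ltr_pwDl.
rewrite ler_pdivlMr ?exprn_gt0 // normrX -exprMn lerXn2r ?nnegrE ?mulr_ge0 ?addr_ge0 ?invr_ge0 ?(ltW b0) //.
exact: sinc_decay.
Qed.

Lemma fejer_bounded (s t : R) : fejer s t <= s ^+ 2 / 2 + 2.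
Proof.
rewrite (le_trans (fejer_le s t)) // ler_piMr ?jap_le1 //.
by rewrite addr_ge0 // divr_ge0 // sqr_ge0.
Qed.

(** A de la Vallee Poussin kernel: the difference of the tents of half-widths 3 and 1 is constant on
    [-1, 1], and [a] normalises the constant to 1. The N sinc factors of width [b] shrink the
    plateau by b N < 1/2, which leaves [-1/2, 1/2]. *)
Lemma plateau_kernel (N : nat) : exists (psi : R -> R) (C : R),
  [/\ 0 < C, measurable_fun setT psi, mu.-integrable setT (EFin \o psi),
      forall t, `|psi t| <= C * ((1 + `|t|) ^+ N)^-1 &
      forall w, `|w| <= 2^-1 -> ftat psi w 1].
Proof.
pose b : R := (2 * N.+1%:R)^-1.
have b0 : 0 < b by rewrite invr_gt0 mulr_gt0.
have m0 : 0 < @fejer_mass R by exact: fejer_mass_gt0.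
pose a : R := (2 * @fejer_mass R)^-1.
pose psi0 (t : R) := a * fejer 3 t + (- a) * fejer 1 t.
have i0 : mu.-integrable setT (EFin \o psi0).
  have h s : mu.-integrable setT (EFin \o (fejer s : R -> R)) by exact: integrable_fejer.
  exact: (integrableD measurableT (integrable_scale a (h 3)) (integrable_scale (- a) (h 1))).
have psi00 : psi0 0 = 0 by rewrite /psi0 !fejer0 !mulr0 addr0.
pose C0 : R := `|a| * (3 ^+ 2 / 2 + 2) + `|a| * (1 ^+ 2 / 2 + 2).
have C00 : 0 <= C0.
  by rewrite addr_ge0 // mulr_ge0 // addr_ge0 // divr_ge0 // sqr_ge0.
have C0P t : `|psi0 t| <= C0.
  rewrite /psi0 (le_trans (ler_normD _ _)) // (normrM a) (normrM (- a)) normrN.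
  by rewrite (ger0_norm (fejer_ge0 3 t)) (ger0_norm (fejer_ge0 1 t)) lerD // ler_wpM2l // fejer_bounded.
exists (fun t => psi0 t * sinc b t ^+ N), ((C0 + 1) * (1 + b^-1) ^+ N); split.
- have := invr_gt0 b; rewrite b0 => bi.
  by apply: mulr_gt0; [lra|apply: exprn_gt0; lra].
- apply: measurable_funM; last by apply: measurable_funX; exact: measurable_sinc.
  by apply: measurable_funD; apply: measurable_funM => //; exact: measurable_fejer.
- exact: integrable_sinc_mul.
- move=> t; rewrite normrM -mulrA ler_pM //; last exact: sincX_decay.
  by rewrite (le_trans (C0P t)) // lerDl.
- move=> w wb; apply: ftat_sincX => // w' w'b.
  have w'1 : `|w'| <= 1.
    have -> : w' = (w' - w) + w by ring.
    rewrite (le_trans (ler_normD _ _)) //.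
    have : b * N%:R <= 2^-1.
      by rewrite /b invfM -mulrA ler_piMr // ler_pdivrMl // mulr1 ler_nat.
    lra.
  move: w'1; rewrite ler_norml => /andP[w1 w2].
  have h s : mu.-integrable setT (EFin \o (fejer s : R -> R)) by exact: integrable_fejer.
  have := ftat_lin a (- a) (h 3) (h 1) (ftat_fejer 3 w') (ftat_fejer 1 w').
  have -> : a * (@fejer_mass R * ((`|3 + w'| + `|3 - w'|) / 2 - `|w'|)) +
      - a * (@fejer_mass R * ((`|1 + w'| + `|1 - w'|) / 2 - `|w'|)) = 1.
    rewrite (@ger0_norm _ (3 + w')) ?(@ger0_norm _ (3 - w')) ?(@ger0_norm _ (1 + w'))
      ?(@ger0_norm _ (1 - w')); try lra.
    by rewrite /a; field; rewrite gt_eqF.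
  move=> H; exact: H.
Qed.

(** The even power M of sinc keeps the Fejer kernel nonnegative and, since M >= N, gives the decay.
    With b = 1 / M the averaging enlarges the spectrum from [-1, 1] to [-2, 2]. The lower bound is
    taken on [1, 2], where 1 - cos t and sin(b t) are both bounded below. *)
Lemma compact_kernel (N : nat) : exists (K : R -> R) (C c : R),
  [/\ [/\ 0 < C, 0 < c & measurable_fun setT K], forall t, 0 <= K t,
      forall t, K t <= C * ((1 + `|t|) ^+ N)^-1,
      forall t, 1 <= t <= 2 -> c <= K t &
      mu.-integrable setT (EFin \o K) /\ forall w, 2 <= `|w| -> ftat K w 0].
Proof.
pose M := N.+1.*2.
pose b : R := (M%:R)^-1.
have b0 : 0 < b by rewrite invr_gt0 ltr0n.
have iK : mu.-integrable setT (EFin \o (fejer 1 : R -> R)) by exact: integrable_fejer.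
have sb0 : 0 < sin b.
  apply: sin2_gt0; rewrite b0 /= (le_lt_trans _ (_ : 1 < 2)) ?ltr1n //.
  by rewrite invf_le1 ?ltr0n // ler1n.
exists (fun t => fejer 1 t * sinc b t ^+ M), ((1 ^+ 2 / 2 + 2) * (1 + b^-1) ^+ M),
  ((1 - cos 1) / 4 * (sin b / (2 * b)) ^+ M).
have Mev t : 0 <= sinc b t ^+ M by rewrite exprn_even_ge0 // /M odd_double.
split; first split.
- have := invr_gt0 b; rewrite b0 => bi.
  by apply: mulr_gt0; [lra|apply: exprn_gt0; lra].
- rewrite mulr_gt0 ?exprn_gt0 ?divr_gt0 ?mulr_gt0 // subr_gt0; exact: cos1_lt1.
- apply: measurable_funM; last by apply: measurable_funX; exact: measurable_sinc.
  exact: measurable_fejer.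
- by move=> t; rewrite mulr_ge0 // fejer_ge0.
- move=> t; rewrite -[leRHS]mulrA ler_pM ?fejer_ge0 ?fejer_bounded //.
  apply: (le_trans (ler_norm _)); apply: (le_trans (sincX_decay t M b0)).
  rewrite ler_wpM2l ?exprn_ge0 ?addr_ge0 ?invr_ge0 ?(ltW b0) //.
  rewrite lef_pV2 ?posrE ?exprn_gt0 ?ltr_pwDl // ler_weXn2l ?lerDl // /M -addnn; lia.
- move=> t t12; rewrite ler_pM ?exprn_ge0 ?divr_ge0 ?mulr_ge0 ?(ltW b0) ?(ltW sb0) ?subr_ge0 ?cos_le1 //.
    exact: fejer_lower.
  move: t12 => /andP[t1 t2].
  have t0 : 0 < t by lra.
  have p2 := @pihalf_ge1 R.
  (* This keeps b t in [b, 1] for t in [1, 2], a range where sine increases, so that sinc is at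
     least sin b / (2 b). *)
  have bh : b <= 2^-1.
    by rewrite /b lef_pV2 ?posrE ?ltr0n // ler_nat /M doubleS.
  have bt : b <= b * t <= 1 by apply/andP; split; nra.
  have sbt : sin b <= sin (b * t).
    have [<-//|ne] := eqVneq b (b * t).
    apply/ltW; rewrite ltr_sin ?in_itv /=; first by rewrite lt_neqAle ne; case/andP: bt.
      by apply/andP; split; lra.
    by move: bt => /andP[? ?]; apply/andP; split; lra.
  rewrite lerXn2r ?nnegrE ?divr_ge0 ?mulr_ge0 ?(ltW b0) ?(ltW sb0) ?(ltW t0) //.
    exact: le_trans (ltW sb0) sbt.
  rewrite /sinc ler_pM ?(ltW sb0) ?invr_ge0 ?mulr_ge0 ?(ltW b0) //.
  by rewrite lef_pV2 ?posrE ?mulr_gt0 // mulrC ler_wpM2r ?(ltW b0).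
- split; first exact: integrable_sinc_mul.
  move=> w w2; apply: ftat_sincX => //; first exact: fejer0.
  move=> w' w'b.
  have w'1 : 1 <= `|w'|.
    move: w'b; rewrite /b mulVf ?pnatr_eq0 // => w'b.
    have : `|w| <= `|w'| + `|w' - w|.
      have {1}-> : w = w' - (w' - w) by ring.
      exact: ler_normB.
    lra.
  have := ftat_fejer 1 w'.
  have -> // : @fejer_mass R * ((`|1 + w'| + `|1 - w'|) / 2 - `|w'|) = 0 :> R.
  have [w0|w0] := leP 0 w'.
    have e : `|w'| = w' by exact: ger0_norm.
    have e1 : `|1 + w'| = 1 + w' by apply: ger0_norm; lra.
    have e2 : `|1 - w'| = - (1 - w') by apply: ler0_norm; lra.
    by rewrite e1 e2 e; field.
  have e : `|w'| = - w' by exact: ltr0_norm.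
  have e1 : `|1 + w'| = - (1 + w') by apply: ler0_norm; lra.
  have e2 : `|1 - w'| = 1 - w' by apply: ger0_norm; lra.
  by rewrite e1 e2 e; field.
Qed.

End Kernels.

(** * Inverse Fourier transforms *)

Section Waves.
Context {R : realType}.
Notation mu := (@lebesgue_measure R).
Notation leb2 := (@leb2 R).
Implicit Types (a b u v : R * R -> R) (x z : R * R).

Lemma sigma_finite_leb2 : sigma_finite setT leb2.
Proof.
have /sigma_finiteP[F [TF ndF Foo]] := sigma_finiteT mu.
exists (fun n => F n `*` F n).
  rewrite -setXTT TF predeqE => -[x y]; split.
    move=> [/= [n _ Fnx] [k _ Fky]]; exists (maxn n k) => //; split.
    - by move: x Fnx; exact/subsetPset/ndF/leq_maxl.
    - by move: y Fky; exact/subsetPset/ndF/leq_maxr.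
  by move=> [n _ []/= ? ?]; split; exists n.
move=> k; have [? ?] := Foo k.
split; first exact: measurableX.
by rewrite /leb2 product_measure1E// lte_mul_pinfty// ge0_fin_numE.
Qed.

(** [leb2] packaged with its sigma-finiteness, so that Tonelli and Fubini apply when the plane is
    one of the two factors. *)
Definition sleb2 : {sigma_finite_measure set (measurableTypeR R * measurableTypeR R)%type -> \bar R} :=
  HB.pack (mu \x mu)%E (Measure_isSigmaFinite.Build _ _ _ (mu \x mu)%E sigma_finite_leb2).

Definition translate x z (t : R) : R * R := (x.1 + t * z.1, x.2 + t * z.2).

Lemma measurable_translate1 {d} {T : measurableType d} x z (f : T -> R) :
  measurable_fun setT f -> measurable_fun setT (fst \o (fun w => translate x z (f w))).
Proof. by move=> mf; apply: measurable_funD => //; exact: measurable_funM. Qed.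

Lemma measurable_translate2 {d} {T : measurableType d} x z (f : T -> R) :
  measurable_fun setT f -> measurable_fun setT (snd \o (fun w => translate x z (f w))).
Proof. by move=> mf; apply: measurable_funD => //; exact: measurable_funM. Qed.

Definition phase (x xi : R * R) : R := 2 * pi * dot2 x xi.

Lemma phase_translate x z t xi :
  phase (translate x z t) xi = phase x xi + t * phase z xi.
Proof. by rewrite /phase /dot2 /=; ring. Qed.

Lemma measurable_phase {d} {T : measurableType d} (f g : T -> R * R) :
  measurable_fun setT (fst \o f) -> measurable_fun setT (snd \o f) ->
  measurable_fun setT (fst \o g) -> measurable_fun setT (snd \o g) ->
  measurable_fun setT (fun t => phase (f t) (g t)).
Proof.
move=> f1 f2 g1 g2; apply: measurable_funM => //.
by apply: measurable_funD; apply: measurable_funM.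
Qed.

(** The real part of exp(i al) times the inverse Fourier transform of the real function [a]. The
    phase -pi/2 yields the imaginary part. *)
Definition osc a x (al : R) : R :=
  Rintegral leb2 setT (fun xi => a xi * cos (phase x xi + al)).

Definition mass a : R := Rintegral leb2 setT (fun xi => `|a xi|).

Lemma mass_ge0 a : 0 <= mass a.
Proof. exact: Rintegral_ge0. Qed.

Notation integrable2 a := (leb2.-integrable setT (EFin \o a)).

Lemma integrable_osc a x al : integrable2 a ->
  leb2.-integrable setT (EFin \o (fun xi => a xi * cos (phase x xi + al))).
Proof.
move=> ia; apply: (@integrable_bounded_mul _ _ _ _ _ _ 1) => //; last by move=> s; exact: cos_max.
by apply: measurable_funcos; apply: measurable_funD => //; apply: measurable_phase;
  [exact: measurable_cst|exact: measurable_cst|exact: measurable_fst|exact: measurable_snd].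
Qed.

Lemma osc_le a x al : integrable2 a -> `|osc a x al| <= mass a.
Proof.
move=> ia; have io := integrable_osc x al ia.
apply: le_trans (le_normr_Rintegral measurableT io) _.
apply: le_Rintegral => //.
- exact: integrable_norm io.
- exact: integrable_norm ia.
- by move=> xi _; rewrite normrM ler_piMr // cos_max.
Qed.

Lemma measurable_osc {d} {T : measurableType d} a (f : T -> R * R) (al : T -> R) :
  integrable2 a ->
  measurable_fun setT (fst \o f) -> measurable_fun setT (snd \o f) ->
  measurable_fun setT al -> measurable_fun setT (fun t => osc a (f t) (al t)).
Proof.
move=> ia f1 f2 mal.
have ma : measurable_fun setT a by apply/measurable_EFinP; exact: (measurable_int _ ia).
suff : measurable_fun setT (fun z : T * (R * R) => a z.2 * cos (phase (f z.1) z.2 + al z.1)).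
  by move=> /(measurable_Rintegral_param sleb2).
apply: measurable_funM; first exact: measurableT_comp.
apply: measurable_funcos; apply: measurable_funD; last exact: measurableT_comp.
apply: measurable_phase.
- exact: (measurableT_comp f1).
- exact: (measurableT_comp f2).
- exact: (measurableT_comp measurable_fst).
- exact: (measurableT_comp measurable_snd).
Qed.

Lemma osc_rot a x al be : integrable2 a ->
  osc a x (be + al) = cos al * osc a x be - sin al * osc a x (be - pi / 2).
Proof.
move=> ia; have i1 := integrable_osc x be ia; have i2 := integrable_osc x (be - pi / 2) ia.
rewrite /osc -RintegralZl // -RintegralZl // -RintegralB //; try exact: integrable_scale.
apply: eq_Rintegral => xi _; rewrite !addrA cosBpihalf (cosD (phase x xi + be)); ring.
Qed.

(** Translating by t z multiplies the frequency xi by exp(i t phase z xi). After the carrier [c] is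
    removed, the remaining frequency lies where the transform of [psi] is 1, so averaging against
    [psi] changes nothing. *)
Lemma osc_reproduce (psi : R -> R) a x z (c al : R) :
  mu.-integrable setT (EFin \o psi) -> integrable2 a ->
  (forall xi, a xi != 0 -> ftat psi (phase z xi - c) 1) ->
  osc a x al =
  Rintegral mu setT (fun t => psi t * osc a (translate x z t) (al - c * t)).
Proof.
move=> ip ia hp.
have mphase y : measurable_fun setT (fun w : R * (R * R) => phase y w.2).
  apply: measurable_phase; [exact: measurable_cst|exact: measurable_cst| |].
    exact: (measurableT_comp measurable_fst).
  exact: (measurableT_comp measurable_snd).
pose B (w : R * (R * R)) := cos (phase x w.2 + al + w.1 * (phase z w.2 - c)).
have mB : measurable_fun setT B.
  apply: measurable_funcos; apply: measurable_funD.
    apply: measurable_funD => //; exact: mphase.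
  apply: measurable_funM => //; apply: measurable_funB => //; exact: mphase.
have := @Rintegral_fubini R _ _ _ _ mu sleb2 psi a B 1 ip ia mB (fun w => cos_max _).
transitivity (Rintegral leb2 setT (fun xi => a xi * Rintegral mu setT (fun t => psi t * B (t, xi)))).
  apply: eq_Rintegral => xi _; have [->|h] := eqVneq (a xi) 0; first by rewrite !mul0r.
  by rewrite (hp _ h (phase x xi + al)) mul1r.
rewrite -H; apply: eq_Rintegral => t _; congr (_ * _).
by apply: eq_Rintegral => xi _; rewrite /B /= phase_translate; congr (_ * cos _); ring.
Qed.

(** The bracket is the real part of one wave times the conjugate of the other. As a double frequency
    integral it depends on t only through the difference of the two phases along z, where the
    transform of [K] vanishes. *)
Lemma osc_orthogonal (K : R -> R) a b x z (al be : R) :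
  mu.-integrable setT (EFin \o K) -> integrable2 a -> integrable2 b ->
  (forall xi xi', a xi != 0 -> b xi' != 0 -> ftat K (phase z xi' - phase z xi) 0) ->
  Rintegral mu setT (fun t => K t *
    (osc a (translate x z t) al * osc b (translate x z t) be +
     osc a (translate x z t) (al - pi / 2) * osc b (translate x z t) (be - pi / 2))) = 0.
Proof.
move=> iK ia ib hK.
have mphase y : measurable_fun setT (fun w : R * (R * R) => phase y w.2).
  apply: measurable_phase; [exact: measurable_cst|exact: measurable_cst| |].
    exact: (measurableT_comp measurable_fst).
  exact: (measurableT_comp measurable_snd).
pose B (w : R * (R * R)) :=
  osc b (translate x z w.1) be * cos (phase (translate x z w.1) w.2 + al) +
  osc b (translate x z w.1) (be - pi / 2) * cos (phase (translate x z w.1) w.2 + (al - pi / 2)).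
have mB : measurable_fun setT B.
  apply: measurable_funD; apply: measurable_funM.
  - by apply: measurable_osc => //; [exact: measurable_translate1|exact: measurable_translate2].
  - apply: measurable_funcos; apply: measurable_funD => //; apply: measurable_phase.
    + exact: measurable_translate1.
    + exact: measurable_translate2.
    + exact: (measurableT_comp measurable_fst).
    + exact: (measurableT_comp measurable_snd).
  - by apply: measurable_osc => //; [exact: measurable_translate1|exact: measurable_translate2].
  - apply: measurable_funcos; apply: measurable_funD => //; apply: measurable_phase.
    + exact: measurable_translate1.
    + exact: measurable_translate2.
    + exact: (measurableT_comp measurable_fst).
    + exact: (measurableT_comp measurable_snd).
have BM w : `|B w| <= mass b + mass b.
  rewrite (le_trans (ler_normD _ _)) // lerD // normrM -[leRHS]mulr1 ler_pM ?cos_max //;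
    exact: osc_le.
transitivity (Rintegral mu setT (fun t => K t * Rintegral leb2 setT (fun xi => a xi * B (t, xi)))).
  apply: eq_Rintegral => t _; congr (_ * _).
  rewrite mulrC [X in _ + X]mulrC /osc.
  have i1 := integrable_osc (translate x z t) al ia; have i2 := integrable_osc (translate x z t) (al - pi / 2) ia.
  rewrite -[X in X + _]RintegralZl // -[X in _ + X]RintegralZl // -RintegralD //;
    try exact: integrable_scale.
  apply: eq_Rintegral => xi _; rewrite /B /= /osc; ring.
rewrite (@Rintegral_fubini R _ _ _ _ mu sleb2 K a B _ iK ia mB BM).
rewrite /Rintegral integral0_eq // => xi _; congr EFin.
have [->|axi] := eqVneq (a xi) 0; first by rewrite mul0r.
apply/eqP; rewrite mulf_eq0; apply/orP; right; apply/eqP.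
(* The identity cos A cos B + sin A sin B = cos(B - A) merges the two products into one cosine of a
   phase difference. *)
pose D (w : R * (R * R)) := cos (phase x w.2 - phase x xi + (be - al) + w.1 * (phase z w.2 - phase z xi)).
have mD : measurable_fun setT D.
  apply: measurable_funcos; apply: measurable_funD.
    apply: measurable_funD => //; apply: measurable_funB => //; exact: mphase.
  apply: measurable_funM => //; apply: measurable_funB => //; exact: mphase.
transitivity (Rintegral mu setT (fun t => K t * Rintegral leb2 setT (fun xi' => b xi' * D (t, xi')))).
  apply: eq_Rintegral => t _; congr (_ * _).
  rewrite /B /= mulrC [X in _ + X]mulrC {1 2}/osc.
  have i1 := integrable_osc (translate x z t) be ib; have i2 := integrable_osc (translate x z t) (be - pi / 2) ib.
  rewrite -[X in X + _]RintegralZl // -[X in _ + X]RintegralZl // -RintegralD //;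
    try exact: integrable_scale.
  apply: eq_Rintegral => xi' _; rewrite /D /= !addrA !cosBpihalf.
  have -> : phase x xi' - phase x xi + be - al + t * (phase z xi' - phase z xi) =
    (phase (translate x z t) xi' + be) - (phase (translate x z t) xi + al).
    by rewrite !phase_translate; ring.
  by rewrite cosB; ring.
rewrite (@Rintegral_fubini R _ _ _ _ mu sleb2 K b D 1 iK ib mD (fun w => cos_max _)).
rewrite /Rintegral integral0_eq // => xi' _; congr EFin.
have [->|bxi] := eqVneq (b xi') 0; first by rewrite mul0r.
rewrite [X in _ * X](_ : _ = 0) ?mulr0 //.
exact: etrans (hK _ _ axi bxi (phase x xi' - phase x xi + (be - al))) (mul0r _).
Qed.

End Waves.

Section RintegralSum.
Context {R : realType} {d : measure_display} {T : measurableType d}.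
Variable m : {measure set T -> \bar R}.

Lemma integrable_sumR (I : Type) (r : seq I) (P : pred I) (f : I -> T -> R) :
  (forall i, P i -> m.-integrable setT (EFin \o f i)) ->
  m.-integrable setT (EFin \o (fun t => \sum_(i <- r | P i) f i t)).
Proof.
move=> fi; elim: r => [|i r IH].
  apply: (eq_integrable measurableT (cst 0%E)); last exact: integrable0.
  by move=> t _; rewrite /= big_nil.
have [Pi|nPi] := boolP (P i).
  apply: (eq_integrable measurableT (fun t => (f i t)%:E + (\sum_(i <- r | P i) f i t)%:E)%E).
    by move=> t _; rewrite /= big_cons Pi.
  exact: (integrableD measurableT (fi _ Pi) IH).
apply: eq_integrable IH => // t _.
by rewrite /= big_cons (negbTE nPi).
Qed.

Lemma Rintegral_sum (I : Type) (r : seq I) (P : pred I) (f : I -> T -> R) :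
  (forall i, P i -> m.-integrable setT (EFin \o f i)) ->
  Rintegral m setT (fun t => \sum_(i <- r | P i) f i t) =
  \sum_(i <- r | P i) Rintegral m setT (f i).
Proof.
move=> fi; elim: r => [|i r IH].
  rewrite big_nil /Rintegral integral0_eq // => t _.
  by rewrite big_nil.
rewrite big_cons; case: ifPn => [Pi|nPi].
  rewrite -IH -RintegralD //; last 2 first.
    exact: fi.
    exact: integrable_sumR.
  by apply: eq_Rintegral => t _; rewrite big_cons Pi.
rewrite -IH; apply: eq_Rintegral => t _.
by rewrite big_cons (negbTE nPi).
Qed.

End RintegralSum.

(** * The modulus of a wave: reproduction and almost orthogonality *)

Section Amplitude.
Context {R : realType}.
Notation mu := (@lebesgue_measure R).
Notation leb2 := (@leb2 R).
Notation integrable2 a := (leb2.-integrable setT (EFin \o a)).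
Implicit Types (u v : R * R -> R) (x z : R * R).

(* Real part of [exp(i al) f(x)], where [f] is the inverse Fourier transform of [u + i v]. *)
Definition wave u v x (al : R) : R := osc u x al + osc v x (al + pi / 2).

Definition amp u v x : R := Num.sqrt (wave u v x 0 ^+ 2 + wave u v x (- (pi / 2)) ^+ 2).

Lemma amp_ge0 u v x : 0 <= amp u v x. Proof. exact: sqrtr_ge0. Qed.

Lemma sqr_amp u v x : amp u v x ^+ 2 = wave u v x 0 ^+ 2 + wave u v x (- (pi / 2)) ^+ 2.
Proof. by rewrite sqr_sqrtr // addr_ge0 // sqr_ge0. Qed.

Lemma wave_rot u v x al : integrable2 u -> integrable2 v ->
  wave u v x al = cos al * wave u v x 0 - sin al * wave u v x (- (pi / 2)).
Proof.
move=> iu iv; rewrite /wave -{1}[al]add0r (osc_rot x al 0 iu) addrC.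
rewrite [al + _]addrC (osc_rot x al (pi / 2) iv) !add0r subrr.
by rewrite [- (pi / 2) + _]addrC subrr; ring.
Qed.

Lemma wave_le_amp u v x al : integrable2 u -> integrable2 v ->
  `|wave u v x al| <= amp u v x.
Proof.
move=> iu iv; rewrite (wave_rot x al iu iv) /amp.
set p := wave u v x 0; set q := wave u v x _.
rewrite -(@sqrtr_sqr R) ler_wsqrtr //.
have : 0 <= (sin al * p + cos al * q) ^+ 2 by exact: sqr_ge0.
have := cos2Dsin2 al; set c := cos al; set s := sin al => cs.
have -> : p ^+ 2 + q ^+ 2 = (c ^+ 2 + s ^+ 2) * (p ^+ 2 + q ^+ 2) by rewrite cs mul1r.
nra.
Qed.

Lemma wave_le_mass u v x al : integrable2 u -> integrable2 v ->
  `|wave u v x al| <= mass u + mass v.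
Proof. by move=> iu iv; rewrite (le_trans (ler_normD _ _)) // lerD // osc_le. Qed.

Lemma amp_le_waves u v x :
  amp u v x <= `|wave u v x 0| + `|wave u v x (- (pi / 2))|.
Proof.
rewrite -(@ler_pXn2r _ 2) ?nnegrE ?amp_ge0 ?addr_ge0 // sqr_amp.
set p := wave u v x 0; set q := wave u v x _.
have hp : `|p| ^+ 2 = p ^+ 2 by exact: real_normK (num_real p).
have hq : `|q| ^+ 2 = q ^+ 2 by exact: real_normK (num_real q).
have : 0 <= `|p| * `|q| by exact: mulr_ge0.
by rewrite -hp -hq; nra.
Qed.

Lemma amp_le_mass u v x : integrable2 u -> integrable2 v ->
  amp u v x <= 2 * (mass u + mass v).
Proof.
move=> iu iv; rewrite (le_trans (amp_le_waves u v x)) //.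
have := wave_le_mass x 0 iu iv; have := wave_le_mass x (- (pi / 2)) iu iv; lra.
Qed.

Lemma measurable_wave {d} {T : measurableType d} u v (f : T -> R * R) (al : T -> R) :
  integrable2 u -> integrable2 v ->
  measurable_fun setT (fst \o f) -> measurable_fun setT (snd \o f) ->
  measurable_fun setT al -> measurable_fun setT (fun t => wave u v (f t) (al t)).
Proof.
move=> iu iv f1 f2 mal; apply: measurable_funD; apply: measurable_osc => //.
exact: measurable_funD.
Qed.

Lemma measurable_amp {d} {T : measurableType d} u v (f : T -> R * R) :
  integrable2 u -> integrable2 v ->
  measurable_fun setT (fst \o f) -> measurable_fun setT (snd \o f) ->
  measurable_fun setT (fun t => amp u v (f t)).
Proof.
move=> iu iv f1 f2; apply: measurable_funsqrt.
by apply: measurable_funD; apply: measurable_funX; apply: measurable_wave.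
Qed.

(** The reproducing identity holds at every phase, so real and imaginary part are each bounded by
    the smeared modulus; the factor 2 comes from adding these two bounds. *)
Lemma amp_reproduce (psi : R -> R) u v x z (c : R) :
  mu.-integrable setT (EFin \o psi) -> integrable2 u -> integrable2 v ->
  (forall xi, (u xi != 0) || (v xi != 0) -> ftat psi (phase z xi - c) 1) ->
  amp u v x <= 2 * Rintegral mu setT (fun t => `|psi t| * amp u v (translate x z t)).
Proof.
move=> ip iu iv hp.
have mt1 := measurable_translate1 x z (@measurable_id _ _ setT).
have mt2 := measurable_translate2 x z (@measurable_id _ _ setT).
have wb al t : `|wave u v (translate x z t) al| <= mass u + mass v by exact: wave_le_mass.
have iw al : mu.-integrable setT (EFin \o (fun t => psi t * wave u v (translate x z t) (al - c * t))).
  apply: (@integrable_bounded_mul _ _ _ _ _ _ (mass u + mass v)) => //.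
  apply: measurable_wave => //; apply: measurable_funB => //; exact: measurable_funM.
have io a al : integrable2 a -> mu.-integrable setT (EFin \o (fun t => psi t * osc a (translate x z t) (al - c * t))).
  move=> ia; apply: (@integrable_bounded_mul _ _ _ _ _ _ (mass a)) => //; last by move=> t; exact: osc_le.
  apply: measurable_osc => //; apply: measurable_funB => //; exact: measurable_funM.
have ia : mu.-integrable setT (EFin \o (fun t => `|psi t| * amp u v (translate x z t))).
  apply: (@integrable_bounded_mul _ _ _ mu (fun t => `|psi t|) (fun t => amp u v (translate x z t)) (2 * (mass u + mass v))).
  - exact: integrable_norm ip.
  - exact: measurable_amp.
  - by move=> t; rewrite ger0_norm ?amp_ge0 // amp_le_mass.
have key al : `|wave u v x al| <= Rintegral mu setT (fun t => `|psi t| * amp u v (translate x z t)).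
  have -> : wave u v x al = Rintegral mu setT (fun t => psi t * wave u v (translate x z t) (al - c * t)).
    rewrite /wave (@osc_reproduce _ psi u x z c) //; last first.
      by move=> xi h; apply: hp; rewrite h.
    rewrite (@osc_reproduce _ psi v x z c) //; last first.
      by move=> xi h; apply: hp; rewrite h orbT.
    have iv' : mu.-integrable setT (EFin \o (fun t => psi t * osc v (translate x z t) (al + pi / 2 - c * t))).
      exact: io.
    rewrite -(RintegralD measurableT (io u al iu) iv').
    apply: eq_Rintegral => t _; rewrite mulrDr; congr (_ + _ * osc _ _ _); ring.
  apply: le_trans (le_normr_Rintegral measurableT (iw al)) _.
  apply: le_Rintegral => //.
  - exact: integrable_norm (iw al).
  - by move=> t _; rewrite normrM ler_wpM2l // wave_le_amp.
rewrite (le_trans (amp_le_waves u v x)) //.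
by rewrite mulr_natl mulr2n lerD // key.
Qed.

Lemma osc_sum (I : Type) (r : seq I) (P : pred I) (a : I -> R * R -> R) x al :
  (forall i, P i -> integrable2 (a i)) ->
  osc (fun xi => \sum_(i <- r | P i) a i xi) x al = \sum_(i <- r | P i) osc (a i) x al.
Proof.
move=> ia; rewrite /osc -Rintegral_sum; last by move=> i Pi; apply: integrable_osc; exact: ia.
by apply: eq_Rintegral => xi _; rewrite mulr_suml.
Qed.

Lemma wave_sum (I : Type) (r : seq I) (P : pred I) (a b : I -> R * R -> R) x al :
  (forall i, P i -> integrable2 (a i)) -> (forall i, P i -> integrable2 (b i)) ->
  wave (fun xi => \sum_(i <- r | P i) a i xi) (fun xi => \sum_(i <- r | P i) b i xi) x al
  = \sum_(i <- r | P i) wave (a i) (b i) x al.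
Proof. by move=> ia ib; rewrite /wave !osc_sum // -big_split. Qed.

Lemma near_count n (j : 'I_n) :
  \sum_(k < n | (j <= k.+1)%N && (k <= j.+1)%N) (1 : R) <= 3.
Proof.
rewrite sumr_const ler_nat -sum1_card sum1_card.
have -> : 3%N = size (iota j.-1 3) by rewrite size_iota.
rewrite cardE -(size_map (@nat_of_ord n)).
apply: uniq_leq_size; first by rewrite (map_inj_uniq val_inj) enum_uniq.
apply/allP; rewrite all_map; apply/allP => i; rewrite mem_enum inE => /andP[h1 h2].
rewrite /= !inE; lia.
Qed.

Lemma sum_half_symmetric n (e : rel 'I_n) (E : 'I_n -> R) : (forall j k, e j k = e k j) ->
  \sum_(j < n) \sum_(k < n) (if e j k then 2^-1 * (E j + E k) else 0) =
  \sum_(j < n) \sum_(k < n) (if e j k then E j else 0).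
Proof.
move=> sym; transitivity (2^-1 * \sum_(j < n) \sum_(k < n) (if e j k then E j else 0) +
  2^-1 * \sum_(k < n) \sum_(j < n) (if e k j then E k else 0)); last by field.
rewrite [X in _ + _ * X]exchange_big /= !mulr_sumr -big_split; apply: eq_bigr => j _ /=.
rewrite !mulr_sumr -big_split; apply: eq_bigr => k _ /=.
by rewrite (sym k j); case: ifP => _; rewrite ?mulr0 ?addr0 // mulrDr.
Qed.

(** In the expanded square, the pairs of indices at distance at least 2 integrate to 0. The
    remaining pairs are split by 2xy <= x^2 + y^2, and the constant 3 counts the neighbours j - 1,
    j, j + 1 of an index. *)
Lemma almost_orthogonal (K : R -> R) n (u v : 'I_n -> R * R -> R) x z :
  mu.-integrable setT (EFin \o K) -> (forall t, 0 <= K t) ->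
  (forall j, integrable2 (u j)) -> (forall j, integrable2 (v j)) ->
  (forall j k : 'I_n, (j.+1 < k)%N || (k.+1 < j)%N ->
    forall xi xi', (u j xi != 0) || (v j xi != 0) -> (u k xi' != 0) || (v k xi' != 0) ->
    ftat K (phase z xi' - phase z xi) 0) ->
  Rintegral mu setT (fun t => K t *
     amp (fun xi => \sum_(j < n) u j xi) (fun xi => \sum_(j < n) v j xi) (translate x z t) ^+ 2)
  <= 3 * \sum_(j < n) Rintegral mu setT (fun t => K t * amp (u j) (v j) (translate x z t) ^+ 2).
Proof.
move=> iK K0 iu iv orth.
have mt1 := measurable_translate1 x z (@measurable_id _ _ setT).
have mt2 := measurable_translate2 x z (@measurable_id _ _ setT).
pose w j al t := wave (u j) (v j) (translate x z t) al.
pose b j k t := w j 0 t * w k 0 t + w j (- (pi / 2)) t * w k (- (pi / 2)) t.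
have mw j al : measurable_fun setT (w j al) by exact: measurable_wave.
have wb j al t : `|w j al t| <= mass (u j) + mass (v j) by exact: wave_le_mass.
have ib j k : mu.-integrable setT (EFin \o (fun t => K t * b j k t)).
  pose M j := mass (u j) + mass (v j).
  apply: (@integrable_bounded_mul _ _ _ _ _ _ (M j * M k + M j * M k)) => //.
    by rewrite /b; apply: measurable_funD; apply: measurable_funM; exact: mw.
  by move=> t; rewrite (le_trans (ler_normD _ _)) // lerD // normrM ler_pM // wb.
have ampb j t : amp (u j) (v j) (translate x z t) ^+ 2 = b j j t.
  by rewrite sqr_amp /b -!expr2.
have -> : Rintegral mu setT (fun t => K t *
     amp (fun xi => \sum_(j < n) u j xi) (fun xi => \sum_(j < n) v j xi) (translate x z t) ^+ 2)
   = \sum_(j < n) \sum_(k < n) Rintegral mu setT (fun t => K t * b j k t).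
  transitivity (\sum_(j < n) Rintegral mu setT (fun t => \sum_(k < n) K t * b j k t)); last first.
    by apply: eq_bigr => j _; rewrite Rintegral_sum.
  rewrite -Rintegral_sum; last by move=> j _; exact: integrable_sumR.
  apply: eq_Rintegral => t _; rewrite sqr_amp !wave_sum //.
  rewrite !expr2 !mulr_suml -big_split mulr_sumr; apply: eq_bigr => j _ /=.
  rewrite !mulr_sumr -big_split mulr_sumr; apply: eq_bigr => k _ /=.
  by [].
pose E j := Rintegral mu setT (fun t => K t * b j j t).
have E0 j : 0 <= E j.
  by apply: Rintegral_ge0 => t _; rewrite mulr_ge0 // -ampb sqr_ge0.
under [X in _ <= 3 * X]eq_bigr => j _ do under eq_Rintegral => t _ do rewrite ampb.
pose near (j k : 'I_n) := (j <= k.+1)%N && (k <= j.+1)%N.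
have bnd j k : Rintegral mu setT (fun t => K t * b j k t) <=
    if near j k then 2^-1 * (E j + E k) else 0.
  case: ifPn => [_|far].
    rewrite /E -RintegralD // -RintegralZl //; last exact: (integrableD measurableT (ib j j) (ib k k)).
    apply: le_Rintegral => //.
      apply: integrable_scale; exact: (integrableD measurableT (ib j j) (ib k k)).
    move=> t _; rewrite -mulrDr mulrCA ler_wpM2l // /b.
    set p := w j 0 t; set q := w k 0 t; set p' := w j _ t; set q' := w k _ t.
    have := sqr_ge0 (p - q); have := sqr_ge0 (p' - q'); lra.
  have far' : (j.+1 < k)%N || (k.+1 < j)%N by move: far; rewrite /near; lia.
  have ho := orth _ _ far'.
  have iKo a c al be : integrable2 a -> integrable2 c -> mu.-integrable setT (EFin \o (fun t => K t *
      (osc a (translate x z t) al * osc c (translate x z t) be +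
       osc a (translate x z t) (al - pi / 2) * osc c (translate x z t) (be - pi / 2)))).
    move=> ia ic; apply: (@integrable_bounded_mul _ _ _ _ _ _ (mass a * mass c + mass a * mass c)) => //.
      by apply: measurable_funD; apply: measurable_funM; apply: measurable_osc.
    by move=> t; rewrite (le_trans (ler_normD _ _)) // lerD // normrM ler_pM // osc_le.
  (* Real and imaginary parts of the two amplitudes give four cross terms, each vanishing separately
     by [osc_orthogonal]. *)
  pose g a c al be t := K t *
      (osc a (translate x z t) al * osc c (translate x z t) be +
       osc a (translate x z t) (al - pi / 2) * osc c (translate x z t) (be - pi / 2)).
  have -> : Rintegral mu setT (fun t => K t * b j k t) =
    Rintegral mu setT (fun t => (g (u j) (u k) 0 0 t + g (u j) (v k) 0 (pi / 2) t) +
      (g (v j) (u k) (pi / 2) 0 t + g (v j) (v k) (pi / 2) (pi / 2) t)).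
    apply: eq_Rintegral => t _; rewrite /g /b /w /wave !add0r subrr.
    by rewrite [- (pi / 2) + _]addrC subrr; ring.
  have i1 := iKo _ _ 0 0 (iu j) (iu k).
  have i2 := iKo _ _ 0 (pi / 2) (iu j) (iv k).
  have i3 := iKo _ _ (pi / 2) 0 (iv j) (iu k).
  have i4 := iKo _ _ (pi / 2) (pi / 2) (iv j) (iv k).
  rewrite RintegralD; [|by []|exact: (integrableD measurableT i1 i2)|exact: (integrableD measurableT i3 i4)].
  rewrite RintegralD // RintegralD // /g.
  rewrite !osc_orthogonal ?addr0 // => xi xi' h1 h2; apply: ho; rewrite ?h1 ?h2 ?orbT //.
apply: (@le_trans _ _ (\sum_(j < n) \sum_(k < n) (if near j k then 2^-1 * (E j + E k) else 0))).
  by apply: ler_sum => j _; apply: ler_sum => k _; exact: bnd.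
have sym j k : near j k = near k j by rewrite /near andbC.
rewrite (sum_half_symmetric E sym) mulr_sumr; apply: ler_sum => j _.
rewrite -big_mkcond /=.
have -> : \sum_(k < n | near j k) E j = (\sum_(k < n | near j k) 1) * E j.
  by rewrite mulr_suml; apply: eq_bigr => k _; rewrite mul1r.
by rewrite ler_wpM2r // near_count.
Qed.

End Amplitude.

(** * Projections onto vertical strips as absolutely convergent integrals *)

Section StripProjections.
Context {R : realType}.
Notation mu := (@lebesgue_measure R).
Notation leb2 := (@leb2 R).
Notation integrable2 a := (leb2.-integrable setT (EFin \o a)).
Implicit Types (u v : R * R -> R) (x xi : R * R).

(** Half-open on the right so that adjacent strips add up exactly in [cut_sum]. The closed strips of
    [fproj] differ from these by a null line, which [Rintegral_strip] discards. *)
Definition cut (a b : R) u : R * R -> R := fun xi => u xi * (a <= xi.1 < b)%R%:R.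

Lemma measurable_strip (a b : R) :
  measurable ([set xi | a <= xi.1 < b] : set (measurableTypeR R * measurableTypeR R)).
Proof.
have -> : [set xi : R * R | a <= xi.1 < b] = `[a, b[ `*` setT.
  by apply/funext => xi; apply/propext; rewrite /= in_itv /=; split=> [|[]].
exact: measurableX.
Qed.

Lemma cutE a b u : cut a b u = u \_ [set xi | a <= xi.1 < b].
Proof.
apply/funext => xi; rewrite /cut /patch; have [h|h] := boolP (a <= xi.1 < b).
  by rewrite mem_set // mulr1.
by rewrite memNset ?mulr0 //=; exact/negP.
Qed.

Lemma cut_neq0 a b u xi : cut a b u xi != 0 -> u xi != 0 /\ a <= xi.1 < b.
Proof.
by rewrite /cut mulf_eq0 negb_or pnatr_eq0 eqb0 negbK => /andP.
Qed.

Lemma integrable_cut a b u : integrable2 u -> integrable2 (cut a b u).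
Proof.
move=> iu; rewrite cutE -restrict_EFin; apply/integrable_restrict => //.
  exact: measurable_strip.
by rewrite setTI; apply: (integrableS measurableT) => //; exact: measurable_strip.
Qed.

Lemma cut_sum (c : nat -> R) n u : (forall j, c j <= c j.+1) ->
  cut (c 0) (c n) u = (fun xi => \sum_(j < n) cut (c j) (c j.+1) u xi).
Proof.
move=> cm; have c0 k : c 0 <= c k.
  by elim: k => // k IH; exact: le_trans (cm k).
elim: n => [|n IH]; apply/funext => xi.
  rewrite big_ord0 /cut (_ : (c 0 <= xi.1 < c 0) = false) ?mulr0 //.
  by apply/negP => /andP[h1 h2]; have := le_lt_trans h1 h2; rewrite ltxx.
have IHx : \sum_(j < n) cut (c j) (c j.+1) u xi = cut (c 0) (c n) u xi by rewrite IH.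
rewrite big_ord_recr /= IHx /cut -mulrDr; congr (_ * _).
have := c0 n; have := cm n => h1 h2.
case: (leP (c 0) xi.1) => h3; case: (ltP xi.1 (c n)) => h4;
  case: (ltP xi.1 (c n.+1)) => h5; rewrite /= ?addr0 ?add0r //; lra.
Qed.

Lemma leb2_line (b : R) : leb2 [set xi | xi.1 = b] = 0%E.
Proof.
have -> : [set xi : R * R | xi.1 = b] = [set b] `*` setT.
  by apply/funext => xi; apply/propext; split=> [|[]].
by rewrite /leb2 product_measure1E //= lebesgue_measure_set1 mul0e.
Qed.

Lemma Rintegral_strip (a b : R) (g : R * R -> R) : integrable2 g ->
  Rintegral leb2 [set xi | a <= xi.1 <= b] g = Rintegral leb2 [set xi | a <= xi.1 < b] g.
Proof.
move=> ig; rewrite /Rintegral; congr fine.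
have mD : measurable ([set xi | a <= xi.1 <= b] : set (measurableTypeR R * measurableTypeR R)).
  have -> : [set xi : R * R | a <= xi.1 <= b] = `[a, b] `*` setT.
    by apply/funext => xi; apply/propext; rewrite /= in_itv /=; split=> [|[]].
  exact: measurableX.
have mN : measurable ([set xi | xi.1 = b] : set (measurableTypeR R * measurableTypeR R)).
  have -> : [set xi : R * R | xi.1 = b] = [set b] `*` setT.
    by apply/funext => xi; apply/propext; split=> [|[]].
  exact: measurableX.
rewrite (negligible_integral mN mD _ (leb2_line b)); last by apply: (integrableS measurableT).
congr (integral _ _ _); apply/seteqP; split=> xi /=.
  by move=> [/andP[-> h] h']; rewrite lt_neqAle h andbT; apply/eqP.
by move=> /andP[-> h]; split; [exact: ltW|move=> e; rewrite e ltxx in h].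
Qed.

Section FourierOfIntegrable.
Variable F : R * R -> R[i].
Hypothesis iRe : integrable2 (fun x => complex.Re (F x)).
Hypothesis iIm : integrable2 (fun x => complex.Im (F x)).

Definition fourier_re xi : R := complex.Re (fourier F xi).
Definition fourier_im xi : R := complex.Im (fourier F xi).

Lemma Re_mul_expi (z : R[i]) th :
  complex.Re (z * expi th) = complex.Re z * cos th - complex.Im z * sin th.
Proof. by case: z. Qed.

Lemma Im_mul_expi (z : R[i]) th :
  complex.Im (z * expi th) = complex.Re z * sin th + complex.Im z * cos th.
Proof. by case: z. Qed.

Lemma measurable_fourier :
  measurable_fun setT fourier_re /\ measurable_fun setT fourier_im.
Proof.
have mRe : measurable_fun setT (fun x => complex.Re (F x)).
  by apply/measurable_EFinP; exact: (measurable_int _ iRe).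
have mIm : measurable_fun setT (fun x => complex.Im (F x)).
  by apply/measurable_EFinP; exact: (measurable_int _ iIm).
have mth : measurable_fun setT (fun z : (R * R) * (R * R) => - (2 * pi * dot2 z.2 z.1)).
  apply: measurable_funN; apply: measurable_phase.
  - exact: (measurableT_comp measurable_fst measurable_snd).
  - exact: (measurableT_comp measurable_snd measurable_snd).
  - exact: (measurableT_comp measurable_fst measurable_fst).
  - exact: (measurableT_comp measurable_snd measurable_fst).
split.
- suff : measurable_fun setT (fun z : (R * R) * (R * R) =>
      complex.Re (F z.2 * expi (- (2 * pi * dot2 z.2 z.1)))).
    by move=> /(measurable_Rintegral_param sleb2).
  under eq_fun do rewrite Re_mul_expi.
  apply: measurable_funB; apply: measurable_funM.
  + exact: (measurableT_comp mRe measurable_snd).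
  + exact: measurable_funcos.
  + exact: (measurableT_comp mIm measurable_snd).
  + exact: measurable_funsin.
- suff : measurable_fun setT (fun z : (R * R) * (R * R) =>
      complex.Im (F z.2 * expi (- (2 * pi * dot2 z.2 z.1)))).
    by move=> /(measurable_Rintegral_param sleb2).
  under eq_fun do rewrite Im_mul_expi.
  apply: measurable_funD; apply: measurable_funM.
  + exact: (measurableT_comp mRe measurable_snd).
  + exact: measurable_funsin.
  + exact: (measurableT_comp mIm measurable_snd).
  + exact: measurable_funcos.
Qed.

Lemma fourier_bounded xi : `|fourier_re xi| <= mass (fun x => complex.Re (F x)) + mass (fun x => complex.Im (F x))
  /\ `|fourier_im xi| <= mass (fun x => complex.Re (F x)) + mass (fun x => complex.Im (F x)).
Proof.
pose th x : R := - (2 * pi * dot2 x xi).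
have mth : measurable_fun setT th.
  apply: measurable_funN; apply: measurable_phase;
  [exact: measurable_fst|exact: measurable_snd|exact: measurable_cst|exact: measurable_cst].
have ib (g : R * R -> R) (B : R * R -> R) : integrable2 g -> measurable_fun setT B ->
    (forall x, `|B x| <= 1) -> integrable2 (fun x => g x * B x).
  by move=> ig mB B1; exact: (integrable_bounded_mul ig mB B1).
have le (g : R * R -> R) (B : R * R -> R) : integrable2 g -> measurable_fun setT B ->
    (forall x, `|B x| <= 1) -> `|Rintegral leb2 setT (fun x => g x * B x)| <= mass g.
  move=> ig mB B1; have i := ib _ _ ig mB B1.
  apply: le_trans (le_normr_Rintegral measurableT i) _.
  apply: le_Rintegral => //; [exact: integrable_norm i|exact: integrable_norm ig|].
  by move=> x _; rewrite normrM ler_piMr.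
have mc : measurable_fun setT (fun x => cos (th x)) by exact: measurable_funcos.
have ms : measurable_fun setT (fun x => sin (th x)) by exact: measurable_funsin.
have c1 x : `|cos (th x)| <= 1 by exact: cos_max.
have s1 x : `|sin (th x)| <= 1 by exact: sin_max.
split.
- rewrite /fourier_re /fourier /cint /=.
  under eq_Rintegral => x _ do rewrite Re_mul_expi.
  rewrite RintegralB //; [|exact: (ib _ _ iRe mc c1)|exact: (ib _ _ iIm ms s1)].
  by rewrite (le_trans (ler_normB _ _)) // lerD //; [exact: (le _ _ iRe mc c1)|exact: (le _ _ iIm ms s1)].
- rewrite /fourier_im /fourier /cint /=.
  under eq_Rintegral => x _ do rewrite Im_mul_expi.
  rewrite RintegralD //; [|exact: (ib _ _ iRe ms s1)|exact: (ib _ _ iIm mc c1)].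
  by rewrite (le_trans (ler_normD _ _)) // lerD //; [exact: (le _ _ iRe ms s1)|exact: (le _ _ iIm mc c1)].
Qed.

Variable delta : R.
Hypothesis delta1 : delta <= 1.
Hypothesis supp : support2 (fourier F) `<=` Nbhd delta.

Lemma fourier_support xi : (fourier_re xi != 0) || (fourier_im xi != 0) -> Nbhd delta xi.
Proof.
move=> h; apply: supp; apply: subset_closure => /=; apply/eqP => e.
by move: h; rewrite /fourier_re /fourier_im e /= !eqxx.
Qed.

(** The transform is bounded because [F] is integrable, and for delta <= 1 the neighbourhood of the
    parabola lies in the box [0, 1] x [0, 2]. *)
Lemma integrable_fourier : integrable2 fourier_re /\ integrable2 fourier_im.
Proof.
pose A : set (measurableTypeR R * measurableTypeR R) := `[0%R, 1%R] `*` `[0%R, 2%R].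
have mA : measurable A by exact: measurableX.
have iA : integrable2 (\1_A : R * R -> R).
  apply/integrableP; split; first by apply/measurable_EFinP; exact: measurable_indic.
  under eq_integral => t _ do rewrite /= ger0_norm //.
  rewrite integral_indic // setIT.
  rewrite [X in (X < _)%E](_ : _ = 2%:E) ?ltry //.
  have l1 : mu [set` `[0, 1]] = 1%:E by rewrite lebesgue_measure_itv /= lte_fin ltr01 oppr0 adde0.
  have l2 : mu [set` `[0, 2]] = 2%:E by rewrite lebesgue_measure_itv /= lte_fin ltr0n oppr0 adde0.
  transitivity (mu [set` `[0%R, 1%R]] * mu [set` `[0%R, 2%R]])%E; last by rewrite l1 l2 mul1e.
  exact: product_measure1E.
have fA (g : R * R -> R) : (forall xi, g xi != 0 -> Nbhd delta xi) -> g = (fun xi => \1_A xi * g xi).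
  move=> hg; apply/funext => xi; have [->|gx] := eqVneq (g xi) 0; first by rewrite mulr0.
  rewrite indicE mem_set ?mul1r //.
  move: (hg _ gx); rewrite /Nbhd /= => -[/andP[h1 h2] /andP[h3 h4]].
  rewrite /A /= !in_itv /= h1 h2; split=> //.
  have s0 := sqr_ge0 xi.1; have s1 : xi.1 ^+ 2 <= 1 by rewrite exprn_ile1.
  apply/andP; split; first lra.
  by apply: (le_trans h4); rewrite -[leRHS]/(1 + 1 : R) lerD.
have [m1 m2] := measurable_fourier.
split.
- rewrite (fA fourier_re); last by move=> xi h; apply: fourier_support; rewrite h.
  apply: (@integrable_bounded_mul _ _ _ _ _ _ (mass (fun x => complex.Re (F x)) + mass (fun x => complex.Im (F x)))) => //.
  by move=> xi; case: (fourier_bounded xi).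
- rewrite (fA fourier_im); last by move=> xi h; apply: fourier_support; rewrite h orbT.
  apply: (@integrable_bounded_mul _ _ _ _ _ _ (mass (fun x => complex.Re (F x)) + mass (fun x => complex.Im (F x)))) => //.
  by move=> xi; case: (fourier_bounded xi).
Qed.

(** The bridge from the complex projections of the statement to the real calculus of [amp], where
    every later estimate takes place. *)
Lemma cmod_fproj a b x :
  cmod (fproj a b F x) = amp (cut a b fourier_re) (cut a b fourier_im) x.
Proof.
have [iu iv] := integrable_fourier.
have ib (g B : R * R -> R) : integrable2 g -> measurable_fun setT B ->
    (forall x, `|B x| <= 1) -> integrable2 (fun x => g x * B x).
  by move=> ig mB B1; exact: (integrable_bounded_mul ig mB B1).
have mph : measurable_fun setT (phase x).
  by apply: measurable_phase; [exact: measurable_cst|exact: measurable_cst|exact: measurable_fst|exact: measurable_snd].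
have mc : measurable_fun setT (fun xi => cos (phase x xi)) by exact: measurable_funcos.
have ms : measurable_fun setT (fun xi => sin (phase x xi)) by exact: measurable_funsin.
have c1 xi : `|cos (phase x xi)| <= 1 by exact: cos_max.
have s1 xi : `|sin (phase x xi)| <= 1 by exact: sin_max.
have icu := integrable_cut a b iu; have icv := integrable_cut a b iv.
rewrite /cmod /amp; congr (Num.sqrt (_ ^+ 2 + _ ^+ 2)).
- transitivity (Rintegral leb2 [set xi | a <= xi.1 <= b]
    (fun xi => complex.Re (fourier F xi * expi (phase x xi)))); first by [].
  under eq_Rintegral => xi _ do rewrite Re_mul_expi.
  rewrite Rintegral_strip; last first.
    exact: (integrableB measurableT (ib _ _ iu mc c1) (ib _ _ iv ms s1)).
  rewrite Rintegral_mkcond /wave /osc -RintegralD //; [|exact: integrable_osc..].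
  apply: eq_Rintegral => xi _; rewrite !addr0 add0r cosDpihalf cutE cutE /patch.
  by case: ifP => _; rewrite ?mul0r ?addr0 // mulrN.
- transitivity (Rintegral leb2 [set xi | a <= xi.1 <= b]
    (fun xi => complex.Im (fourier F xi * expi (phase x xi)))); first by [].
  under eq_Rintegral => xi _ do rewrite Im_mul_expi.
  rewrite Rintegral_strip; last first.
    exact: (integrableD measurableT (ib _ _ iu ms s1) (ib _ _ iv mc c1)).
  rewrite Rintegral_mkcond /wave /osc -RintegralD //; [|exact: integrable_osc..].
  apply: eq_Rintegral => xi _; rewrite cosBpihalf [- (pi / 2) + _]addrC subrr addr0 cutE cutE /patch.
  by case: ifP => _; rewrite ?mul0r ?addr0.
Qed.

End FourierOfIntegrable.

End StripProjections.

(** * Hoelder and Minkowski inequalities *)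

Section Hoelder.
Context {R : realType}.
Implicit Types (a b th : R).

Lemma powR_interp_inv a th : 0 <= a -> th != 0 -> (a `^ th) `^ th^-1 = a.
Proof. by move=> a0 h; rewrite -powRrM divff // powRr1. Qed.

Lemma amgm_powR a b th : 0 <= a -> 0 <= b -> 0 <= th <= 1 ->
  a `^ (1 - th) * b `^ th <= (1 - th) * a + th * b.
Proof.
move=> a0 b0 /andP[]; rewrite le_eqVlt => /predU1P[<-|t0] t1.
  by rewrite subr0 powRr1 // powRr0 mulr1 mul1r mul0r addr0.
move: t1; rewrite le_eqVlt => /predU1P[->|t1].
  by rewrite subrr powRr0 mul1r mul0r add0r powRr1 // mul1r.
have s0 : 0 < 1 - th by rewrite subr_gt0.
have := @conjugate_powR R (a `^ (1 - th)) (b `^ th) (1 - th)^-1 th^-1 (powR_ge0 _ _) (powR_ge0 _ _).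
rewrite !invr_gt0 => /(_ s0 t0); rewrite !invrK subrK => /(_ erefl).
by rewrite !powR_interp_inv ?gt_eqF // mulrC [th * _]mulrC [(1 - th) * _]mulrC [b `^ th * _]mulrC.
Qed.

Lemma powR_invr a th : 0 <= a -> (a^-1) `^ th = (a `^ th)^-1.
Proof. by move=> a0; rewrite -powR_inv1 // -powRrM mulN1r powRN. Qed.

(** Once both sums are normalised to 1, the weighted arithmetic-geometric inequality applied to each
    term sums to 1. *)
Lemma hoelder_sum (I : Type) (r : seq I) (P : pred I) (f g : I -> R) th :
  0 <= th < 1 -> (forall i, 0 <= f i) -> (forall i, 0 <= g i) ->
  \sum_(i <- r | P i) f i `^ (1 - th) * g i `^ th <=
  (\sum_(i <- r | P i) f i) `^ (1 - th) * (\sum_(i <- r | P i) g i) `^ th.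
Proof.
move=> /andP[t0 t1] f0 g0.
have t01 : 0 <= th <= 1 by rewrite t0 ltW.
have s0 : 1 - th != 0 by rewrite subr_eq0 gt_eqF.
set A := \sum_(i <- r | P i) f i; set B := \sum_(i <- r | P i) g i.
have A0 : 0 <= A by exact: sumr_ge0.
have B0 : 0 <= B by exact: sumr_ge0.
move: t0; rewrite le_eqVlt => /predU1P[t0|t0].
  rewrite -t0 subr0 powRr0 mulr1 powRr1 //; apply: ler_sum => i _.
  by rewrite powRr0 mulr1 powRr1.
(* Normalisation breaks down when a sum is 0; then every term with index in the range vanishes, and
   so does the left side. *)
have zero (h : I -> R) : (forall i, 0 <= h i) -> \sum_(i <- r | P i) h i = 0 ->
    \sum_(i <- r | P i) f i `^ (1 - th) * g i `^ th =
    \sum_(i <- r | P i) (if h i == 0 then f i `^ (1 - th) * g i `^ th else 0).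
  move=> h0; elim: r {A B A0 B0} => [|i r IH]; first by rewrite !big_nil.
  rewrite !big_cons; case: ifP => Pi //; first last.
  move=> /eqP; rewrite paddr_eq0 ?sumr_ge0 // => /andP[-> /eqP /IH ->] //.
have [Az|An] := eqVneq A 0.
  rewrite (zero f f0 Az) Az powR0 // mul0r; apply: sumr_le0 => i _.
  by case: eqP => // ->; rewrite powR0 // mul0r.
have [Bz|Bn] := eqVneq B 0.
  rewrite (zero g g0 Bz) Bz powR0 ?gt_eqF // mulr0; apply: sumr_le0 => i _.
  by case: eqP => // ->; rewrite powR0 ?mulr0 // gt_eqF.
have Ap : 0 < A by rewrite lt0r An.
have Bp : 0 < B by rewrite lt0r Bn.
have Apow : 0 < A `^ (1 - th) by rewrite powR_gt0.
have Bpow : 0 < B `^ th by rewrite powR_gt0.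
rewrite -[leRHS]mulr1 -ler_pdivrMl ?mulr_gt0 // mulr_sumr.
apply: (@le_trans _ _ (\sum_(i <- r | P i) ((1 - th) * (f i / A) + th * (g i / B)))).
  apply: ler_sum => i _.
  have := amgm_powR (divr_ge0 (f0 i) A0) (divr_ge0 (g0 i) B0) t01.
  rewrite !powRM ?invr_ge0 // !powR_invr // => h; apply: le_trans h.
  by rewrite [leRHS]mulrACA -invfM mulrC.
rewrite big_split -!mulr_sumr -!mulr_suml -/A -/B !divff // !mulr1 /=.
by rewrite addrNK.
Qed.

Lemma hoelder_Rintegral {d} {T : measurableType d} (m : {measure set T -> \bar R})
    (f g : T -> R) th : 0 <= th <= 1 ->
  m.-integrable setT (EFin \o f) -> m.-integrable setT (EFin \o g) ->
  (forall x, 0 <= f x) -> (forall x, 0 <= g x) ->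
  m.-integrable setT (EFin \o (fun x => f x `^ (1 - th) * g x `^ th)) /\
  Rintegral m setT (fun x => f x `^ (1 - th) * g x `^ th) <=
  Rintegral m setT f `^ (1 - th) * Rintegral m setT g `^ th.
Proof.
move=> th01 fi gi f0 g0.
have mf : measurable_fun setT f by apply/measurable_EFinP; exact: (measurable_int _ fi).
have mg : measurable_fun setT g by apply/measurable_EFinP; exact: (measurable_int _ gi).
have ifg : m.-integrable setT (EFin \o (fun x => f x `^ (1 - th) * g x `^ th)).
  apply: (@le_integrable _ _ _ m _ measurableT _ (fun x => ((1 - th) * f x)%:E + (th * g x)%:E)%E).
  - by apply/measurable_EFinP; apply: measurable_funM; exact: measurable_funpowR.
  - move=> x _; rewrite /= lee_fin ger0_norm ?mulr_ge0 ?powR_ge0 //.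
    by rewrite (le_trans (amgm_powR _ _ th01)) // ler_norm.
  - by apply: integrableD => //; exact: integrable_scale.
split=> //.
case/andP: th01; rewrite le_eqVlt => /predU1P[<-|t0] t1.
  rewrite subr0 powRr0 mulr1 powRr1; last exact: Rintegral_ge0.
  rewrite le_eqVlt; apply/orP; left; apply/eqP; apply: eq_Rintegral => x _.
  by rewrite powRr0 mulr1 powRr1.
move: t1; rewrite le_eqVlt => /predU1P[->|t1].
  rewrite subrr powRr0 mul1r powRr1; last exact: Rintegral_ge0.
  rewrite le_eqVlt; apply/orP; left; apply/eqP; apply: eq_Rintegral => x _.
  by rewrite powRr0 mul1r powRr1.
have s0 : 0 < 1 - th by rewrite subr_gt0.
have fin (h : T -> R) : m.-integrable setT (EFin \o h) ->
    (Rintegral m setT h)%:E = (\int[m]_x (h x)%:E)%E.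
  by move=> ih; rewrite /Rintegral fineK //; exact: integrable_fin_num.
have nrm (h : T -> R) s : 0 < s -> m.-integrable setT (EFin \o h) -> (forall x, 0 <= h x) ->
    ('N[m]_(s^-1)%:E[EFin \o (fun x => (h x `^ s)%R)] = (Rintegral m setT h `^ s)%:E)%E.
  move=> s00 ih h0; rewrite unlock invrK -poweR_EFin fin //; congr (_ `^ _)%E.
  apply: eq_integral => x _ /=.
  by rewrite ger0_norm ?powR_ge0 // powR_interp_inv // gt_eqF.
have := @hoelder _ _ _ m (fun x => f x `^ (1 - th)) (fun x => g x `^ th) (1 - th)^-1 th^-1
  (measurable_funpowR (1 - th) mf) (measurable_funpowR th mg).
rewrite !invr_gt0 !invrK subrK => /(_ s0 t0 erefl).
rewrite (nrm f) // (nrm g) // Lnorm1 -EFinM => H.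
rewrite -lee_fin fin //; apply: le_trans H.
rewrite le_eqVlt; apply/orP; left; apply/eqP; apply: eq_integral => x _.
by rewrite /= ger0_norm // mulr_ge0 // powR_ge0.
Qed.

(** With n_i the l^th norm of row i and S the sum of the n_i, Hoelder applied to x = (x^th
    n^(1-th))^(1/th) n^(1-1/th) bounds each column by S^(th-1) times the sum of x^th n^(1-th).
    Summing over columns turns that sum into S, giving S^th. *)
Lemma minkowski_sum (I J : finType) (P : pred I) (Q : pred J)
    (x : I -> J -> R) th : 1 <= th -> (forall i j, 0 <= x i j) ->
  \sum_(j | Q j) (\sum_(i | P i) x i j) `^ th <=
  (\sum_(i | P i) (\sum_(j | Q j) x i j `^ th) `^ th^-1) `^ th.
Proof.
move=> th1 x0.
have th0 : 0 < th by rewrite (lt_le_trans _ th1).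
have thn : th != 0 by rewrite gt_eqF.
pose N i := \sum_(j | Q j) x i j `^ th.
have N0 i : 0 <= N i by apply: sumr_ge0 => j _; exact: powR_ge0.
pose n i := N i `^ th^-1.
have n0 i : 0 <= n i by exact: powR_ge0.
pose S := \sum_(i | P i) n i.
have S0 : 0 <= S by exact: sumr_ge0.
pose t := 1 - th^-1.
have ti : th^-1 <= 1 by rewrite invf_le1.
have t01 : 0 <= t < 1 by rewrite /t subr_ge0 ti ltrBlDr ltrDl invr_gt0.
have tE : 1 - t = th^-1 by rewrite /t opprB addrCA subrr addr0.
have key j : Q j -> (\sum_(i | P i) x i j) `^ th <=
    S `^ (th - 1) * \sum_(i | P i) x i j `^ th * n i `^ (1 - th).
  move=> Qj.
  have h : \sum_(i | P i) x i j <=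
     (\sum_(i | P i) x i j `^ th * n i `^ (1 - th)) `^ th^-1 * S `^ t.
    rewrite -tE.
    apply: le_trans (hoelder_sum _ _ t01 _ n0); last first.
      by move=> i; rewrite mulr_ge0 ?powR_ge0.
    rewrite le_eqVlt; apply/orP; left; apply/eqP; apply: eq_bigr => i _.
    (* A row of norm 0 consists of zeros, so its terms agree although negative powers of [n i] are
       meaningless. *)
    have [nz|nz] := eqVneq (n i) 0.
      have /eqP : N i = 0 by apply/eqP; move: nz => /powR_eq0_eq0 ->.
      rewrite psumr_eq0 => [/allP /(_ j (mem_index_enum _))|k _]; last exact: powR_ge0.
      rewrite Qj /= => /eqP /powR_eq0_eq0 ->.
      by rewrite powR0 // mul0r tE powR0 ?mul0r // invr_neq0.
    rewrite tE powRM ?powR_ge0 // powR_interp_inv // -powRrM mulrBl mul1r divff // -mulrA -powRD.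
      by rewrite /t addrA subrK subrr powRr0 mulr1.
    by rewrite nz implybT.
  apply: (@le_trans _ _ (((\sum_(i | P i) x i j `^ th * n i `^ (1 - th)) `^ th^-1 * S `^ t) `^ th)).
    apply: ge0_ler_powR => //; rewrite ?nnegrE ?mulr_ge0 ?powR_ge0 ?sumr_ge0 //; exact: ltW.
  rewrite powRM ?powR_ge0 // -!powRrM mulVf // powRr1; last first.
    by apply: sumr_ge0 => i _; rewrite mulr_ge0 ?powR_ge0.
  by rewrite mulrC /t mulrBl mul1r mulVf.
apply: (@le_trans _ _ (\sum_(j | Q j) S `^ (th - 1) * \sum_(i | P i) x i j `^ th * n i `^ (1 - th))).
  by apply: ler_sum => j Qj; exact: key.
rewrite -mulr_sumr exchange_big /=.
under eq_bigr => i _ do rewrite -mulr_suml.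
have e i : (\sum_(j | Q j) x i j `^ th) * n i `^ (1 - th) = n i.
  rewrite -/(N i) /n -powRrM mulrBr mulr1 mulVf //.
  have [->|Nz] := eqVneq (N i) 0; first by rewrite mul0r powR0 // invr_neq0.
  by rewrite -{1}(powRr1 (N0 i)) -powRD ?Nz ?implybT // addrCA subrr addr0.
under eq_bigr => i _ do rewrite e.
by rewrite -/S mulrC mulr_powRB1.
Qed.

End Hoelder.

(** * Weights of squares and of their subsquares *)

Section Weights.
Context {R : realType}.
Notation mu := (@lebesgue_measure R).
Implicit Types (d e x y z : R * R) (Q : @square R).

Definition nrm2 d : R := Num.sqrt (d.1 ^+ 2 + d.2 ^+ 2).

Lemma nrm2_ge0 d : 0 <= nrm2 d. Proof. exact: sqrtr_ge0. Qed.

Lemma sqr_nrm2 d : nrm2 d ^+ 2 = d.1 ^+ 2 + d.2 ^+ 2.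
Proof. by rewrite sqr_sqrtr // addr_ge0 // sqr_ge0. Qed.

Lemma inner_le_nrm2 d e : d.1 * e.1 + d.2 * e.2 <= nrm2 d * nrm2 e.
Proof.
have [h|h] := leP (d.1 * e.1 + d.2 * e.2) 0.
  by rewrite (le_trans h) // mulr_ge0 // nrm2_ge0.
rewrite -(@ler_pXn2r _ 2) ?nnegrE ?mulr_ge0 ?nrm2_ge0 ?(ltW h) //.
rewrite exprMn !sqr_nrm2; have := sqr_ge0 (d.1 * e.2 - d.2 * e.1); nra.
Qed.

Lemma nrm2D d e : nrm2 (d.1 + e.1, d.2 + e.2) <= nrm2 d + nrm2 e.
Proof.
rewrite -(@ler_pXn2r _ 2) ?nnegrE ?addr_ge0 ?nrm2_ge0 //.
rewrite sqr_nrm2 /=; have := inner_le_nrm2 d e.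
have := sqr_nrm2 d; have := sqr_nrm2 e.
by set A := nrm2 d; set B := nrm2 e; nra.
Qed.

Lemma nrm2_scale (t : R) d : nrm2 (t * d.1, t * d.2) = `|t| * nrm2 d.
Proof. by rewrite /nrm2 /= !exprMn -mulrDr sqrtrM ?sqr_ge0 // sqrtr_sqr. Qed.

Lemma abs_inner_le d e : `|d.1 * e.1 + d.2 * e.2| <= nrm2 d * nrm2 e.
Proof.
rewrite ler_norml inner_le_nrm2 andbT lerNl.
have := inner_le_nrm2 (-1 * d.1, -1 * d.2) e.
by rewrite nrm2_scale normrN1 mul1r /= !mulN1r !mulNr -opprD.
Qed.

Definition br (l : R) d : R := 1 + nrm2 d / l.

Lemma br_ge1 l d : 0 < l -> 1 <= br l d.
Proof. by move=> l0; rewrite lerDl divr_ge0 ?nrm2_ge0 // ltW. Qed.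

Lemma br_gt0 l d : 0 < l -> 0 < br l d.
Proof. by move=> l0; rewrite (lt_le_trans _ (br_ge1 d l0)). Qed.

Definition offset Q x : R * R := (x.1 - (sq_center Q).1, x.2 - (sq_center Q).2).

Lemma wQE Q x : wQ Q x = (br (side Q) (offset Q x) ^+ 200)^-1.
Proof. by []. Qed.

Lemma wQ_gt0 Q x : 0 < side Q -> 0 < wQ Q x.
Proof. by move=> l0; rewrite wQE invr_gt0 exprn_gt0 // br_gt0. Qed.

Lemma measurable_wQ {dd} {T : measurableType dd} Q (f : T -> R * R) :
  measurable_fun setT (fst \o f) -> measurable_fun setT (snd \o f) ->
  measurable_fun setT (fun t => wQ Q (f t)).
Proof.
move=> f1 f2; apply: measurable_funV; apply: measurable_funX; apply: measurable_funD => //.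
apply: measurable_funM => //; apply: measurable_funsqrt.
by apply: measurable_funD; apply: measurable_funX; apply: measurable_funB.
Qed.

Lemma measurable_wQ1 Q : measurable_fun setT (wQ Q).
Proof. by apply: (@measurable_wQ _ _ Q id); [exact: measurable_fst|exact: measurable_snd]. Qed.

Lemma br_triangle (l t : R) d z : 0 < l -> nrm2 z <= l ->
  br l d <= br l (d.1 + t * z.1, d.2 + t * z.2) * (1 + `|t|).
Proof.
move=> l0 zl; rewrite /br.
set e := (d.1 + t * z.1, d.2 + t * z.2).
have h : nrm2 d <= nrm2 e + `|t| * l.
  have -> : d = (e.1 + (- t) * z.1, e.2 + (- t) * z.2).
    by rewrite [LHS]surjective_pairing /e /=; congr pair; ring.
  apply: (le_trans (nrm2D e (- t * z.1, - t * z.2))); rewrite lerD2l.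
  by rewrite nrm2_scale normrN ler_wpM2l.
have h' : nrm2 d / l <= nrm2 e / l + `|t|.
  by rewrite ler_pdivrMr // mulrDl divfK // gt_eqF.
have e0 : 0 <= nrm2 e / l by rewrite divr_ge0 ?nrm2_ge0 // ltW.
have : 0 <= nrm2 e / l * `|t| by rewrite mulr_ge0.
nra.
Qed.

(** The price of a displacement by t side lengths. Its exponent 200 dictates the decay 202 demanded
    from the kernels. *)
Lemma wQ_translate Q x z t : 0 < side Q -> nrm2 z <= side Q ->
  wQ Q (translate x z t) <= (1 + `|t|) ^+ 200 * wQ Q x.
Proof.
move=> l0 zl; rewrite !wQE.
have q : 0 < 1 + `|t| by rewrite ltr_pwDl.
rewrite ler_pdivlMr ?exprn_gt0 ?br_gt0 // mulrC ler_pdivrMr ?exprn_gt0 ?br_gt0 // -exprMn.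
rewrite lerXn2r ?nnegrE ?mulr_ge0 ?(ltW q) ?(ltW (br_gt0 _ l0)) //.
rewrite mulrC; have := br_triangle t (offset Q x) l0 zl.
by rewrite /offset /translate /= !(addrAC _ (_ * _)).
Qed.

Lemma wQ_translate_ge Q x z t : 0 < side Q -> nrm2 z <= side Q ->
  wQ Q x <= (1 + `|t|) ^+ 200 * wQ Q (translate x z t).
Proof.
move=> l0 zl; have := wQ_translate (translate x z t) (- t) l0 zl.
rewrite normrN; have -> // : translate (translate x z t) z (- t) = x.
by rewrite [RHS]surjective_pairing /translate /=; congr pair; ring.
Qed.

Lemma inv_br_sqr_le (l s : R) d : 0 < l -> `|s| <= nrm2 d / l -> (br l d ^+ 2)^-1 <= jap s.
Proof.
move=> l0 h; rewrite /jap lef_pV2 ?posrE ?exprn_gt0 ?br_gt0 //; last first.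
  by rewrite ltr_pwDl // sqr_ge0.
have : s ^+ 2 = `|s| ^+ 2 by rewrite real_normK ?num_real.
move=> ->; rewrite /br; set q := nrm2 d / l in h *.
have : 0 <= `|s| by []; nra.
Qed.

Lemma abs_fst_le d : `|d.1| <= nrm2 d.
Proof. by rewrite -(@sqrtr_sqr R) ler_wsqrtr // lerDl sqr_ge0. Qed.

Lemma abs_snd_le d : `|d.2| <= nrm2 d.
Proof. by rewrite -(@sqrtr_sqr R) ler_wsqrtr // lerDr sqr_ge0. Qed.

Lemma inv_br_fst (l : R) d : 0 < l -> (br l d ^+ 2)^-1 <= jap (d.1 / l).
Proof.
move=> l0; apply: inv_br_sqr_le => //.
by rewrite normrM normfV (gtr0_norm l0) ler_wpM2r ?invr_ge0 ?(ltW l0) // abs_fst_le.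
Qed.

Lemma inv_br_snd (l : R) d : 0 < l -> (br l d ^+ 2)^-1 <= jap (d.2 / l).
Proof.
move=> l0; apply: inv_br_sqr_le => //.
by rewrite normrM normfV (gtr0_norm l0) ler_wpM2r ?invr_ge0 ?(ltW l0) // abs_snd_le.
Qed.

Lemma inv_brX_le (l : R) d m n : 0 < l -> (m <= n)%N -> (br l d ^+ n)^-1 <= (br l d ^+ m)^-1.
Proof.
move=> l0 mn; rewrite lef_pV2 ?posrE ?exprn_gt0 ?br_gt0 //.
by rewrite ler_weXn2l // br_ge1.
Qed.

(** Two powers of the bracket pay for decay in each coordinate, so four powers suffice for
    integrability in the plane and for summation over a grid of squares. *)
Lemma inv_br4_le (l : R) d : 0 < l -> (br l d ^+ 4)^-1 <= jap (d.1 / l) * jap (d.2 / l).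
Proof.
move=> l0; rewrite (exprM _ 2 2) expr2 invfM ler_pM ?invr_ge0 ?exprn_ge0 ?(ltW (br_gt0 _ l0)) //.
  exact: inv_br_fst.
exact: inv_br_snd.
Qed.

Lemma wQ_le_jap Q x : 0 < side Q ->
  wQ Q x <= jap ((offset Q x).1 / side Q) * jap ((offset Q x).2 / side Q).
Proof.
by move=> l0; rewrite wQE; apply: le_trans (inv_br4_le _ l0); exact: inv_brX_le.
Qed.

Lemma integral_wQ_le Q : 0 < side Q ->
  (\int[leb2]_x (wQ Q x)%:E <= ((pi * side Q) ^+ 2)%:E)%E.
Proof.
move=> l0.
pose l := side Q; pose c := sq_center Q.
have ln : l^-1 != 0 by rewrite invr_eq0 gt_eqF.
pose g (s : R) (b : R) := jap (l^-1 * s + b).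
pose b1 := - c.1 / l; pose b2 := - c.2 / l.
have mg b : measurable_fun setT (fun s : R => g s b).
  by apply: measurable_jap; apply: measurable_funD => //; exact: measurable_funM.
have m1 : measurable_fun setT (fun x : R * R => g x.1 b1).
  exact: (measurableT_comp (mg b1) measurable_fst).
have m2 : measurable_fun setT (fun x : R * R => g x.2 b2).
  exact: (measurableT_comp (mg b2) measurable_snd).
apply: (@le_trans _ _ (\int[leb2]_x (g x.1 b1 * g x.2 b2)%:E)%E).
  apply: ge0_le_integral => //.
  - by move=> x _; rewrite lee_fin ltW // wQ_gt0.
  - by apply/measurable_EFinP; exact: measurable_wQ1.
  - by apply/measurable_EFinP; exact: measurable_funM.
  - move=> x _; rewrite lee_fin; apply: (le_trans (wQ_le_jap x l0)).
    rewrite /g /b1 /b2 /offset /= -/c -/l.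
    by rewrite le_eqVlt; apply/orP; left; apply/eqP; congr (jap _ * jap _); ring.
rewrite /leb2 (fubini_tonelli1 (fun x : measurableTypeR R * measurableTypeR R => (g x.1 b1 * g x.2 b2)%:E)) //; last 2 first.
- by apply/measurable_EFinP; exact: measurable_funM.
- by move=> x; rewrite lee_fin mulr_ge0 // jap_ge0.
rewrite /fubini_F /=.
have E b : (\int[mu]_s (g s b)%:E = (pi * l)%:E)%E.
  rewrite integral_jap_affine // ger0_norm ?invrK // invr_ge0 ltW //.
rewrite le_eqVlt; apply/orP; left; apply/eqP.
transitivity (\int[mu]_s ((pi * l)%:E * (g s b1)%:E))%E.
  apply: eq_integral => s _.
  transitivity (\int[mu]_s' ((g s b1)%:E * (g s' b2)%:E))%E; first by [].
  rewrite ge0_integralZl //.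
  - by rewrite E muleC.
  - by apply/measurable_EFinP; exact: mg.
  - by move=> s' _; rewrite lee_fin jap_ge0.
  - by rewrite lee_fin jap_ge0.
rewrite ge0_integralZl //.
- by rewrite E -EFinM expr2.
- by apply/measurable_EFinP; exact: mg.
- by move=> s' _; rewrite lee_fin jap_ge0.
- by rewrite lee_fin mulr_ge0 ?pi_ge0 // ltW.
Qed.

Lemma integrable_wQ Q : 0 < side Q -> leb2.-integrable setT (EFin \o wQ Q).
Proof.
move=> l0; apply/integrableP; split; first by apply/measurable_EFinP; exact: measurable_wQ1.
under eq_integral => x _ do rewrite /= ger0_norm ?(ltW (wQ_gt0 x l0)) //.
exact: le_lt_trans (integral_wQ_le l0) (ltry _).
Qed.

Lemma Rintegral_wQ_le Q : 0 < side Q -> Rintegral leb2 setT (wQ Q) <= (pi * side Q) ^+ 2.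
Proof.
move=> l0; rewrite -lee_fin /Rintegral fineK; first exact: integral_wQ_le.
by apply: integrable_fin_num => //; exact: integrable_wQ.
Qed.

End Weights.

(** * Sums of weights over subsquares, and transversal sums *)

Section WeightSums.
Context {R : realType}.
Implicit Types (d e x y z : R * R) (Q : @square R).

Lemma subsquare_offset Q s i j x n : side Q = n%:R * 2 ^+ s ->
  let q := subsquare Q s i j in
  offset q x = (((x.1 - (corner Q).1) / 2 ^+ s - 2^-1 - i%:R) * 2 ^+ s,
                ((x.2 - (corner Q).2) / 2 ^+ s - 2^-1 - j%:R) * 2 ^+ s).
Proof.
move=> _ /=; have p : 2 ^+ s != 0 :> R by rewrite expf_neq0.
by rewrite /offset /sq_center /subsquare /=; congr pair; field.
Qed.

Lemma subsquare_center_dist Q s (n i j : nat) : side Q = n%:R * 2 ^+ s ->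
  (i < n)%N -> (j < n)%N ->
  nrm2 ((sq_center (subsquare Q s i j)).1 - (sq_center Q).1,
        (sq_center (subsquare Q s i j)).2 - (sq_center Q).2) <= side Q.
Proof.
move=> sQ iN jN; have p : 0 < 2 ^+ s :> R by rewrite exprn_gt0.
have L0 : 0 <= side Q by rewrite sQ mulr_ge0 // ltW.
rewrite -(@ler_pXn2r _ 2) ?nnegrE ?nrm2_ge0 // sqr_nrm2 /sq_center /=.
have half k : (k < n)%N -> (k%:R * 2 ^+ s + 2 ^+ s / 2 - side Q / 2) ^+ 2 <= (side Q / 2) ^+ 2.
  move=> kn; have k1 : k%:R + 1 <= n%:R :> R by rewrite natr1 ler_nat.
  have k0 : 0 <= k%:R :> R by [].
  rewrite sQ; set l := 2 ^+ s in p *.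
  have h1 : 0 <= k%:R * l by rewrite mulr_ge0 // ltW.
  have h2 : (k%:R + 1) * l <= n%:R * l by rewrite ler_wpM2r // ltW.
  nra.
have h1 := half _ iN; have h2 := half _ jN.
have -> : (corner Q).1 + i%:R * 2 ^+ s + 2 ^+ s / 2 - ((corner Q).1 + side Q / 2) =
  i%:R * 2 ^+ s + 2 ^+ s / 2 - side Q / 2 by ring.
have -> : (corner Q).2 + j%:R * 2 ^+ s + 2 ^+ s / 2 - ((corner Q).2 + side Q / 2) =
  j%:R * 2 ^+ s + 2 ^+ s / 2 - side Q / 2 by ring.
have := sqr_ge0 (side Q); nra.
Qed.

Lemma expr6D_le (a b : R) : 0 <= a -> 0 <= b -> (a + b) ^+ 6 <= 2 ^+ 6 * (a ^+ 6 + b ^+ 6).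
Proof.
move=> a0 b0; wlog ab : a b a0 b0 / a <= b.
  by move=> H; have [h|h] := leP a b; [exact: H|rewrite addrC [a ^+ 6 + _]addrC; apply: H => //; exact: ltW].
apply: (@le_trans _ _ ((2 * b) ^+ 6)).
  by rewrite lerXn2r ?nnegrE ?addr_ge0 ?mulr_ge0 // mulr_natl mulr2n lerD.
by rewrite exprMn ler_wpM2l ?exprn_ge0 // lerDr exprn_ge0.
Qed.

Fact subsquare_const_subproof : {C : R | C = 2 ^+ 206}.
Proof. by exists (2 ^+ 206). Qed.

(* Hidden behind [Qed] so that unification never tries to compute with it. *)
Definition subsquare_const : R := sval subsquare_const_subproof.

Lemma subsquare_constE : subsquare_const = 2 ^+ 206.
Proof. exact: svalP subsquare_const_subproof. Qed.

Lemma subsquare_const_ge0 : 0 <= subsquare_const.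
Proof. by rewrite subsquare_constE exprn_ge0. Qed.

(* Compares the weight of a subsquare with the weight of the big square; the loss is paid
   for by 6 of the 200 powers of decay. *)
Lemma wQ_subsquare_le Q s (n i j : nat) x y : (0 < n)%N -> side Q = n%:R * 2 ^+ s ->
  (i < n)%N -> (j < n)%N ->
  wQ (subsquare Q s i j) x <= subsquare_const * br (side Q) (y.1 - x.1, y.2 - x.2) ^+ 200 * wQ Q y *
            ((n%:R ^+ 6)^-1 + (br (2 ^+ s) (offset (subsquare Q s i j) x) ^+ 6)^-1).
Proof.
move=> n0 sQ iN jN; set q := subsquare Q s i j.
have p : 0 < 2 ^+ s :> R by rewrite exprn_gt0.
have nR : 0 < n%:R :> R by rewrite ltr0n.
have L0 : 0 < side Q by rewrite sQ mulr_gt0.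
set L := side Q; set l : R := 2 ^+ s.
set D := offset q x; set V := (y.1 - x.1, y.2 - x.2).
(* The centres of [q] and [Q] are at most L apart; this costs a factor 2, that is 2^200 for the
   weight. *)
have hL : br L (offset Q y) <= 2 * (br L D * br L V).
  have h : nrm2 (offset Q y) <= nrm2 V + (nrm2 D + L).
    pose c := ((sq_center q).1 - (sq_center Q).1, (sq_center q).2 - (sq_center Q).2).
    have -> : offset Q y = (V.1 + (D.1 + c.1, D.2 + c.2).1, V.2 + (D.1 + c.1, D.2 + c.2).2).
      by rewrite /offset /V /D /c /offset /=; congr pair; ring.
    apply: (le_trans (nrm2D _ _)); rewrite lerD2l; apply: (le_trans (nrm2D _ _)); rewrite lerD2l.
    exact: (subsquare_center_dist sQ iN jN).
  have h' : nrm2 (offset Q y) / L <= nrm2 V / L + (nrm2 D / L + 1).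
    have LV : L / L = 1 by rewrite divff // gt_eqF.
    by rewrite -LV -!mulrDl ler_wpM2r // invr_ge0 ltW.
  rewrite /br; have : 0 <= nrm2 V / L by rewrite divr_ge0 ?nrm2_ge0 // ltW.
  have : 0 <= nrm2 D / L by rewrite divr_ge0 ?nrm2_ge0 // ltW.
  by nra.
have bL := br_gt0 D L0; have bl := br_gt0 D p; have bV := br_gt0 V L0.
have bO := br_gt0 (offset Q y) L0.
pose rho := br L D / br l D.
have rho0 : 0 <= rho by rewrite divr_ge0 // ltW.
have LE : L = n%:R * l by [].
have Dl : nrm2 D / L = n%:R^-1 * (nrm2 D / l).
  by rewrite LE; field; rewrite !gt_eqF.
have n1 : n%:R^-1 <= 1 :> R by rewrite invf_le1 // ler1n.
have q0 : 0 <= nrm2 D / l by rewrite divr_ge0 ?nrm2_ge0 // ltW.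
have ni0 : 0 <= n%:R^-1 :> R by rewrite invr_ge0.
have rho1 : rho <= 1.
  by rewrite /rho ler_pdivrMr // mul1r /br Dl lerD2l ler_piMl.
have rho2 : rho <= n%:R^-1 + (br l D)^-1.
  rewrite /rho ler_pdivrMr // mulrDl mulVf ?gt_eqF // /br Dl; nra.
have rho6 : rho ^+ 200 <= 2 ^+ 6 * ((n%:R ^+ 6)^-1 + (br l D ^+ 6)^-1).
  apply: (@le_trans _ _ (rho ^+ 6)); first by apply: ler_wiXn2l.
  apply: (@le_trans _ _ ((n%:R^-1 + (br l D)^-1) ^+ 6)).
    by rewrite lerXn2r ?nnegrE ?addr_ge0 ?invr_ge0 // ltW.
  by rewrite -!exprVn expr6D_le // invr_ge0 ltW.
have -> : wQ q x = rho ^+ 200 * (br L D ^+ 200)^-1.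
  rewrite wQE -/D -/l /rho exprMn exprVn mulrAC divff ?mul1r //.
  by rewrite expf_neq0 // gt_eqF.
have wy : (br L D ^+ 200)^-1 <= 2 ^+ 200 * br L V ^+ 200 * wQ Q y.
  rewrite wQE -/L ler_pdivlMr ?exprn_gt0 // mulrC ler_pdivrMr ?exprn_gt0 // -!exprMn.
  rewrite lerXn2r ?nnegrE ?mulr_ge0 ?(ltW bL) ?(ltW bV) ?(ltW bO) //.
  by apply: (le_trans hL); rewrite -!mulrA [br L D * _]mulrC.
apply: (le_trans (ler_pM _ _ rho6 wy)); rewrite ?exprn_ge0 ?invr_ge0 ?exprn_ge0 ?(ltW bL) //.
rewrite subsquare_constE (exprD 2 6 200 : 2 ^+ 206 = _).
by rewrite le_eqVlt; apply/orP; left; apply/eqP; ring.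
Qed.

(** The n^2 terms of size n^-6 <= n^-2 add up to at most 1, and the local terms factor into two grid
    sums, each at most 8; hence 65 = 1 + 8 * 8. *)
Lemma sum_wQ_subsquare_le Q s (n : nat) y : (0 < n)%N -> side Q = n%:R * 2 ^+ s ->
  \sum_(i < n) \sum_(j < n) wQ (subsquare Q s i j) y <= subsquare_const * 65 * wQ Q y.
Proof.
move=> n0 sQ.
have p : 0 < 2 ^+ s :> R by rewrite exprn_gt0.
have nR : 0 < n%:R :> R by rewrite ltr0n.
have L0 : 0 < side Q by rewrite sQ mulr_gt0.
pose A := (y.1 - (corner Q).1) / 2 ^+ s - 2^-1.
pose B := (y.2 - (corner Q).2) / 2 ^+ s - 2^-1.
have step (i j : 'I_n) : wQ (subsquare Q s i j) y <=
    subsquare_const * wQ Q y * ((n%:R ^+ 2)^-1 + jap (A - i%:R) * jap (B - j%:R)).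
  apply: (le_trans (wQ_subsquare_le y y n0 sQ (ltn_ord i) (ltn_ord j))).
  have -> : br (side Q) (y.1 - y.1, y.2 - y.2) = 1.
    by rewrite !subrr /br /nrm2 /= expr0n /= addr0 sqrtr0 mul0r addr0.
  rewrite expr1n mulr1.
  rewrite ler_wpM2l ?mulr_ge0 ?subsquare_const_ge0 ?(ltW (wQ_gt0 _ L0)) // lerD //.
    by rewrite lef_pV2 ?posrE ?exprn_gt0 // ler_weXn2l // ler1n.
  apply: (le_trans (inv_brX_le _ p (_ : 4 <= 6)%N)) => //.
  apply: (le_trans (inv_br4_le _ p)).
  by rewrite (subsquare_offset i j y sQ) /= !mulfK ?gt_eqF.
apply: (@le_trans _ _ (\sum_(i < n) \sum_(j < n) subsquare_const * wQ Q y * ((n%:R ^+ 2)^-1 + jap (A - i%:R) * jap (B - j%:R)))).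
  by apply: ler_sum => i _; apply: ler_sum => j _; exact: step.
under eq_bigr => i _ do rewrite -mulr_sumr.
rewrite -mulr_sumr [leRHS]mulrAC ler_wpM2l ?mulr_ge0 ?subsquare_const_ge0 ?(ltW (wQ_gt0 _ L0)) //.
under eq_bigr => i _ do rewrite big_split /= -mulr_sumr sumr_const card_ord.
have e : (n%:R ^+ 2)^-1 *+ n *+ n = 1 :> R.
  by rewrite -mulrnA -[LHS]mulr_natr natrM -expr2 mulVf // expf_neq0 // gt_eqF.
rewrite big_split /= sumr_const card_ord e.
rewrite -mulr_suml (_ : 65 = 1 + 8 * 8); last by ring.
rewrite lerD2l ler_pM ?sum_jap_le // sumr_ge0 // => i _; exact: jap_ge0.
Qed.

Lemma jap_scale_le (c s : R) : 0 < c -> c <= 1 -> jap (c * s) <= (c ^+ 2)^-1 * jap s.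
Proof.
move=> c0 c1; rewrite /jap -invfM lef_pV2 ?posrE ?mulr_gt0 ?exprn_gt0 //; last 2 first.
- by rewrite ltr_pwDl // sqr_ge0.
- by rewrite ltr_pwDl // sqr_ge0.
rewrite exprMn mulrDr mulr1 lerD2r exprn_ile1 // ltW //.
Qed.

Lemma jap_mono (s t : R) : s ^+ 2 <= t ^+ 2 -> jap t <= jap s.
Proof. by move=> h; rewrite /jap lef_pV2 ?posrE ?lerD2l // ltr_pwDl // sqr_ge0. Qed.

(** Two bumps can be large together only if their arguments are close. This extracts from two
    transversal strips the coordinate in which they diverge. *)
Lemma jap_mul_le (s t : R) : jap s * jap t <= 2 * jap (s - t).
Proof.
have q (r : R) : 0 < 1 + r ^+ 2 by rewrite ltr_pwDl // sqr_ge0.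
rewrite /jap -invfM ler_pdivlMr // mulrC ler_pdivrMr ?mulr_gt0 //.
have := sqr_ge0 (s + t); have := sqr_ge0 (s * t); rewrite exprMn; nra.
Qed.

(* Transversality: the index [i + 2 a j] measures the position of a square across the strips
   normal to the parabola at [a]. *)
Lemma sum_transversal_le (a b A B : R) (n : nat) : 2^-1 <= 2 * (b - a) ->
  \sum_(i < n) \sum_(j < n) jap ((A - i%:R - 2 * a * j%:R) / 3) ^+ 2 *
     jap ((B - i%:R - 2 * b * j%:R) / 3) ^+ 2 <= 2 * 72 * 288.
Proof.
move=> ab; have [k [kE k0 k2]] : exists k, [/\ k = 2 * (b - a), 0 < k & 2^-1 <= k].
  by exists (2 * (b - a)); split => //; lra.
pose U (i j : nat) := (A - i%:R - 2 * a * j%:R) / 3.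
pose V (i j : nat) := (B - i%:R - 2 * b * j%:R) / 3.
have j3 (s : R) : jap (s / 3) <= 9 * jap s.
  have h := @jap_scale_le 3^-1 s.
    rewrite invr_gt0 invf_le1 // exprVn invrK [3^-1 * _]mulrC ltr0n ler1n in h.
    apply: (le_trans (h isT isT)); rewrite ler_wpM2r ?jap_ge0 //; lra.
(* The four bumps are grouped into two mixed pairs. As U - V depends on j alone, with slope k / 3 >=
   1/6, one pair decays in j with the factor 36 = 6^2. The other pair is at most [jap (U i j)],
   which for fixed j decays in i with the factor 9 = 3^2. Each grid sum costs 8, hence 72 and
   288. *)
have step i j : jap (U i j) ^+ 2 * jap (V i j) ^+ 2 <=
    2 * (9 * jap (A - 2 * a * j%:R - i%:R)) * (36 * jap ((A - B) / k - (- 1) * j%:R)).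
  have -> : jap (U i j) ^+ 2 * jap (V i j) ^+ 2 =
    (jap (U i j) * jap (V i j)) * (jap (U i j) * jap (V i j)) by ring.
  have h1 : jap (U i j) * jap (V i j) <= 2 * (36 * jap ((A - B) / k - (- 1) * j%:R)).
    apply: (le_trans (jap_mul_le _ _)); rewrite ler_wpM2l //.
    have -> : U i j - V i j = (k / 3) * ((A - B) / k - (- 1) * j%:R).
      rewrite /U /V; have -> : 2 * b = 2 * a + k by rewrite kE; ring.
      by field; rewrite gt_eqF.
    set S := _ - _.
    apply: (@le_trans _ _ (jap (6^-1 * S))).
      by apply: jap_mono; rewrite !exprMn ler_wpM2r ?sqr_ge0 // -!exprMn; nra.
    have h := @jap_scale_le 6^-1 S.
    rewrite invr_gt0 invf_le1 // exprVn invrK [6^-1 * _]mulrC ltr0n ler1n in h.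
    rewrite [_ * S]mulrC; apply: (le_trans (h isT isT)); rewrite ler_wpM2r ?jap_ge0 //; lra.
  have h2 : jap (U i j) * jap (V i j) <= 9 * jap (A - 2 * a * j%:R - i%:R).
    apply: (@le_trans _ _ (jap (U i j))); first by rewrite ler_piMr ?jap_ge0 ?jap_le1.
    by rewrite /U addrAC; exact: j3.
  apply: (le_trans (ler_pM _ _ h2 h1)); rewrite ?mulr_ge0 ?jap_ge0 //.
  by rewrite le_eqVlt; apply/orP; left; apply/eqP; ring.
rewrite exchange_big /=.
apply: (@le_trans _ _ (\sum_(j < n) (2 * 72) * (36 * jap ((B - A) / k - j%:R)))).
  apply: ler_sum => j _.
  apply: (@le_trans _ _ (\sum_(i < n) 2 * (9 * jap (A - 2 * a * j%:R - i%:R)) * (36 * jap ((A - B) / k - (- 1) * j%:R)))).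
    by apply: ler_sum => i _; exact: step.
  rewrite -mulr_suml -mulr_sumr -mulr_sumr.
  have -> : (A - B) / k - -1 * j%:R = - ((B - A) / k - j%:R) by ring.
  rewrite japN ler_wpM2r ?mulr_ge0 ?jap_ge0 // ler_wpM2l //.
  have := sum_jap_le (A - 2 * a * j%:R) n; lra.
rewrite -mulr_sumr -mulr_sumr ler_wpM2l //.
have := sum_jap_le ((B - A) / k) n; lra.
Qed.

End WeightSums.

(** * Smearing along tubes and local orthogonality *)

Section Shifts.
Context {R : realType}.
Notation mu := (@lebesgue_measure R).
Notation leb2 := (@leb2 R).
Implicit Types (x y z : R * R).

Lemma integral_translate z (H : R * R -> \bar R) :
  measurable_fun setT H -> (forall x, 0 <= H x)%E ->
  (\int[leb2]_x H (x.1 + z.1, x.2 + z.2)%R = \int[leb2]_x H x)%E.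
Proof.
move=> mH H0.
have n1 : 1 != 0 :> R by exact: oner_neq0.
have mHt : measurable_fun setT (fun x : R * R => H (x.1 + z.1, x.2 + z.2)).
  apply: (measurableT_comp mH); apply/measurable_fun_pairP; split.
    by apply: measurable_funD => //; exact: measurable_fst.
  by apply: measurable_funD => //; exact: measurable_snd.
rewrite /leb2 (@fubini_tonelli1 _ _ _ _ _ mu mu (fun x : measurableTypeR R * measurableTypeR R => H (x.1 + z.1, x.2 + z.2))) //.
rewrite (@fubini_tonelli1 _ _ _ _ _ mu mu (H : measurableTypeR R * measurableTypeR R -> \bar R)) //.
rewrite /fubini_F /=.
have mF : measurable_fun setT (fun s : R => (\int[mu]_s' H (s, s'))%E).
  exact: (measurable_fun_fubini_tonelli_F (m2 := mu) _ mH H0).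
rewrite (ge0_integral_affine z.1 n1 mF) ?normr1 ?mul1e; last by move=> s; exact: integral_ge0.
apply: eq_integral => s _; rewrite mul1r.
have mS : measurable_fun setT (fun s' : R => H (s + z.1, s')).
  exact: (measurableT_comp mH (pair1_measurable _)).
rewrite (ge0_integral_affine z.2 n1 mS) ?normr1 ?mul1e //.
by apply: eq_integral => s' _; rewrite mul1r.
Qed.

Lemma measurable_translate_pair z (s : (R * R) * R -> R) : measurable_fun setT s ->
  measurable_fun setT (fun p : (R * R) * R => translate p.1 z (s p)).
Proof.
move=> ms; apply/measurable_fun_pairP; split.
  apply: measurable_funD; first exact: (measurableT_comp measurable_fst measurable_fst).
  exact: measurable_funM.
apply: measurable_funD; first exact: (measurableT_comp measurable_snd measurable_fst).
exact: measurable_funM.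
Qed.

Lemma measurable_shifted_product (k : R -> R) (g : R * R -> R) z :
  measurable_fun setT k -> measurable_fun setT g ->
  measurable_fun setT (fun p : (R * R) * R => k p.2 * g (translate p.1 z p.2)).
Proof.
move=> mk mg; apply: measurable_funM; first exact: (measurableT_comp mk measurable_snd).
apply: (measurableT_comp mg); apply: measurable_translate_pair; exact: measurable_snd.
Qed.

Lemma measurable_backshifted_product (k : R -> R) (g : R * R -> R) z :
  measurable_fun setT k -> measurable_fun setT g ->
  measurable_fun setT (fun p : (R * R) * R => k p.2 * g (translate p.1 z (- p.2))).
Proof.
move=> mk mg; apply: measurable_funM; first exact: (measurableT_comp mk measurable_snd).
apply: (measurableT_comp mg); apply: measurable_translate_pair.
by apply: measurable_funN; exact: measurable_snd.
Qed.

(** Tonelli and translation invariance transfer the smearing from the function to the weight, with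
    the direction reversed. *)
Lemma integral_shift (G w : R * R -> R) (k : R -> R) z :
  measurable_fun setT G -> measurable_fun setT w -> measurable_fun setT k ->
  (forall x, 0 <= G x) -> (forall x, 0 <= w x) -> (forall t, 0 <= k t) ->
  (\int[leb2]_x \int[mu]_t (w x * (k t * G (translate x z t)))%:E =
   \int[leb2]_y ((G y)%:E * \int[mu]_t (k t * w (translate y z (- t)))%:E))%E.
Proof.
move=> mG mw mk G0 w0 k0.
pose f (p : (R * R) * R) : \bar R := (w p.1 * (k p.2 * G (translate p.1 z p.2)))%:E.
have mf : measurable_fun setT f.
  apply/measurable_EFinP; apply: measurable_funM; first exact: (measurableT_comp mw measurable_fst).
  exact: measurable_shifted_product.
have f0 p : (0 <= f p)%E by rewrite lee_fin !mulr_ge0.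
have E1 := @fubini_tonelli _ _ _ _ _ (@sleb2 R) mu f mf f0.
pose g (p : (R * R) * R) : \bar R := (w (translate p.1 z (- p.2)) * (k p.2 * G p.1))%:E.
have mg : measurable_fun setT g.
  apply/measurable_EFinP; apply: measurable_funM.
    apply: (measurableT_comp mw); apply: measurable_translate_pair.
    by apply: measurable_funN; exact: measurable_snd.
  apply: measurable_funM; first exact: (measurableT_comp mk measurable_snd).
  exact: (measurableT_comp mG measurable_fst).
have g0 p : (0 <= g p)%E by rewrite lee_fin !mulr_ge0.
have E2 := @fubini_tonelli _ _ _ _ _ (@sleb2 R) mu g mg g0.
transitivity (\int[mu]_t \int[leb2]_x f (x, t))%E; first exact: E1.
transitivity (\int[mu]_t \int[leb2]_x g (x, t))%E.
  apply: eq_integral => t _.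
  have mgt : measurable_fun setT (fun x : R * R => g (x, t)).
    exact: (measurableT_comp mg (pair2_measurable _)).
  rewrite -(integral_translate (t * z.1, t * z.2) mgt) //.
  apply: eq_integral => x _; rewrite /f /g /=; congr (_ * (_ * _))%:E.
  by rewrite /translate /= !mulNr !addrK -surjective_pairing.
rewrite -E2; apply: eq_integral => y _.
rewrite -ge0_integralZl //.
- apply: eq_integral => t _; rewrite /g /= -EFinM; congr EFin.
  by rewrite mulrC -mulrA mulrCA.
- apply/measurable_EFinP; apply: measurable_funM => //; apply: (measurableT_comp mw).
  apply/measurable_fun_pairP; split; apply: measurable_funD => //; apply: measurable_funM => //;
  exact: measurable_funN.
- by move=> t _; rewrite lee_fin mulr_ge0.
- by rewrite lee_fin.
Qed.

End Shifts.

(** * Averages of the weights of small squares along tubes *)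

Section TubeWeight.
Context {R : realType}.
Notation mu := (@lebesgue_measure R).
Implicit Types (x y z : R * R) (Q : @square R).

(** Order 202 = 200 + 2: after the price (1 + |t|)^200 of a shifted weight, a function dominated by
    [jap] remains. *)
Definition decay (t : R) : R := ((1 + `|t|) ^+ 202)^-1.

Lemma decay_gt0 t : 0 < decay t.
Proof. by rewrite invr_gt0 exprn_gt0 // ltr_pwDl. Qed.

Lemma measurable_decay : measurable_fun setT decay.
Proof.
by apply: measurable_funV; apply: measurable_funX; apply: measurable_funD.
Qed.

Lemma decay_le_jap t : (1 + `|t|) ^+ 200 * decay t <= jap t.
Proof.
have q : 0 < 1 + `|t| by rewrite ltr_pwDl.
rewrite /decay (exprD _ 200 2 : _ ^+ 202 = _) invfM mulrA divff ?expf_neq0 ?gt_eqF // mul1r.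
rewrite /jap lef_pV2 ?posrE ?exprn_gt0 // ?ltr_pwDl ?sqr_ge0 //.
have : t ^+ 2 = `|t| ^+ 2 by rewrite real_normK ?num_real.
by move=> ->; have : 0 <= `|t| by []; nra.
Qed.

Lemma decay_le_jap1 t : decay t <= jap t.
Proof.
apply: le_trans (decay_le_jap t); rewrite ler_peMl ?(ltW (decay_gt0 t)) //.
by rewrite exprn_ege1 // lerDl.
Qed.

(** The normal of the parabola at a, scaled so that in [cap_frequency] a cap occupies frequencies up
    to (2 pi / 32) * 2 <= 1/2, the radius of the plateau. Its length stays below L, as
    [wQ_translate] demands. *)
Definition tube_dir (a L : R) : R * R := (- (2 * a * (L / 32)), L / 32).

(** The coordinate of [y] along (1, 2a) in units of l, measured from the centre of the first
    subsquare. It is constant along [tube_dir], and i + 2 a j is its value at the centre of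
    subsquare (i, j). *)
Definition across (a l : R) Q y : R :=
  ((y.1 - (corner Q).1) / l - 2^-1) + 2 * a * ((y.2 - (corner Q).2) / l - 2^-1).

(** Of the six powers of local decay, four control the position across the tube, giving the squared
    [jap]. The last two are integrated along the tube and yield 1/n, because a tube of length
    comparable to n l meets a square of side l only for a fraction 1/n of its parameters. *)
Lemma tube_weight Q s (n i j : nat) y (a : R) : (0 < n)%N -> side Q = n%:R * 2 ^+ s ->
  (i < n)%N -> (j < n)%N -> 0 <= a <= 1 ->
  (\int[mu]_t (decay t * wQ (subsquare Q s i j) (translate y (tube_dir a (side Q)) (- t)))%:E <=
   (subsquare_const * 32 * pi * wQ Q y * (n%:R^-1 * ((n%:R ^+ 5)^-1 +
      jap ((across a (2 ^+ s) Q y - i%:R - 2 * a * j%:R) / 3) ^+ 2)))%:E)%E.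
Proof.
move=> n0 sQ iN jN /andP[a0 a1].
have p : 0 < 2 ^+ s :> R by rewrite exprn_gt0.
have nR : 0 < n%:R :> R by rewrite ltr0n.
have L0 : 0 < side Q by rewrite sQ mulr_gt0.
set q := subsquare Q s i j; set L := side Q; set l : R := 2 ^+ s.
set z := tube_dir a L; set W := wQ Q y.
have W0 : 0 < W by exact: wQ_gt0.
set al := jap ((across a l Q y - i%:R - 2 * a * j%:R) / 3).
have al0 : 0 <= al by exact: jap_ge0.
pose lam := L / 32.
have lam0 : 0 < lam by rewrite divr_gt0.
have zL : nrm2 z <= L.
  rewrite -(@ler_pXn2r _ 2) ?nnegrE ?nrm2_ge0 ?(ltW L0) // sqr_nrm2 /z /tube_dir /=.
  rewrite -/lam; have l3 : 3 * lam <= L by rewrite /lam /L; lra.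
  have a2 : a ^+ 2 <= 1 by rewrite exprn_ile1.
  have h2 : (3 * lam) ^+ 2 <= L ^+ 2 by rewrite lerXn2r ?nnegrE ?mulr_ge0 ?(ltW lam0) ?(ltW L0).
  apply: le_trans h2; have := sqr_ge0 lam; move: (lam) => r r0.
  by rewrite sqrrN !exprMn; nra.
have n1 : nrm2 (1, 2 * a) <= 3.
  rewrite -(@ler_pXn2r _ 2) ?nnegrE ?nrm2_ge0 // sqr_nrm2 /=; nra.
pose b := (offset q y).2 / l.
have pt t : decay t * wQ q (translate y z (- t)) <=
   subsquare_const * W * ((n%:R ^+ 6)^-1 * jap t + al ^+ 2 * jap (- (lam / l) * t + b)).
  set x := translate y z (- t); set D := offset q x.
  have h := wQ_subsquare_le x y n0 sQ iN jN.
  have hb : br (side Q) (y.1 - x.1, y.2 - x.2) <= 1 + `|t|.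
    rewrite /br lerD2l ler_pdivrMr //.
    have -> : (y.1 - x.1, y.2 - x.2) = (t * z.1, t * z.2).
      by rewrite /x /translate /=; congr pair; ring.
    by rewrite nrm2_scale ler_wpM2l.
  have hD : (br l D ^+ 6)^-1 <= al ^+ 2 * jap (- (lam / l) * t + b).
    (* The inner product of [D] with (1, 2a) is independent of t; the division by 3 bounds the norm
       of (1, 2a). *)
    have S1 : (br l D ^+ 2)^-1 <= al.
      apply: inv_br_sqr_le => //.
      have -> : (across a l Q y - i%:R - 2 * a * j%:R) / 3 = (1 * D.1 + 2 * a * D.2) / (3 * l).
        rewrite /D /x /translate /offset /q /sq_center /subsquare /z /tube_dir /across /= -/l.
        by field; rewrite gt_eqF.
      rewrite normrM normfV (gtr0_norm (_ : 0 < 3 * l)) ?mulr_gt0 //.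
      rewrite ler_pdivrMr ?mulr_gt0 // [3 * l]mulrC mulrA divfK ?gt_eqF //.
      apply: (le_trans (abs_inner_le (1, 2 * a) D)).
      by rewrite mulrC ler_wpM2l ?nrm2_ge0.
    have S2 : (br l D ^+ 2)^-1 <= jap (- (lam / l) * t + b).
      have -> : - (lam / l) * t + b = D.2 / l.
        by rewrite /b /D /x /translate /offset /z /tube_dir /= -/lam; field; rewrite gt_eqF.
      exact: inv_br_snd.
    have i0 : 0 <= (br l D ^+ 2)^-1 by rewrite invr_ge0 exprn_ge0 // ltW // br_gt0.
    rewrite (exprM _ 2 3 : _ ^+ 6 = _) -exprVn exprSr expr2 [al ^+ 2]expr2.
    by rewrite ler_pM ?mulr_ge0 // ler_pM.
  apply: (@le_trans _ _ (decay t * (subsquare_const * (1 + `|t|) ^+ 200 * W *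
      ((n%:R ^+ 6)^-1 + al ^+ 2 * jap (- (lam / l) * t + b))))).
    rewrite ler_wpM2l ?(ltW (decay_gt0 t)) //; apply: (le_trans h).
    have i6 : 0 <= (br l D ^+ 6)^-1 by rewrite invr_ge0 exprn_ge0 // ltW // br_gt0.
    have i6' : 0 <= (n%:R ^+ 6)^-1 :> R by rewrite invr_ge0 exprn_ge0 // ltW.
    apply: ler_pM.
    - by apply: mulr_ge0 (ltW W0); apply: mulr_ge0 subsquare_const_ge0 (exprn_ge0 _ (ltW (br_gt0 _ L0))).
    - by rewrite addr_ge0.
    - rewrite ler_wpM2r ?(ltW W0) // ler_wpM2l ?subsquare_const_ge0 //.
      by rewrite lerXn2r ?nnegrE ?(ltW (br_gt0 _ L0)) ?addr_ge0.
    - by rewrite lerD2l.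
  set X := (n%:R ^+ 6)^-1 + _.
  have -> : decay t * (subsquare_const * (1 + `|t|) ^+ 200 * W * X) =
    subsquare_const * W * (((1 + `|t|) ^+ 200 * decay t) * X).
    by move: ((1 + `|t|) ^+ 200) (decay t) X => p1 p2 p3; ring.
  rewrite ler_wpM2l ?mulr_ge0 ?subsquare_const_ge0 ?(ltW W0) //.
  have dj := decay_le_jap t; have j1 := jap_le1 t.
  have d0 : 0 <= (1 + `|t|) ^+ 200 * decay t by rewrite mulr_ge0 ?exprn_ge0 ?addr_ge0 ?(ltW (decay_gt0 t)).
  rewrite /X mulrDr lerD //.
    by rewrite mulrC ler_wpM2l ?invr_ge0 ?exprn_ge0.
  by rewrite ler_piMl ?mulr_ge0 ?exprn_ge0 ?jap_ge0 // (le_trans dj).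
have mx : measurable_fun setT (fun t : R => wQ q (translate y z (- t))).
  apply: measurable_wQ; [apply: measurable_translate1|apply: measurable_translate2]; exact: measurable_funN.
have mj : measurable_fun setT (fun t : R => jap (- (lam / l) * t + b)).
  by apply: measurable_jap; apply: measurable_funD => //; exact: measurable_funM.
have mjt : measurable_fun setT (fun t : R => jap t) by exact: measurable_jap.
have ne : - (lam / l) != 0 by rewrite oppr_eq0 gt_eqF // divr_gt0.
have C0 : 0 <= subsquare_const * W by rewrite mulr_ge0 ?subsquare_const_ge0 // ltW.
have n60 : 0 <= (n%:R ^+ 6)^-1 :> R by rewrite invr_ge0 exprn_ge0 // ltW.
apply: (@le_trans _ _ (\int[mu]_t ((subsquare_const * W)%:E *
    (((n%:R ^+ 6)^-1)%:E * (jap t)%:E + (al ^+ 2)%:E * (jap (- (lam / l) * t + b))%:E)))%E).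
  apply: ge0_le_integral => //.
  - by move=> t _; rewrite lee_fin mulr_ge0 ?(ltW (decay_gt0 t)) // ltW // wQ_gt0.
  - by apply/measurable_EFinP; apply: measurable_funM => //; exact: measurable_decay.
  - apply/measurable_EFinP; apply: measurable_funM => //; apply: measurable_funD; exact: measurable_funM.
  - by move=> t _; rewrite -!EFinM lee_fin.
rewrite ge0_integralZl //; last 2 first.
- apply/measurable_EFinP; apply: measurable_funD; exact: measurable_funM.
- by move=> t _; rewrite -!EFinM -?EFinD lee_fin addr_ge0 // mulr_ge0 ?exprn_ge0 ?jap_ge0.
rewrite ge0_integralD //; last 4 first.
- by move=> t _; rewrite -EFinM lee_fin mulr_ge0 ?jap_ge0.
- apply/measurable_EFinP; exact: measurable_funM.
- by move=> t _; rewrite -EFinM lee_fin mulr_ge0 ?exprn_ge0 ?jap_ge0.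
- apply/measurable_EFinP; exact: measurable_funM.
rewrite ge0_integralZl //; last 2 first.
- by apply/measurable_EFinP.
- by move=> t _; rewrite lee_fin jap_ge0.
rewrite ge0_integralZl //; last 3 first.
- by apply/measurable_EFinP.
- by move=> t _; rewrite lee_fin jap_ge0.
- by rewrite lee_fin exprn_ge0.
rewrite integral_jap integral_jap_affine // normrN gtr0_norm ?divr_gt0 // -!EFinM -?EFinD -?EFinM lee_fin.
(* One unit of t advances n / 32 small squares, so the integral along the tube is 32 pi / n. *)
have -> : lam / l = n%:R / 32 by rewrite /lam /L sQ -/l; field; rewrite gt_eqF.
rewrite -[leRHS]mulrA -[subsquare_const * 32 * pi]mulrA -[leRHS]mulrA.
rewrite -[subsquare_const * W * _]mulrA ler_wpM2l ?subsquare_const_ge0 //.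
rewrite [32 * pi * _]mulrC -[leRHS]mulrA ler_wpM2l ?(ltW W0) //.
have -> : (n%:R ^+ 6)^-1 = n%:R^-1 * (n%:R ^+ 5)^-1 :> R by rewrite -invfM -exprS.
have -> : (pi : R) / (n%:R / 32) = 32 * pi * n%:R^-1 by field; rewrite gt_eqF.
have := @pi_gt0 R; have : 0 <= n%:R^-1 * (n%:R ^+ 5)^-1 :> R.
  by rewrite mulr_ge0 ?invr_ge0 ?exprn_ge0 // ltW.
set u := n%:R^-1 * (n%:R ^+ 5)^-1; set v := n%:R^-1.
rewrite [X in _ -> _ -> _ <= X](_ : _ = 32 * pi * u + 32 * pi * (v * al ^+ 2)); last by rewrite /u -/v; ring.
move=> u0 pi0; have : 0 <= pi * u by rewrite mulr_ge0 // ltW.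
nra.
Qed.

End TubeWeight.

(** * Smearing the energy of one cap along its tubes *)

Section LocalEstimates.
Context {R : realType}.
Notation mu := (@lebesgue_measure R).
Notation leb2 := (@leb2 R).
Notation integrable2 a := (leb2.-integrable setT (EFin \o a)).
Implicit Types (u v : R * R -> R) (x y z : R * R) (Q : @square R).

Lemma EFin_Rintegral {d} {T : measurableType d} (m : {measure set T -> \bar R}) (f : T -> R) :
  m.-integrable setT (EFin \o f) -> (Rintegral m setT f)%:E = (\int[m]_x (f x)%:E)%E.
Proof. by move=> i; rewrite /Rintegral fineK //; exact: integrable_fin_num. Qed.

Lemma Rintegral_decay_le (f : R -> R) (C : R) : 0 <= C -> measurable_fun setT f ->
  (forall t, 0 <= f t) -> (forall t, f t <= C * jap t) ->
  mu.-integrable setT (EFin \o f) /\ Rintegral mu setT f <= C * pi.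
Proof.
move=> C0 mf f0 fC.
have ij : mu.-integrable setT (EFin \o (fun t => C * jap t)).
  by apply: integrable_scale; exact: integrable_jap.
have ifi : mu.-integrable setT (EFin \o f).
  apply: (le_integrable measurableT _ _ ij); first exact/measurable_EFinP.
  by move=> t _; rewrite /= lee_fin (ger0_norm (f0 t)) (le_trans (fC t)) // ler_norm.
split=> //; apply: (@le_trans _ _ (Rintegral mu setT (fun t => C * jap t))).
  exact: le_Rintegral.
rewrite RintegralZl //; last exact: integrable_jap.
by rewrite ler_wpM2l // /Rintegral integral_jap.
Qed.

Definition energy u v (q : R) Q : R :=
  Rintegral leb2 setT (fun x => amp u v x `^ q * wQ Q x).

Lemma amp_powR_bounded u v q x : 0 <= q -> integrable2 u -> integrable2 v ->
  `|amp u v x `^ q| <= (2 * (mass u + mass v)) `^ q.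
Proof.
move=> q0 iu iv; rewrite ger0_norm ?powR_ge0 //.
apply: ge0_ler_powR => //; rewrite ?nnegrE ?amp_ge0 ?mulr_ge0 ?addr_ge0 ?mass_ge0 //.
exact: amp_le_mass.
Qed.

Lemma measurable_amp1 u v : integrable2 u -> integrable2 v -> measurable_fun setT (amp u v).
Proof.
move=> iu iv.
by apply: (@measurable_amp _ _ _ u v id) => //; [exact: measurable_fst|exact: measurable_snd].
Qed.

Lemma integrable_energy u v q Q : 0 <= q -> 0 < side Q -> integrable2 u -> integrable2 v ->
  integrable2 (fun x => amp u v x `^ q * wQ Q x).
Proof.
move=> q0 l0 iu iv.
have H := @integrable_bounded_mul _ _ _ leb2 (wQ Q) (fun x => amp u v x `^ q)
  ((2 * (mass u + mass v)) `^ q) (integrable_wQ l0)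
  (measurable_funpowR q (measurable_amp1 iu iv)) (fun x => amp_powR_bounded x q0 iu iv).
by apply: (eq_integrable measurableT) H => x _; rewrite /= mulrC.
Qed.

Lemma energy_ge0 u v q Q : 0 < side Q -> 0 <= energy u v q Q.
Proof. by move=> l0; apply: Rintegral_ge0 => x _; rewrite mulr_ge0 ?powR_ge0 // ltW // wQ_gt0. Qed.

(** The linear bound of [amp_reproduce] is raised to the power q by Hoelder against the measure with
    density [decay]. The total mass of that measure is at most pi, which explains the factor
    pi^(q-1). *)
Lemma amp_powR_reproduce (psi : R -> R) (C0 : R) u v z (c q : R) : 0 < C0 -> 1 <= q ->
  mu.-integrable setT (EFin \o psi) -> (forall t, `|psi t| <= C0 * decay t) ->
  integrable2 u -> integrable2 v ->
  (forall xi, (u xi != 0) || (v xi != 0) -> ftat psi (phase z xi - c) 1) ->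
  forall x, mu.-integrable setT (EFin \o (fun t => decay t * amp u v (translate x z t) `^ q)) /\
  amp u v x `^ q <= (2 * C0) `^ q * pi `^ (q - 1) *
    Rintegral mu setT (fun t => decay t * amp u v (translate x z t) `^ q).
Proof.
move=> C00 q1 ip pC iu iv hp x.
have q0 : 0 < q by exact: lt_le_trans q1.
have mt1 := measurable_translate1 x z (@measurable_id _ _ setT).
have mt2 := measurable_translate2 x z (@measurable_id _ _ setT).
have ma : measurable_fun setT (fun t => amp u v (translate x z t)) by exact: measurable_amp.
have [id idpi] := @Rintegral_decay_le decay 1 ler01 measurable_decay
  (fun t => ltW (decay_gt0 t)) (fun t => eq_ind_r (fun b => decay t <= b) (decay_le_jap1 t) (mul1r _)).
rewrite mul1r in idpi.
have iA : mu.-integrable setT (EFin \o (fun t => decay t * amp u v (translate x z t))).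
  apply: (@integrable_bounded_mul _ _ _ mu decay (fun t => amp u v (translate x z t)) (2 * (mass u + mass v))) => //.
  by move=> t; rewrite ger0_norm ?amp_ge0 // amp_le_mass.
have iAq : mu.-integrable setT (EFin \o (fun t => decay t * amp u v (translate x z t) `^ q)).
  apply: (@integrable_bounded_mul _ _ _ mu decay (fun t => amp u v (translate x z t) `^ q) ((2 * (mass u + mass v)) `^ q)) => //.
    exact: measurable_funpowR.
  by move=> t; apply: amp_powR_bounded => //; exact: ltW.
split=> //.
set X := Rintegral mu setT _.
have X0 : 0 <= X by apply: Rintegral_ge0 => t _; rewrite mulr_ge0 ?powR_ge0 // ltW // decay_gt0.
have ipa : mu.-integrable setT (EFin \o (fun t => `|psi t| * amp u v (translate x z t))).
  apply: (@integrable_bounded_mul _ _ _ mu (fun t => `|psi t|) (fun t => amp u v (translate x z t)) (2 * (mass u + mass v))) => //.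
    exact: integrable_norm ip.
  by move=> t; rewrite ger0_norm ?amp_ge0 // amp_le_mass.
have s1 : amp u v x <= 2 * C0 * Rintegral mu setT (fun t => decay t * amp u v (translate x z t)).
  apply: (le_trans (amp_reproduce x ip iu iv hp)); rewrite -mulrA ler_wpM2l // -RintegralZl //.
  apply: le_Rintegral => //; first exact: integrable_scale.
  by move=> t _; rewrite mulrA ler_wpM2r ?amp_ge0.
pose th := 1 - q^-1.
have th01 : 0 <= th <= 1 by rewrite /th subr_ge0 invf_le1 // q1 /= lerBlDr lerDl invr_ge0 ltW.
have thE : 1 - th = q^-1 by rewrite /th opprB addrCA subrr addr0.
have f0 t : 0 <= decay t * amp u v (translate x z t) `^ q.
  by rewrite mulr_ge0 ?powR_ge0 // ltW // decay_gt0.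
have [_ s2] := hoelder_Rintegral th01 iAq id f0 (fun t => ltW (decay_gt0 t)).
have s3 : Rintegral mu setT (fun t => decay t * amp u v (translate x z t)) <= X `^ q^-1 * pi `^ th.
  rewrite thE in s2.
  have -> : Rintegral mu setT (fun t => decay t * amp u v (translate x z t)) =
      Rintegral mu setT (fun t => (decay t * amp u v (translate x z t) `^ q) `^ q^-1 * decay t `^ th).
    apply: eq_Rintegral => t _.
    rewrite powRM ?powR_ge0 ?(ltW (decay_gt0 _)) // powR_interp_inv ?amp_ge0 ?gt_eqF //.
    rewrite mulrAC -powRD ?(gt_eqF (decay_gt0 _)) ?implybT // /th addrCA subrr addr0.
    by rewrite powRr1 ?(ltW (decay_gt0 _)).
  apply: (le_trans s2); rewrite ler_wpM2l ?powR_ge0 //.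
  apply: ge0_ler_powR => //; rewrite ?nnegrE ?pi_ge0 //; first by case/andP: th01.
  by apply: Rintegral_ge0 => t _; rewrite ltW // decay_gt0.
have s4 : amp u v x <= 2 * C0 * (X `^ q^-1 * pi `^ th).
  by apply: (le_trans s1); rewrite ler_wpM2l // mulr_ge0 // ltW.
apply: (@le_trans _ _ ((2 * C0 * (X `^ q^-1 * pi `^ th)) `^ q)).
  apply: ge0_ler_powR => //; rewrite ?nnegrE ?amp_ge0 ?mulr_ge0 ?powR_ge0 ?(ltW C00) //; exact: ltW.
have A0 : 0 <= 2 * C0 by rewrite mulr_ge0 // ltW.
rewrite (powRM _ A0) ?mulr_ge0 ?powR_ge0 // (@powRM _ (X `^ q^-1)) ?powR_ge0 //.
rewrite -!powRrM mulVf ?gt_eqF // powRr1 // /th mulrBl mul1r mulVf ?gt_eqF //.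
by rewrite [X * _]mulrC mulrA.
Qed.

(** The products of integrals are read as one integral in independent variables x and y, so a
    pointwise bound on the sum of al(x) be(y) suffices. This converts transversality of strips into
    a bilinear estimate for functions. *)
Lemma sum_Rintegral_mul_le (I : finType) (F G : R * R -> R) (al be : I -> R * R -> R) (D M : R) :
  integrable2 F -> integrable2 G -> (forall x, 0 <= F x) -> (forall x, 0 <= G x) ->
  (forall i, measurable_fun setT (al i)) -> (forall i, measurable_fun setT (be i)) ->
  (forall i x, 0 <= al i x <= M) -> (forall i x, 0 <= be i x <= M) ->
  (forall x y, \sum_i al i x * be i y <= D) ->
  \sum_i Rintegral leb2 setT (fun x => F x * al i x) * Rintegral leb2 setT (fun x => G x * be i x)
  <= D * Rintegral leb2 setT F * Rintegral leb2 setT G.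
Proof.
move=> iF iG F0 G0 mal mbe alM beM hD.
have ia i : integrable2 (fun x => F x * al i x).
  apply: (@integrable_bounded_mul _ _ _ leb2 F (al i) M); [by []|exact: mal|move=> x].
  by have /andP[h1 h2] := alM i x; rewrite ger0_norm.
have ib i : integrable2 (fun x => G x * be i x).
  apply: (@integrable_bounded_mul _ _ _ leb2 G (be i) M); [by []|exact: mbe|move=> x].
  by have /andP[h1 h2] := beM i x; rewrite ger0_norm.
have inner x : \sum_i al i x * Rintegral leb2 setT (fun y => G y * be i y) <= D * Rintegral leb2 setT G.
  under eq_bigr => i _ do rewrite -RintegralZl //.
  rewrite -Rintegral_sum; last by move=> i _; exact: integrable_scale.
  rewrite -RintegralZl //; apply: le_Rintegral => //.
  - by apply: integrable_sumR => i _; exact: integrable_scale.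
  - exact: integrable_scale.
  - move=> y _; under eq_bigr => i _ do rewrite mulrCA.
    by rewrite -mulr_sumr mulrC ler_wpM2r.
under eq_bigr => i _ do rewrite -RintegralZr //.
rewrite -Rintegral_sum; last first.
  move=> i _; have := integrable_scale (Rintegral leb2 setT (fun y => G y * be i y)) (ia i).
  by apply: (eq_integrable measurableT) => x _; rewrite /= mulrC.
rewrite mulrAC -RintegralZl //; apply: le_Rintegral => //.
- apply: integrable_sumR => i _.
  have := integrable_scale (Rintegral leb2 setT (fun y => G y * be i y)) (ia i).
  by apply: (eq_integrable measurableT) => x _; rewrite /= mulrC.
- exact: integrable_scale.
- move=> x _; under eq_bigr => i _ do rewrite -mulrA.
  by rewrite -mulr_sumr mulrC ler_wpM2r.
Qed.

(** The factor left by [tube_weight] beside the weight of [Q] when n = 2^m: a tail, plus the profile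
    of the strip through subsquare (i, j). *)
Definition tube_factor (a : R) Q (m i j : nat) y : R :=
  (2 ^+ m)^-1 * (((2 ^+ m) ^+ 5)^-1 +
    jap ((across a (2 ^+ m) Q y - i%:R - 2 * a * j%:R) / 3) ^+ 2).

Lemma measurable_tube_factor (a : R) Q m i j : measurable_fun setT (tube_factor a Q m i j).
Proof.
have mac : measurable_fun setT (across a (2 ^+ m) Q).
  by apply: measurable_funD; last apply: measurable_funM => //; apply: measurable_funB => //;
    apply: measurable_funM => //; apply: measurable_funB => //;
    (exact: measurable_fst || exact: measurable_snd).
apply: measurable_funM => //; apply: measurable_funD => //; apply: measurable_funX.
by apply: measurable_jap; apply: measurable_funM => //; do 2! apply: measurable_funB => //.
Qed.

Lemma tube_factor_bounds (a : R) Q m i j y : 0 <= tube_factor a Q m i j y <= 2.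
Proof.
have h1 : 0 <= (2 ^+ m : R)^-1 <= 1.
  by rewrite invr_ge0 exprn_ge0 //= invf_le1 ?exprn_gt0 // exprn_ege1 // ler1n.
have h2 : 0 <= ((2 ^+ m : R) ^+ 5)^-1 <= 1.
  by rewrite invr_ge0 !exprn_ge0 //= invf_le1 ?exprn_gt0 // !exprn_ege1 // ler1n.
rewrite /tube_factor; set J := jap _.
have h3 : 0 <= J ^+ 2 <= 1 by rewrite exprn_ge0 ?jap_ge0 //= exprn_ile1 ?jap_ge0 ?jap_le1.
by move: h1 h2 h3 => /andP[? ?] /andP[? ?] /andP[? ?]; apply/andP; split; nra.
Qed.

Section BallInflation.
Variables (psi : R -> R) (C0 : R).
Hypotheses (C00 : 0 < C0) (ip : mu.-integrable setT (EFin \o psi)).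
Hypothesis pC : forall t, `|psi t| <= C0 * decay t.
Hypothesis pft : forall w, `|w| <= 2^-1 -> ftat psi w 1.

Definition cap_supported (a h delta : R) u v := forall xi, (u xi != 0) || (v xi != 0) ->
  Nbhd delta xi /\ a <= xi.1 <= a + h.

(** Up to the carrier -a^2, the pairing of xi with (-2a, 1) is (xi.2 - xi.1^2) + (xi.1 - a)^2. Both
    terms lie between 0 and h^2 = 1 / L, so L times their sum is at most 2, and pi <= 4 finishes. *)
Lemma cap_frequency (a L delta h : R) u v xi : 0 < L -> 0 <= h -> delta <= h ^+ 2 ->
  L * h ^+ 2 = 1 -> cap_supported a h delta u v -> (u xi != 0) || (v xi != 0) ->
  `|phase (tube_dir a L) xi - 2 * pi * (L / 32 * (- a ^+ 2))| <= 2^-1.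
Proof.
move=> L0 h0 dh Lh cs hx.
have [[/andP[x0 x1] /andP[y0 y1]] /andP[ax xa]] := cs xi hx.
have -> : phase (tube_dir a L) xi - 2 * pi * (L / 32 * - a ^+ 2) =
  2 * pi / 32 * (L * (xi.2 - xi.1 ^+ 2 + (xi.1 - a) ^+ 2)).
  by rewrite /phase /dot2 /tube_dir /=; field.
set r := xi.2 - _ + _.
have r0 : 0 <= r by rewrite /r addr_ge0 ?sqr_ge0 // subr_ge0.
have rh : r <= 2 * h ^+ 2.
  have : (xi.1 - a) ^+ 2 <= h ^+ 2 by rewrite lerXn2r ?nnegrE ?subr_ge0 // lerBlDl.
  by rewrite /r; move: y1; lra.
have Lr : L * r <= 2.
  by apply: (le_trans (ler_wpM2l (ltW L0) rh)); rewrite mulrCA Lh mulr1.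
have Lr0 : 0 <= L * r by rewrite mulr_ge0 // ltW.
have p4 : pi <= 4 :> R by have := @pihalf_lt2 R; lra.
have p0 := @pi_ge0 R.
rewrite ger0_norm ?mulr_ge0 ?divr_ge0 ?mulr_ge0 //; nra.
Qed.

(** The q-th power of the modulus is replaced by its average along the tube, the average is moved
    onto the weight, and [tube_weight] evaluates it. After this step the small square occurs only
    through [tube_factor]. *)
Lemma energy_subsquare_le u v q (a delta : R) Q (m i j : nat) : 1 <= q ->
  integrable2 u -> integrable2 v -> side Q = 2 ^+ (2 * m) -> delta <= 4 ^- m ->
  (i < 2 ^ m)%N -> (j < 2 ^ m)%N -> 0 <= a <= 1 ->
  cap_supported a (2 ^- m) delta u v ->
  energy u v q (subsquare Q m i j) <=
  (2 * C0) `^ q * pi `^ (q - 1) * (subsquare_const * 32 * pi) *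
  Rintegral leb2 setT (fun y => amp u v y `^ q * wQ Q y * tube_factor a Q m i j y).
Proof.
move=> q1 iu iv sQ dm im jm a01 cs.
have q0 : 0 <= q by lra.
have L0 : 0 < side Q by rewrite sQ exprn_gt0.
have n0 : (0 < 2 ^ m)%N by rewrite expn_gt0.
have sQ' : side Q = (2 ^ m)%N%:R * 2 ^+ m by rewrite sQ natrX -exprD addnn -mul2n.
have l0 : 0 < side (subsquare Q m i j) by rewrite /= exprn_gt0.
set C1 := (2 * C0) `^ q * pi `^ (q - 1).
have C10 : 0 <= C1 by rewrite mulr_ge0 ?powR_ge0.
pose z := tube_dir a (side Q).
pose c : R := 2 * pi * (side Q / 32 * (- a ^+ 2)).
have hp xi : (u xi != 0) || (v xi != 0) -> ftat psi (phase z xi - c) 1.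
  move=> hx; apply: pft; apply: (@cap_frequency _ _ delta (2 ^- m) u v) => //.
  - apply: (le_trans dm); rewrite exprVn -exprM (_ : 4 = 2 ^+ 2 :> R); last by rewrite expr2 -natrM.
    by rewrite -exprM mulnC.
  - by rewrite sQ exprVn -exprM [(m * 2)%N]mulnC divff // expf_neq0.
have rep := amp_powR_reproduce C00 q1 ip pC iu iv hp.
pose G y := amp u v y `^ q.
have mG : measurable_fun setT G by apply: measurable_funpowR; exact: measurable_amp1.
have G0 y : 0 <= G y by exact: powR_ge0.
set w := wQ (subsquare Q m i j).
have w0 x : 0 <= w x by rewrite ltW // wQ_gt0.
have mw : measurable_fun setT w by exact: measurable_wQ1.
pose C2 : R := subsquare_const * 32 * pi.
have C20 : 0 <= C2 by rewrite !mulr_ge0 ?subsquare_const_ge0 ?pi_ge0.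
have tf y := tube_factor_bounds a Q m i j y.
have mtf := measurable_tube_factor a Q m i j.
have iT : integrable2 (fun y => amp u v y `^ q * wQ Q y * tube_factor a Q m i j y).
  apply: (@integrable_bounded_mul _ _ _ leb2 (fun y => amp u v y `^ q * wQ Q y) (tube_factor a Q m i j) 2) => //.
    exact: integrable_energy.
  by move=> y; have /andP[h1 h2] := tf y; rewrite ger0_norm.
rewrite /energy -lee_fin EFin_Rintegral; last exact: integrable_energy.
rewrite -mulrA EFinM [(C2 * _)%:E]EFinM EFin_Rintegral // -/C2.
have mker : measurable_fun setT (fun p : (R * R) * R => w p.1 * (decay p.2 * G (translate p.1 z p.2))).
  apply: measurable_funM; first exact: (measurableT_comp mw measurable_fst).
  exact: measurable_shifted_product measurable_decay mG.
have kpos x t : 0 <= w x * (decay t * G (translate x z t)).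
  by rewrite !mulr_ge0 // ltW // decay_gt0.
apply: (@le_trans _ _ (\int[leb2]_x (C1%:E * \int[mu]_t (w x * (decay t * G (translate x z t)))%:E))%E).
  apply: ge0_le_integral => //.
  - by move=> x _; rewrite lee_fin mulr_ge0 ?powR_ge0 ?w0.
  - by apply/measurable_EFinP; exact: (measurable_funM mG mw).
  - apply: emeasurable_funM => //.
    apply: (measurable_fun_fubini_tonelli_F (m2 := mu) (fun p => (w p.1 * (decay p.2 * G (translate p.1 z p.2)))%:E)).
      by apply/measurable_EFinP; exact: mker.
    by move=> pp; rewrite lee_fin kpos.
  - move=> x _; have [ix hx] := rep x.
    have ix' : mu.-integrable setT (EFin \o (fun t => w x * (decay t * G (translate x z t)))).
      exact: integrable_scale.
    rewrite -(EFin_Rintegral ix') -EFinM lee_fin RintegralZl // mulrC mulrCA ler_wpM2l //.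
rewrite ge0_integralZl //; last 2 first.
- apply: (measurable_fun_fubini_tonelli_F (m2 := mu) (fun p => (w p.1 * (decay p.2 * G (translate p.1 z p.2)))%:E)).
    by apply/measurable_EFinP; exact: mker.
  by move=> pp; rewrite lee_fin kpos.
- by move=> x _; apply: integral_ge0 => t _; rewrite lee_fin.
rewrite lee_wpmul2l ?lee_fin //.
rewrite (integral_shift z mG mw measurable_decay G0 w0 (fun t => ltW (decay_gt0 t))).
have mwk := measurable_backshifted_product z measurable_decay mw.
apply: (@le_trans _ _ (\int[leb2]_y (C2%:E * (amp u v y `^ q * wQ Q y * tube_factor a Q m i j y)%:E))%E).
  apply: ge0_le_integral => //.
  - move=> y _; apply: mule_ge0; first by rewrite lee_fin.
    by apply: integral_ge0 => t _; rewrite lee_fin mulr_ge0 // ltW // decay_gt0.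
  - apply: emeasurable_funM; first exact/measurable_EFinP.
    apply: (measurable_fun_fubini_tonelli_F (m2 := mu) (fun p => (decay p.2 * w (translate p.1 z (- p.2)))%:E)).
      by apply/measurable_EFinP.
    by move=> p; rewrite lee_fin mulr_ge0 // ltW // decay_gt0.
  - apply: emeasurable_funM => //; exact: (measurable_int _ iT).
  - move=> y _; have h := tube_weight y n0 sQ' im jm a01.
    apply: (le_trans (lee_wpmul2l _ h)); first by rewrite lee_fin.
    rewrite -!EFinM lee_fin natrX -/(tube_factor a Q m i j y) /G /C2.
    move: (amp u v y `^ q) (wQ Q y) (tube_factor a Q m i j y) => X1 X2 X3.
    by rewrite le_eqVlt; apply/orP; left; apply/eqP; ring.
rewrite ge0_integralZl //.
- exact: (measurable_int _ iT).
- move=> y _; have /andP[h1 _] := tf y; rewrite lee_fin; apply: mulr_ge0 h1.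
  by rewrite mulr_ge0 ?powR_ge0 // ltW // wQ_gt0.
Qed.

End BallInflation.

End LocalEstimates.

(** * The transversal pair estimate and local orthogonality *)

Section BilinearEstimates.
Context {R : realType}.
Notation mu := (@lebesgue_measure R).
Notation leb2 := (@leb2 R).
Notation integrable2 a := (leb2.-integrable setT (EFin \o a)).
Implicit Types (u v : R * R -> R) (x y z : R * R) (Q : @square R).

(** The first summand bounds the product of the two strip profiles, the 3 bounds the terms that
    contain a tail. The value is sealed, like [subsquare_const], against computation. *)
Fact transversal_const_subproof : {C : R | 0 <= C & C = 2 * 72 * 288 + 3}.
Proof.
exists (2 * 72 * 288 + 3); last exact: erefl.
by apply: addr_ge0; [apply: mulr_ge0; [apply: mulr_ge0|]|]; exact: ler0n.
Qed.

Definition transversal_const : R := s2val transversal_const_subproof.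

Lemma transversal_const_ge0 : 0 <= transversal_const.
Proof. exact: s2valP transversal_const_subproof. Qed.

Lemma transversal_constE : transversal_const = 2 * 72 * 288 + 3.
Proof. exact: s2valP' transversal_const_subproof. Qed.

(** With e = n^-5 and X, Y in [0, 1], the product (e + X)(e + Y) is at most 3e + XY. The tails sum
    to 3 n^2 e <= 3 over the n^2 squares, and the XY terms are the transversal sum. *)
Lemma tube_factor_sum (a b : R) Q m x y : 2^-1 <= 2 * (b - a) ->
  \sum_(p : 'I_(2 ^ m) * 'I_(2 ^ m)) tube_factor a Q m p.1 p.2 x * tube_factor b Q m p.1 p.2 y
  <= transversal_const * (4 ^+ m)^-1.
Proof.
move=> ab; set n := (2 ^ m)%N.
have nE : (2 : R) ^+ m = n%:R by rewrite natrX.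
have n0 : 0 < n%:R :> R by rewrite -nE exprn_gt0.
have n1 : 1 <= n%:R :> R by rewrite -nE exprn_ege1 // ler1n.
pose X (i j : nat) := jap ((across a (2 ^+ m) Q x - i%:R - 2 * a * j%:R) / 3) ^+ 2.
pose Y (i j : nat) := jap ((across b (2 ^+ m) Q y - i%:R - 2 * b * j%:R) / 3) ^+ 2.
have X01 i j : 0 <= X i j <= 1.
  by rewrite exprn_ge0 ?jap_ge0 //= exprn_ile1 ?jap_ge0 ?jap_le1.
have Y01 i j : 0 <= Y i j <= 1.
  by rewrite exprn_ge0 ?jap_ge0 //= exprn_ile1 ?jap_ge0 ?jap_le1.
have i2 : (4 ^+ m)^-1 = n%:R^-1 * n%:R^-1 :> R.
  by rewrite -nE -invfM -exprMn -natrM.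
rewrite i2.
have e0 : 0 < (n%:R ^+ 5)^-1 :> R by rewrite invr_gt0 exprn_gt0.
have e1 : (n%:R ^+ 5)^-1 <= 1 :> R by rewrite invf_le1 ?exprn_gt0 // exprn_ege1.
have ni : 0 < n%:R^-1 :> R by rewrite invr_gt0.
have step (p : 'I_n * 'I_n) : tube_factor a Q m p.1 p.2 x * tube_factor b Q m p.1 p.2 y <=
    n%:R^-1 * n%:R^-1 * (3 * (n%:R ^+ 5)^-1 + X p.1 p.2 * Y p.1 p.2).
  rewrite /tube_factor nE -nE -/(X p.1 p.2) -/(Y p.1 p.2) nE mulrACA ler_wpM2l ?mulr_ge0 ?(ltW ni) //.
  move: (X01 p.1 p.2) (Y01 p.1 p.2) => /andP[x0 x1] /andP[y0 y1].
  move: (X _ _) (Y _ _) x0 x1 y0 y1 => X1 Y1 x0 x1 y0 y1.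
  move: ((n%:R ^+ 5)^-1) e0 e1 => e h0 h1; nra.
apply: (@le_trans _ _ (\sum_(p : 'I_n * 'I_n) n%:R^-1 * n%:R^-1 * (3 * (n%:R ^+ 5)^-1 + X p.1 p.2 * Y p.1 p.2))).
  by apply: ler_sum => p _; exact: step.
rewrite -mulr_sumr mulrC ler_wpM2r ?mulr_ge0 ?(ltW ni) // big_split /=.
rewrite sumr_const card_prod card_ord -(pair_bigA _ (fun i j : 'I_n => X i j * Y i j)) /=.
have h := sum_transversal_le (across a (2 ^+ m) Q x) (across b (2 ^+ m) Q y) n ab.
have h3 : 3 * (n%:R ^+ 5)^-1 *+ (n * n) <= 3 :> R.
  rewrite -[leLHS]mulr_natr natrM -mulrA ler_piMr //.
  rewrite (exprD _ 3 2 : _ ^+ 5 = _) -expr2 invfM -mulrA mulVf ?expf_neq0 ?gt_eqF // mulr1.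
  by rewrite invf_le1 ?exprn_gt0 // exprn_ege1.
by rewrite transversal_constE addrC lerD.
Qed.

(** Each energy on a small square becomes an integral against [tube_factor], after which the sum
    over squares involves only the two families of strips. *)
Lemma ball_inflation (q : R) : 1 <= q -> exists2 C : R, 0 < C &
  forall m Q (delta a b : R) u v u' v', side Q = 2 ^+ (2 * m) -> delta <= 4 ^- m ->
  integrable2 u -> integrable2 v -> integrable2 u' -> integrable2 v' ->
  0 <= a <= 1 -> 0 <= b <= 1 -> 2^-1 <= 2 * (b - a) ->
  cap_supported a (2 ^- m) delta u v -> cap_supported b (2 ^- m) delta u' v' ->
  \sum_(p : 'I_(2 ^ m) * 'I_(2 ^ m))
    energy u v q (subsquare Q m p.1 p.2) * energy u' v' q (subsquare Q m p.1 p.2)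
  <= C * (4 ^+ m)^-1 * energy u v q Q * energy u' v' q Q.
Proof.
move=> q1; have [psi [C0 [C00 _ ip pC pft]]] := @plateau_kernel R 202.
have [C1 C10 C1E] : exists2 C1 : R, 0 <= C1 &
    (2 * C0) `^ q * pi `^ (q - 1) * (subsquare_const * 32 * pi) = C1.
  eexists; last exact: erefl.
  by rewrite !mulr_ge0 ?powR_ge0 ?subsquare_const_ge0 ?pi_ge0.
have C11 : 0 <= C1 * C1 by exact: mulr_ge0.
exists (C1 * C1 * transversal_const + 1).
  by apply: ltr_wpDl ltr01; apply: mulr_ge0 C11 transversal_const_ge0.
move=> m Q delta a b u v u' v' sQ dm iu iv iu' iv' a01 b01 ab cs cs'.
have q0 : 0 <= q by lra.
have L0 : 0 < side Q by rewrite sQ exprn_gt0.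
have h (p : 'I_(2 ^ m) * 'I_(2 ^ m)) := energy_subsquare_le C00 ip pC pft q1 iu iv sQ dm (ltn_ord p.1) (ltn_ord p.2) a01 cs.
rewrite C1E in h.
have h' (p : 'I_(2 ^ m) * 'I_(2 ^ m)) := energy_subsquare_le C00 ip pC pft q1 iu' iv' sQ dm (ltn_ord p.1) (ltn_ord p.2) b01 cs'.
rewrite C1E in h'.
pose A (p : 'I_(2 ^ m) * 'I_(2 ^ m)) := Rintegral leb2 setT (fun y => amp u v y `^ q * wQ Q y * tube_factor a Q m p.1 p.2 y).
pose B (p : 'I_(2 ^ m) * 'I_(2 ^ m)) := Rintegral leb2 setT (fun y => amp u' v' y `^ q * wQ Q y * tube_factor b Q m p.1 p.2 y).
apply: (@le_trans _ _ (C1 * C1 * \sum_p A p * B p)).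
  rewrite mulr_sumr; apply: ler_sum => p _.
  have l0 : 0 < side (subsquare Q m p.1 p.2) by rewrite /= exprn_gt0.
  rewrite mulrACA; apply: ler_pM; [exact: energy_ge0|exact: energy_ge0|exact: h|exact: h'].
have E0 := energy_ge0 u v q L0; have E0' := energy_ge0 u' v' q L0.
have fpos u1 v1 x : 0 <= amp u1 v1 x `^ q * wQ Q x by rewrite mulr_ge0 ?powR_ge0 // ltW // wQ_gt0.
have hs : \sum_p A p * B p <= transversal_const * (4 ^+ m)^-1 * energy u v q Q * energy u' v' q Q.
  apply: (@sum_Rintegral_mul_le R _ _ _ (fun p : 'I_(2 ^ m) * 'I_(2 ^ m) => tube_factor a Q m p.1 p.2)
    (fun p => tube_factor b Q m p.1 p.2) _ 2).
  - exact: integrable_energy.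
  - exact: integrable_energy.
  - exact: fpos.
  - exact: fpos.
  - by move=> p; exact: measurable_tube_factor.
  - by move=> p; exact: measurable_tube_factor.
  - by move=> p x; exact: tube_factor_bounds.
  - by move=> p x; exact: tube_factor_bounds.
  - by move=> x y; exact: tube_factor_sum.
apply: (le_trans (ler_wpM2l C11 hs)).
have i0 : 0 <= (4 ^+ m : R)^-1 by rewrite invr_ge0 exprn_ge0.
move: (energy u v q Q) (energy u' v' q Q) ((4 ^+ m)^-1) E0 E0' i0 => E E' i4 E0 E0' i0.
rewrite !mulrA; apply: ler_wpM2r => //; apply: ler_wpM2r => //; apply: ler_wpM2r => //.
by rewrite lerDl.
Qed.

Lemma phase_horizontal (l : R) xi : phase (l, 0) xi = 2 * pi * (l * xi.1).
Proof. by rewrite /phase /dot2 /= mul0r addr0. Qed.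

(* The weight is comparable with its average against a kernel whose Fourier transform has
   compact support, and for such averages the pieces are exactly almost orthogonal. *)
Lemma local_orthogonality : exists2 C : R, 0 < C &
  forall n (u v : 'I_n -> R * R -> R) (c : nat -> R) Q, 0 < side Q ->
  (forall j, c j.+1 = c j + (side Q)^-1) ->
  (forall j, integrable2 (u j)) -> (forall j, integrable2 (v j)) ->
  (forall j xi, (u j xi != 0) || (v j xi != 0) -> c j <= xi.1 < c j.+1) ->
  energy (fun xi => \sum_(j < n) u j xi) (fun xi => \sum_(j < n) v j xi) 2 Q <=
  C * \sum_(j < n) energy (u j) (v j) 2 Q.
Proof.
have [K [C [c0 [[C0 c00 mK] K0 KC Kc [iK Kft]]]]] := @compact_kernel R 202.
(* For t in [1, 2] one has 1 + |t| <= 3, so a shift changes the weight by at most 3^200. The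
   constant [B] then turns the lower bound into a comparison with the weight itself. *)
have [t3 t30 t3E] : exists2 t : R, 0 < t & 3 ^+ 200 = t by exists (3 ^+ 200); rewrite ?exprn_gt0.
have [B B0 BE] : exists2 B : R, 0 < B & B * (t3^-1 * c0) = 1.
  exists (t3^-1 * c0)^-1; first by rewrite invr_gt0 mulr_gt0 ?invr_gt0.
  by rewrite mulVf // gt_eqF // mulr_gt0 ?invr_gt0.
exists (B * (3 * (C * pi))).
  by apply: mulr_gt0 B0 _; apply: mulr_gt0 => //; exact: mulr_gt0 C0 (pi_gt0 R).
move=> n u v c Q l0 hc iu iv supp.
(* Horizontal translation by l sees only xi.1. Non-adjacent strips of width 1 / l are at least 1 / l
   apart, so their phases differ by at least 2 pi, outside the spectrum of [K]. *)
pose l := side Q; pose z : R * R := (l, 0).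
have zl : nrm2 z <= l.
  by rewrite /nrm2 /z /= expr0n addr0 sqrtr_sqr ger0_norm // ltW.
have cmono j d : c (j + d)%N = c j + d%:R * l^-1.
  elim: d => [|d IH]; first by rewrite addn0 mul0r addr0.
  by rewrite addnS hc IH -natr1 mulrDl mul1r addrA.
have far (j k : 'I_n) xi xi' : (j.+1 < k)%N -> c j <= xi.1 < c j.+1 -> c k <= xi'.1 < c k.+1 ->
    2 <= phase z xi' - phase z xi.
  move=> jk /andP[_ h1] /andP[h2 _].
  have ck : c j.+1 + l^-1 <= c k.
    have -> : (k : nat) = (j.+1 + (k - j.+1))%N by rewrite subnKC // ltnW.
    rewrite cmono lerD2l -[leLHS]mul1r ler_wpM2r ?invr_ge0 ?(ltW l0) //.
    by rewrite ler1n subn_gt0.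
  rewrite !phase_horizontal -mulrBr -mulrBr.
  have h3 : 1 <= l * (xi'.1 - xi.1).
    rewrite -(mulfV (_ : l != 0)) ?gt_eqF // ler_wpM2l ?(ltW l0) //; lra.
  have p2 := @pi_ge2 R; nra.
have orth (j k : 'I_n) : (j.+1 < k)%N || (k.+1 < j)%N ->
    forall xi xi', (u j xi != 0) || (v j xi != 0) -> (u k xi' != 0) || (v k xi' != 0) ->
    ftat K (phase z xi' - phase z xi) 0.
  move=> jk xi xi' /supp h1 /supp h2; apply: Kft; case/orP: jk => jk.
    by rewrite (le_trans (far _ _ _ _ jk h1 h2)) // ler_norm.
  by rewrite distrC (le_trans (far _ _ _ _ jk h2 h1)) // ler_norm.
have pw x := almost_orthogonal x iK K0 iu iv orth.
set U := (fun xi => \sum_(j < n) u j xi); set V := (fun xi => \sum_(j < n) v j xi).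
have iU : integrable2 U by apply: integrable_sumR => j _; exact: iu.
have iV : integrable2 V by apply: integrable_sumR => j _; exact: iv.
have w0 x : 0 <= wQ Q x by rewrite ltW // wQ_gt0.
have mw := measurable_wQ1 Q.
have mwt y : measurable_fun setT (fun t : R => wQ Q (translate y z (- t))).
  apply: measurable_wQ; [apply: measurable_translate1|apply: measurable_translate2]; exact: measurable_funN.
have mKw y : measurable_fun setT (fun t => K t * wQ Q (translate y z (- t))) by exact: measurable_funM.
have KwC y t : K t * wQ Q (translate y z (- t)) <= C * wQ Q y * jap t.
  have h1 := wQ_translate y (- t) l0 zl; rewrite normrN in h1.
  apply: (@le_trans _ _ (C * decay t * ((1 + `|t|) ^+ 200 * wQ Q y))).
    by rewrite ler_pM // KC.
  have h2 := decay_le_jap t.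
  move: ((1 + `|t|) ^+ 200) (decay t) (jap t) (wQ Q y) (w0 y) h2 => p d j w w0' h2.
  have -> : C * d * (p * w) = C * w * (p * d) by ring.
  by apply: ler_wpM2l => //; apply: mulr_ge0 => //; exact: ltW.
have upper y : (\int[mu]_t (K t * wQ Q (translate y z (- t)))%:E <= (C * wQ Q y * pi)%:E)%E.
  have CW : 0 <= C * wQ Q y by rewrite mulr_ge0 ?(ltW C0).
  have Kw0 t : 0 <= K t * wQ Q (translate y z (- t)) by rewrite mulr_ge0.
  have [i1 i2] := Rintegral_decay_le CW (mKw y) Kw0 (KwC y).
  by rewrite -(EFin_Rintegral i1) lee_fin.
have lower y : ((wQ Q y)%:E <= B%:E * \int[mu]_t (K t * wQ Q (translate y z (- t)))%:E)%E.
  have h : ((t3^-1 * c0 * wQ Q y)%:E <= \int[mu]_t (K t * wQ Q (translate y z (- t)))%:E)%E.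
    have -> : (t3^-1 * c0 * wQ Q y)%:E =
        (\int[mu]_(t in `[1%R, 2%R]) (t3^-1 * c0 * wQ Q y)%:E)%E.
      rewrite integral_cst //= lebesgue_measure_itv /= lte_fin ltr1n -EFinD -EFinM.
      by rewrite -[2]/(1 + 1) addrK mulr1.
    apply: (@le_trans _ _ (\int[mu]_(t in `[1%R, 2%R]) (K t * wQ Q (translate y z (- t)))%:E)%E).
      apply: ge0_le_integral => //.
      - by move=> t _; rewrite lee_fin; apply: mulr_ge0 => //; apply: mulr_ge0; rewrite ?invr_ge0 ltW.
      - by apply/measurable_EFinP; apply: measurable_funTS; exact: mKw.
      - move=> t /=; rewrite in_itv /= => t12; rewrite lee_fin [t3^-1 * _]mulrC -mulrA.
        apply: ler_pM; [exact: ltW|by apply: mulr_ge0 => //; rewrite invr_ge0 ltW|exact: Kc|].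
        have h1 := wQ_translate_ge y (- t) l0 zl; rewrite normrN in h1.
        rewrite mulrC ler_pdivrMr // mulrC; apply: (le_trans h1); apply: ler_wpM2r => //.
        case/andP: t12 => t1 t2; rewrite ger0_norm; last by lra.
        by rewrite -t3E; apply: lerXn2r; rewrite ?nnegrE; lra.
    apply: ge0_subset_integral => //; first by apply/measurable_EFinP; exact: mKw.
    by move=> t _; rewrite lee_fin mulr_ge0.
  have := lee_wpmul2l (_ : 0 <= B%:E)%E h; rewrite lee_fin (ltW B0) => /(_ isT).
  rewrite -EFinM; apply: le_trans.
  by rewrite mulrA BE mul1r.
pose G y := amp U V y ^+ 2.
have mG : measurable_fun setT G by apply: measurable_funX; exact: measurable_amp1.
have G0 y : 0 <= G y by exact: sqr_ge0.
have mGj j : measurable_fun setT (fun y => amp (u j) (v j) y ^+ 2).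
  by apply: measurable_funX; exact: measurable_amp1.
have E2 u1 v1 : energy u1 v1 2 Q = Rintegral leb2 setT (fun y => amp u1 v1 y ^+ 2 * wQ Q y).
  by apply: eq_Rintegral => y _; rewrite -[2]/(2%:R) powR_mulrn ?amp_ge0.
have iE u1 v1 : integrable2 u1 -> integrable2 v1 -> integrable2 (fun y => amp u1 v1 y ^+ 2 * wQ Q y).
  move=> i1 i2; apply: (eq_integrable measurableT) (integrable_energy (ler0n R 2) l0 i1 i2) => y _.
  by rewrite /= powR_mulrn ?amp_ge0.
have mKwp := measurable_backshifted_product z mK mw.
have mI : measurable_fun setT (fun y : R * R => (\int[mu]_t (K t * wQ Q (translate y z (- t)))%:E)%E).
  apply: (measurable_fun_fubini_tonelli_F (m2 := mu) (fun p => (K p.2 * wQ Q (translate p.1 z (- p.2)))%:E)).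
    by apply/measurable_EFinP; exact: mKwp.
  by move=> pp; rewrite lee_fin mulr_ge0.
have I0 y : (0 <= \int[mu]_t (K t * wQ Q (translate y z (- t)))%:E)%E.
  by apply: integral_ge0 => t _; rewrite lee_fin mulr_ge0.
pose H (g : R * R -> R) : \bar R := (\int[leb2]_x \int[mu]_t (wQ Q x * (K t * g (translate x z t)))%:E)%E.
have mker (g : R * R -> R) : measurable_fun setT g -> measurable_fun setT (fun p : (R * R) * R => wQ Q p.1 * (K p.2 * g (translate p.1 z p.2))).
  move=> mg; apply: measurable_funM; first exact: (measurableT_comp mw measurable_fst).
  exact: measurable_shifted_product mK mg.
have mH (g : R * R -> R) : measurable_fun setT g -> (forall y, 0 <= g y) ->
    measurable_fun setT (fun x : R * R => (\int[mu]_t (wQ Q x * (K t * g (translate x z t)))%:E)%E).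
  move=> mg g0; apply: (measurable_fun_fubini_tonelli_F (m2 := mu) (fun p => (wQ Q p.1 * (K p.2 * g (translate p.1 z p.2)))%:E)).
    by apply/measurable_EFinP; exact: mker.
  by move=> pp; rewrite lee_fin !mulr_ge0.
have kp (a : R) x t : 0 <= a -> 0 <= wQ Q x * (K t * a).
  by move=> a0; apply: mulr_ge0 => //; apply: mulr_ge0.
have mHj j := mH _ (mGj j) (fun y => sqr_ge0 _).
(* The weight is replaced by its [K]-average, and the average is moved onto the function, where
   almost orthogonality acts pointwise in x. *)
have step1 : ((energy U V 2 Q)%:E <= B%:E * H G)%E.
  rewrite E2 (EFin_Rintegral (iE _ _ iU iV)) /H (integral_shift z mG mw mK G0 w0 K0).
  rewrite -ge0_integralZl //; last 3 first.
  - by apply: emeasurable_funM => //; exact/measurable_EFinP.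
  - by move=> y _; rewrite mule_ge0 // lee_fin.
  - by rewrite lee_fin ltW.
  apply: ge0_le_integral => //.
  - by move=> y _; rewrite lee_fin mulr_ge0 ?sqr_ge0.
  - by apply/measurable_EFinP; exact: measurable_funM.
  - by apply: emeasurable_funM => //; apply: emeasurable_funM => //; exact/measurable_EFinP.
  - by move=> y _; rewrite muleCA EFinM lee_wpmul2l ?lee_fin ?sqr_ge0.
have step2 : (H G <= 3%:E * \sum_(j < n) H (fun y => amp (u j) (v j) y ^+ 2)%R)%E.
  rewrite /H -ge0_integral_sum //; last first.
  - by move=> j x _; apply: integral_ge0 => t _; rewrite lee_fin; apply: kp; exact: sqr_ge0.
  rewrite -ge0_integralZl //; last 2 first.
  - by apply: emeasurable_sum => j; exact: mHj.
  - by move=> x _; apply: sume_ge0 => j _; apply: integral_ge0 => t _; rewrite lee_fin; apply: kp; exact: sqr_ge0.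
  apply: ge0_le_integral => //.
  - by move=> x _; apply: integral_ge0 => t _; rewrite lee_fin; apply: kp; exact: sqr_ge0.
  - exact: mH mG G0.
  - apply: emeasurable_funM => //; apply: emeasurable_sum => j; exact: mHj.
  - move=> x _.
    have ig u1 v1 : integrable2 u1 -> integrable2 v1 ->
        mu.-integrable setT (EFin \o (fun t => K t * amp u1 v1 (translate x z t) ^+ 2)).
      move=> i1 i2; apply: (@integrable_bounded_mul _ _ _ mu K (fun t => amp u1 v1 (translate x z t) ^+ 2)
         ((2 * (mass u1 + mass v1)) ^+ 2)) => //.
        apply: measurable_funX; apply: measurable_amp => //.
          exact: (measurable_translate1 x z (@measurable_id _ _ setT)).
        exact: (measurable_translate2 x z (@measurable_id _ _ setT)).
      move=> t; rewrite ger0_norm ?sqr_ge0 // lerXn2r ?nnegrE ?amp_ge0 ?mulr_ge0 ?addr_ge0 ?mass_ge0 //.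
      exact: amp_le_mass.
    have iw u1 v1 : integrable2 u1 -> integrable2 v1 ->
       (\int[mu]_t (wQ Q x * (K t * amp u1 v1 (translate x z t) ^+ 2))%:E =
        (wQ Q x * Rintegral mu setT (fun t => K t * amp u1 v1 (translate x z t) ^+ 2))%:E)%E.
      move=> i1 i2; rewrite -RintegralZl //; last exact: ig.
      by rewrite EFin_Rintegral //; apply: integrable_scale; exact: ig.
    rewrite /G iw // (eq_bigr (fun j => (wQ Q x * Rintegral mu setT (fun t => K t * amp (u j) (v j) (translate x z t) ^+ 2))%:E)); last by move=> j _; rewrite iw.
    rewrite sumEFin -EFinM lee_fin -mulr_sumr mulrCA ler_wpM2l //.
(* The average returns to the weight, where the decay of [K] bounds it by a multiple of the
   weight. *)
have step3 j : (H (fun y => amp (u j) (v j) y ^+ 2)%R <= (C * pi * energy (u j) (v j) 2 Q)%:E)%E.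
  have g0 y : 0 <= amp (u j) (v j) y ^+ 2 by exact: sqr_ge0.
  rewrite /H (integral_shift z (mGj j) mw mK g0 w0 K0).
  rewrite E2 EFinM (EFin_Rintegral (iE _ _ (iu j) (iv j))) -ge0_integralZl //; last 3 first.
  - by apply/measurable_EFinP; exact: measurable_funM (mGj j) mw.
  - by move=> y _; rewrite lee_fin; exact: mulr_ge0.
  - by rewrite lee_fin mulr_ge0 ?pi_ge0 // ltW.
  apply: ge0_le_integral => //.
  - by move=> y _; rewrite mule_ge0 // lee_fin.
  - by apply: emeasurable_funM; [apply/measurable_EFinP; exact: mGj|exact: mI].
  - by apply/measurable_EFinP; apply: measurable_funM => //; exact: measurable_funM (mGj j) mw.
  - move=> y _; apply: (le_trans (lee_wpmul2l _ (upper y))); first by rewrite lee_fin.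
    rewrite -!EFinM lee_fin le_eqVlt; apply/orP; left; apply/eqP; ring.
have : ((energy U V 2 Q)%:E <= B%:E * (3%:E * (\sum_(j < n) (C * pi * energy (u j) (v j) 2 Q)%:E)))%E.
  apply: (le_trans step1); rewrite lee_wpmul2l ?lee_fin ?(ltW B0) //.
  apply: (le_trans step2); rewrite lee_wpmul2l ?lee_fin //.
  by apply: lee_sum => j _; exact: step3.
rewrite sumEFin -!EFinM lee_fin -mulr_sumr. move=> h; apply: (le_trans h).
by rewrite le_eqVlt; apply/orP; left; apply/eqP; ring.
Qed.

End BilinearEstimates.

(** * Sums over pairs of caps *)

Section BilinearSums.
Context {R : realType}.
Implicit Types th : R.

Lemma powR_le2 (a b th : R) : 0 <= th -> 0 <= a -> a <= b -> a `^ th <= b `^ th.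
Proof. by move=> t0 a0 ab; apply: ge0_ler_powR; rewrite ?nnegrE //; exact: le_trans ab. Qed.

(* Minkowski's inequality in l^th, applied to the expansion of the product of the two sums. *)
Lemma bilinear_sum (I J T : finType) (P : pred I) (Q : pred J)
    (a : T -> I -> R) (b : T -> J -> R) (A : I -> R) (B : J -> R) D th : 1 <= th -> 0 <= D ->
  (forall t i, 0 <= a t i) -> (forall t j, 0 <= b t j) ->
  (forall i, 0 <= A i) -> (forall j, 0 <= B j) ->
  (forall i j, P i -> Q j -> \sum_t (a t i * b t j) `^ th <= D * (A i * B j) `^ th) ->
  \sum_t (\sum_(i | P i) a t i) `^ th * (\sum_(j | Q j) b t j) `^ th <=
  D * ((\sum_(i | P i) A i) `^ th * (\sum_(j | Q j) B j) `^ th).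
Proof.
move=> th1 D0 a0 b0 A0 B0 h.
have th0 : 0 < th by exact: lt_le_trans th1.
pose PQ (p : I * J) := P p.1 && Q p.2.
have prodE (f : I -> R) (g : J -> R) : (forall i, 0 <= f i) -> (forall j, 0 <= g j) ->
    (\sum_(i | P i) f i) `^ th * (\sum_(j | Q j) g j) `^ th =
    (\sum_(p | PQ p) f p.1 * g p.2) `^ th.
  move=> f0 g0; rewrite -(powRM th) ?sumr_ge0 //; congr (_ `^ _).
  by rewrite big_distrlr /= pair_big.
under eq_bigr => t _ do rewrite (prodE (a t) (b t)) //.
rewrite prodE //.
apply: (le_trans (@minkowski_sum R _ _ PQ xpredT (fun p t => a t p.1 * b t p.2) th th1 _)).
  by move=> p t; exact: mulr_ge0.
have thn : th != 0 by rewrite gt_eqF.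
have -> : D * (\sum_(p | PQ p) A p.1 * B p.2) `^ th = (\sum_(p | PQ p) (D `^ th^-1 * (A p.1 * B p.2))) `^ th.
  rewrite -mulr_sumr (powRM th) ?powR_ge0 //; last by apply: sumr_ge0 => p _; exact: mulr_ge0.
  by rewrite -powRrM mulVf // powRr1.
apply: powR_le2; first exact: ltW.
  by apply: sumr_ge0 => p _; exact: powR_ge0.
apply: ler_sum => -[i j] /andP[/= Pi Qj].
have AB0 : 0 <= A i * B j by exact: mulr_ge0.
apply: (@le_trans _ _ ((D * (A i * B j) `^ th) `^ th^-1)).
  apply: powR_le2 (h _ _ Pi Qj); rewrite ?invr_ge0 ?(ltW th0) //.
  by apply: sumr_ge0 => t _; exact: powR_ge0.
by rewrite (powRM th^-1) ?powR_ge0 // -[X in _ * X]powRrM divff // powRr1.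
Qed.

Section PowerSums.
Context (I J T : finType) (P : pred I) (Q : pred J).
Variables (a : T -> I -> R) (b : T -> J -> R) (A : I -> R) (B : J -> R) (D e th : R).
Hypotheses (th1 : 1 <= th) (D0 : 0 <= D).
Hypotheses (a0 : forall t i, 0 <= a t i) (b0 : forall t j, 0 <= b t j).
Hypotheses (A0 : forall i, 0 <= A i) (B0 : forall j, 0 <= B j).

Let powE (x y : R) : (x `^ e * y `^ e) `^ th = x `^ (e * th) * y `^ (e * th).
Proof. by rewrite (powRM th (powR_ge0 _ _) (powR_ge0 _ _)) -!powRrM. Qed.

(** The case of a genuinely bilinear bound. It serves for e = 4/p and th = p/4, where the powers
    cancel and the estimate for a single pair of caps applies unchanged. *)
Lemma bilinear_sum_product : e * th = 1 ->
  (forall i j, P i -> Q j -> \sum_t a t i * b t j <= D * (A i * B j)) ->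
  \sum_t (\sum_(i | P i) a t i `^ e) `^ th * (\sum_(j | Q j) b t j `^ e) `^ th <=
  D * ((\sum_(i | P i) A i `^ e) `^ th * (\sum_(j | Q j) B j `^ e) `^ th).
Proof.
move=> eth h.
apply: (bilinear_sum (a := fun t i => a t i `^ e) (b := fun t j => b t j `^ e)
  (A := fun i => A i `^ e) (B := fun j => B j `^ e)) => // *; try exact: powR_ge0.
rewrite powE eth !powRr1 //; under eq_bigr => t _ do rewrite powE eth !powRr1 //.
exact: h.
Qed.

(** The case of separate bounds for the two families: Cauchy-Schwarz over [t] decouples them, each
    contributes the square root of D, and together they give D. *)
Lemma bilinear_sum_factor : e * th = 2^-1 ->
  (forall i, \sum_t a t i <= D * A i) -> (forall j, \sum_t b t j <= D * B j) ->
  \sum_t (\sum_(i | P i) a t i `^ e) `^ th * (\sum_(j | Q j) b t j `^ e) `^ th <=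
  D * ((\sum_(i | P i) A i `^ e) `^ th * (\sum_(j | Q j) B j `^ e) `^ th).
Proof.
move=> eth ha hb.
have h01 : 0 <= (2^-1 : R) < 1 by apply/andP; split; lra.
have h2 : 0 <= 2^-1 :> R by lra.
have hE : 1 - 2^-1 = 2^-1 :> R by field.
apply: (bilinear_sum (a := fun t i => a t i `^ e) (b := fun t j => b t j `^ e)
  (A := fun i => A i `^ e) (B := fun j => B j `^ e)) => //; try by move=> *; exact: powR_ge0.
move=> i j _ _.
rewrite powE eth; under eq_bigr => t _ do rewrite powE eth.
have := hoelder_sum (index_enum T) xpredT h01 (a0^~ i) (b0^~ j).
rewrite hE => h; apply: (le_trans h).
have Sa : 0 <= \sum_t a t i by exact: sumr_ge0.
have Sb : 0 <= \sum_t b t j by exact: sumr_ge0.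
apply: (le_trans (ler_pM (powR_ge0 _ _) (powR_ge0 _ _) (powR_le2 h2 Sa (ha i)) (powR_le2 h2 Sb (hb j)))).
rewrite (powRM 2^-1 D0 (A0 i)) (powRM 2^-1 D0 (B0 j)) mulrACA -powRD; last first.
  by rewrite -[X in X + _]hE subrK oner_eq0.
by rewrite -[X in X + _]hE subrK powRr1.
Qed.

End PowerSums.

Lemma sum_ord_mul (a b : nat) (f : nat -> R) :
  \sum_(i < a * b) f i = \sum_(i < a) \sum_(j < b) f (i * b + j)%N.
Proof.
elim: a => [|a IH]; first by rewrite mul0n !big_ord0.
rewrite big_ord_recr /= -IH -!(big_mkord xpredT f) mulSnr (@big_cat_nat _ _ _ (a * b)) ?leq_addr //=.
by congr (_ + _); rewrite -{1}[(a * b)%N]add0n big_addn addKn big_mkord; apply: eq_bigr => j _; rewrite addnC.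
Qed.

End BilinearSums.

(** * Normalised means on a square and their Hoelder inequalities *)

Section Means.
Context {R : realType}.
Notation leb2 := (@leb2 R).
Notation integrable2 a := (leb2.-integrable setT (EFin \o a)).
Implicit Types (u v : R * R -> R) (x y z : R * R) (Q : @square R).

Definition mean u v (q : R) Q := (sq_area Q)^-1 * energy u v q Q.

Lemma sq_area_gt0 Q : 0 < side Q -> 0 < sq_area Q.
Proof. exact: exprn_gt0. Qed.

Lemma mean_ge0 u v q Q : 0 < side Q -> 0 <= mean u v q Q.
Proof. by move=> l0; rewrite mulr_ge0 ?energy_ge0 // invr_ge0 ltW // sq_area_gt0. Qed.

(** Log-convexity of moments: [mean] carries no q-th root, so the exponents themselves combine
    linearly, and the weight and the factor 1 / |Q| split as powers 1 - th and th. *)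
Lemma mean_interpolation u v (p q s th : R) Q : 0 < side Q -> 0 <= th <= 1 ->
  0 < p -> 0 < s -> 0 <= q -> q = s * (1 - th) + p * th ->
  integrable2 u -> integrable2 v ->
  mean u v q Q <= mean u v s Q `^ (1 - th) * mean u v p Q `^ th.
Proof.
move=> l0 th01 p0 s0 q0 qE iu iv.
have a0 : 0 <= (sq_area Q)^-1 by rewrite invr_ge0 ltW // sq_area_gt0.
have an : (sq_area Q)^-1 != 0 by rewrite invr_eq0 gt_eqF // sq_area_gt0.
have w0 x := wQ_gt0 x l0.
have f0 e x : 0 <= amp u v x `^ e * wQ Q x by rewrite mulr_ge0 ?powR_ge0 // ltW.
have [_ h] := hoelder_Rintegral th01 (integrable_energy (ltW s0) l0 iu iv)
  (integrable_energy (ltW p0) l0 iu iv) (f0 s) (f0 p).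
rewrite /mean (powRM (1 - th) a0) ?energy_ge0 // (powRM th a0) ?energy_ge0 //.
rewrite mulrACA -powRD ?an ?implybT // subrK powRr1 // ler_wpM2l //.
apply: le_trans h; rewrite le_eqVlt; apply/orP; left; apply/eqP.
apply: eq_Rintegral => x _.
rewrite (powRM (1 - th)) ?powR_ge0 ?(ltW (w0 x)) // (powRM th) ?powR_ge0 ?(ltW (w0 x)) //.
rewrite mulrACA -[in RHS]powRD ?(gt_eqF (w0 x)) ?implybT // subrK powRr1 ?(ltW (w0 x)) //.
rewrite -!powRrM -powRD -?qE //.
(* Adding exponents of a possibly zero base calls for a nonzero total; [q] is positive as a convex
   combination of the positive [s] and [p]. *)
case/andP: th01 => t0 t1; apply/implyP => /eqP q00; exfalso; nra.
Qed.

(** The weight has total mass at most pi^2 |Q| rather than 1, which is the origin of the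
    constant. *)
Lemma mean_hoelder u v (q : R) Q : 0 < side Q -> 2 <= q -> integrable2 u -> integrable2 v ->
  mean u v 2 Q <= (pi ^+ 2) `^ (1 - 2 / q) * mean u v q Q `^ (2 / q).
Proof.
move=> l0 q2 iu iv; have q0 : 0 < q by lra.
have th01 : 0 <= 1 - 2 / q <= 1.
  by rewrite subr_ge0 ler_pdivrMr // mul1r q2 /= lerBlDr lerDl divr_ge0 // ltW.
have a0 : 0 <= (sq_area Q)^-1 by rewrite invr_ge0 ltW // sq_area_gt0.
have an : (sq_area Q)^-1 != 0 by rewrite invr_eq0 gt_eqF // sq_area_gt0.
have w0 x := wQ_gt0 x l0.
have f0 e x : 0 <= amp u v x `^ e * wQ Q x by rewrite mulr_ge0 ?powR_ge0 // ltW.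
have [_ h] := hoelder_Rintegral th01 (integrable_energy (ltW q0) l0 iu iv)
  (integrable_wQ l0) (f0 q) (fun x => ltW (w0 x)).
rewrite subKr in h.
have W0 : 0 <= Rintegral leb2 setT (wQ Q) by apply: Rintegral_ge0 => x _; exact: ltW (w0 x).
have W1 : (sq_area Q)^-1 * Rintegral leb2 setT (wQ Q) <= pi ^+ 2.
  rewrite mulrC ler_pdivrMr ?sq_area_gt0 // /sq_area -exprMn; exact: Rintegral_wQ_le.
apply: (@le_trans _ _ ((sq_area Q)^-1 * (energy u v q Q `^ (2 / q) * Rintegral leb2 setT (wQ Q) `^ (1 - 2 / q)))).
  rewrite ler_wpM2l //; apply: le_trans h; rewrite le_eqVlt; apply/orP; left; apply/eqP.
  apply: eq_Rintegral => x _.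
  rewrite (powRM (2 / q)) ?powR_ge0 ?(ltW (w0 x)) // -powRrM mulrCA divff ?gt_eqF // mulr1.
  by rewrite -mulrA -powRD ?(gt_eqF (w0 x)) ?implybT // addrC subrK powRr1 ?(ltW (w0 x)).
rewrite /mean; move: (energy u v q Q) (energy_ge0 u v q l0) (Rintegral _ _ _) W0 W1 => E E0 W W0 W1.
move: (sq_area Q)^-1 a0 an W1 => s s0 sn W1.
have -> : s * (E `^ (2 / q) * W `^ (1 - 2 / q)) = (s * W) `^ (1 - 2 / q) * (s * E) `^ (2 / q).
  rewrite (powRM (1 - 2 / q)) // (powRM (2 / q)) // mulrACA -powRD ?sn ?implybT //.
  by rewrite subrK powRr1 // [E `^ _ * _]mulrC.
apply: ler_wpM2r; first exact: powR_ge0.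
apply: powR_le2 W1; [by case/andP: th01|exact: mulr_ge0].
Qed.

End Means.

(** * Square functions over caps and their interpolation *)

Section Caps.
Context {R : realType}.
Notation leb2 := (@leb2 R).
Notation integrable2 a := (leb2.-integrable setT (EFin \o a)).
Implicit Types (Q : @square R) (I : R * R).
Variables (u v : R * R -> R).
Hypotheses (iu : integrable2 u) (iv : integrable2 v).

Definition capmean (q : R) Q (sigma k : nat) : R :=
  mean (cut (k%:R / 2 ^+ sigma) (k.+1%:R / 2 ^+ sigma) u)
       (cut (k%:R / 2 ^+ sigma) (k.+1%:R / 2 ^+ sigma) v) q Q.

Definition dyadic_in I (sigma k : nat) : bool :=
  (I.1 <= k%:R / 2 ^+ sigma) && (k.+1%:R / 2 ^+ sigma <= I.2).

(** The power 2/q turns the q-th moment [capmean] into a squared averaged L^q norm, so this is the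
    inner sum of [Mpq] on one square. *)
Definition capsum (q : R) Q (sigma : nat) I : R :=
  \sum_(k < 2 ^ sigma | dyadic_in I sigma k) capmean q Q sigma k `^ (2 / q).

Definition bimean (p q : R) Q (sigma : nat) : R :=
  capsum q Q sigma I1 `^ (p / 4) * capsum q Q sigma I2 `^ (p / 4).

Lemma powR_two_half (a : R) : 0 <= a -> a `^ (2 / 2) = a.
Proof. by move=> a0; rewrite divff // powRr1. Qed.

Lemma capmean_ge0 q Q sigma k : 0 < side Q -> 0 <= capmean q Q sigma k.
Proof. exact: mean_ge0. Qed.

Lemma capsum_ge0 q Q sigma I : 0 <= capsum q Q sigma I.
Proof. by apply: sumr_ge0 => k _; exact: powR_ge0. Qed.

Lemma bimean_ge0 p q Q sigma : 0 <= bimean p q Q sigma.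
Proof. by rewrite mulr_ge0 ?powR_ge0. Qed.

Lemma capsum_hoelder q Q sigma I : 0 < side Q -> 2 <= q ->
  capsum 2 Q sigma I <= (pi ^+ 2) `^ (1 - 2 / q) * capsum q Q sigma I.
Proof.
move=> l0 q2; rewrite /capsum mulr_sumr; apply: ler_sum => k _.
rewrite (powR_two_half (capmean_ge0 _ _ _ l0)).
by apply: mean_hoelder => //; exact: integrable_cut.
Qed.

(** The moments interpolate with parameter kappa/2, since p/2 = 2 (1 - kappa/2) + p kappa/2. Raised
    to the power 4/p, the squared norms carry the exponents 1 - kappa and kappa, which add up to 1,
    so Hoelder applies to the sum over caps. *)
Lemma capsum_interpolation p Q sigma I : 0 < side Q -> 4 <= p ->
  capsum (p / 2) Q sigma I <= capsum 2 Q sigma I `^ (1 - kappa p) * capsum p Q sigma I `^ kappa p.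
Proof.
move=> l0 p4.
have p2 : 0 < p - 2 by lra.
have p0 : 0 < p by lra.
have k0 : 0 <= kappa p by rewrite divr_ge0 // ?(ltW p2) // subr_ge0.
have k1 : kappa p < 1 by rewrite /kappa ltr_pdivrMr // mul1r ltrD2l ltrN2 ltr_nat.
apply: (@le_trans _ _ (\sum_(k < 2 ^ sigma | dyadic_in I sigma k)
   (capmean 2 Q sigma k `^ (2 / 2)) `^ (1 - kappa p) * (capmean p Q sigma k `^ (2 / p)) `^ kappa p)); last first.
  by apply: hoelder_sum; [rewrite k0 k1|move=> k; exact: powR_ge0|move=> k; exact: powR_ge0].
apply: ler_sum => k _.
have h : capmean (p / 2) Q sigma k <=
    capmean 2 Q sigma k `^ (1 - kappa p / 2) * capmean p Q sigma k `^ (kappa p / 2).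
  apply: (mean_interpolation l0 _ p0 (ltr0Sn R 1) _ _ (integrable_cut _ _ iu) (integrable_cut _ _ iv)).
  - by rewrite divr_ge0 //= ler_pdivrMr // mul1r; lra.
  - by rewrite divr_ge0 // ltW.
  - by rewrite /kappa; field; rewrite gt_eqF.
have e0 : 0 <= 2 / (p / 2) by apply: divr_ge0 => //; apply: divr_ge0 => //; exact: ltW.
apply: (le_trans (powR_le2 e0 (capmean_ge0 _ _ _ l0) h)).
move: (capmean 2 Q sigma k) (capmean p Q sigma k) => X Y.
rewrite (powRM (2 / (p / 2)) (powR_ge0 _ _) (powR_ge0 _ _)) -!powRrM.
have -> : (1 - kappa p / 2) * (2 / (p / 2)) = 2 / 2 * (1 - kappa p).
  by rewrite /kappa; field; rewrite !gt_eqF.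
have -> // : kappa p / 2 * (2 / (p / 2)) = 2 / p * kappa p.
by field; rewrite gt_eqF.
Qed.

Lemma bimean_interpolation p Q sigma : 0 < side Q -> 4 <= p ->
  bimean p (p / 2) Q sigma <= bimean p 2 Q sigma `^ (1 - kappa p) * bimean p p Q sigma `^ kappa p.
Proof.
move=> l0 p4; have p0 : 0 <= p / 4 by lra.
have h I := powR_le2 p0 (capsum_ge0 _ _ _ I) (capsum_interpolation sigma I l0 p4).
apply: (le_trans (ler_pM (powR_ge0 _ _) (powR_ge0 _ _) (h I1) (h I2))).
rewrite /bimean; move: (kappa p) (capsum 2 Q sigma I1) (capsum p Q sigma I1)
  (capsum 2 Q sigma I2) (capsum p Q sigma I2) => k a b c d.
have P := @powR_ge0 R.
rewrite !(powRM (p / 4) (P _ _) (P _ _)) (powRM (1 - k) (P _ _) (P _ _)) (powRM k (P _ _) (P _ _)).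
have AC x y z : (x `^ y) `^ z = (x `^ z) `^ y :> R by rewrite -!powRrM mulrC.
rewrite (AC a (1 - k)) (AC b k) (AC c (1 - k)) (AC d k).
move: ((a `^ _) `^ _) ((b `^ _) `^ _) ((c `^ _) `^ _) ((d `^ _) `^ _) => a1 b1 c1 d1.
by rewrite mulrACA.
Qed.

End Caps.

(** * Comparing two scales of caps and of squares *)

Section Multiscale.
Context {R : realType}.
Notation leb2 := (@leb2 R).
Notation integrable2 a := (leb2.-integrable setT (EFin \o a)).
Implicit Types (u v : R * R -> R) (Q : @square R) (I : R * R).

Lemma cap_supported_cut u v delta m k :
  (forall xi, (u xi != 0) || (v xi != 0) -> Nbhd delta xi) ->
  cap_supported (k%:R / 2 ^+ m) (2 ^- m) delta
    (cut (k%:R / 2 ^+ m) (k.+1%:R / 2 ^+ m) u) (cut (k%:R / 2 ^+ m) (k.+1%:R / 2 ^+ m) v).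
Proof.
have kE : k.+1%:R / 2 ^+ m = k%:R / 2 ^+ m + 2 ^- m :> R by rewrite -natr1 mulrDl mul1r.
move=> supp xi; rewrite kE => h.
have [h1 /andP[h2 h3]] : ((u xi != 0) || (v xi != 0)) /\ k%:R / 2 ^+ m <= xi.1 < k%:R / 2 ^+ m + 2 ^- m.
  by case/orP: h => /cut_neq0[-> ->]; rewrite ?orbT.
by split; [exact: supp|rewrite h2 ltW].
Qed.

(** A cap of length 2^-m is cut into 2^m pieces of length 4^-m, exactly the inverse side of [Q],
    which is the resolution of [local_orthogonality]. *)
Lemma capsum_refine : exists2 C : R, 0 < C & forall m Q I u v, side Q = 2 ^+ (2 * m) ->
  integrable2 u -> integrable2 v ->
  capsum u v 2 Q m I <= C * capsum u v 2 Q (2 * m) I.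
Proof.
have [C C0 hC] := @local_orthogonality R; exists C => // m Q I u v sQ iu iv.
have l0 : 0 < side Q by rewrite sQ exprn_gt0.
have mE : (2 ^ (2 * m) = 2 ^ m * 2 ^ m)%N by rewrite mul2n -addnn expnD.
have m2 : (2 : R) ^+ (2 * m) = 2 ^+ m * 2 ^+ m by rewrite mul2n -addnn exprD.
have n0 : (2 : R) ^+ m != 0 by rewrite expf_neq0.
have nE : (2 ^ m)%N%:R = 2 ^+ m :> R by rewrite natrX.
(* Extension by 0 lets the fine index run over a full range, so that it splits as k 2^m + j with k
   the coarse cap. *)
pose g k := if dyadic_in I (2 * m) k then capmean u v 2 Q (2 * m) k `^ (2 / 2) else 0.
have -> : capsum u v 2 Q (2 * m) I = \sum_(i < 2 ^ m) \sum_(j < 2 ^ m) g (i * 2 ^ m + j)%N.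
  by rewrite -(sum_ord_mul _ _ g) -mE /capsum big_mkcond.
rewrite /capsum big_mkcond mulr_sumr; apply: ler_sum => k _.
have g0 i : 0 <= g i by rewrite /g; case: ifP => // _; exact: powR_ge0.
case: ifP => [kI|_]; last by rewrite mulr_ge0 ?(ltW C0) // sumr_ge0.
pose c (j : nat) : R := (k * 2 ^ m + j)%N%:R / 2 ^+ (2 * m).
have ck : c 0%N = k%:R / 2 ^+ m.
  by rewrite /c addn0 natrM nE m2 invfM mulrA mulfK.
have ck1 : c (2 ^ m)%N = k.+1%:R / 2 ^+ m.
  by rewrite /c -mulSnr natrM nE m2 invfM mulrA mulfK.
have cS j : c j.+1 = c j + (side Q)^-1 by rewrite /c addnS -natr1 mulrDl mul1r sQ.
have cm j : c j <= c j.+1 by rewrite cS lerDl invr_ge0 ltW.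
have cmono i j : (i <= j)%N -> c i <= c j.
  by move=> ij; rewrite ler_wpM2r ?invr_ge0 ?exprn_ge0 // ler_nat leq_add2l.
have gE (j : 'I_(2 ^ m)) : g (k * 2 ^ m + j)%N = mean (cut (c j) (c j.+1) u) (cut (c j) (c j.+1) v) 2 Q.
  rewrite /g ifT; last first.
    rewrite /dyadic_in -addnS -/(c j) -/(c j.+1); move: kI; rewrite /dyadic_in -ck -ck1 => /andP[h1 h2].
    by rewrite (le_trans h1 (cmono _ _ _)) // (le_trans (cmono _ _ _) h2).
  by rewrite (powR_two_half (capmean_ge0 _ _ _ _ _ l0)) /capmean -addnS.
under eq_bigr => j _ do rewrite gE.
rewrite (powR_two_half (capmean_ge0 _ _ _ _ _ l0)) /capmean -ck -ck1 (cut_sum _ u cm) (cut_sum _ v cm).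
rewrite /mean -mulr_sumr mulrCA ler_wpM2l ?invr_ge0 ?(ltW (sq_area_gt0 l0)) //.
apply: (hC _ _ _ c) => //.
- by move=> j; exact: integrable_cut.
- by move=> j; exact: integrable_cut.
- by move=> j xi /orP[] /cut_neq0[].
Qed.

Lemma bimean_refine (p : R) : 0 <= p -> exists2 C : R, 0 < C &
  forall m Q u v, side Q = 2 ^+ (2 * m) -> integrable2 u -> integrable2 v ->
  bimean u v p 2 Q m <= C * bimean u v p 2 Q (2 * m).
Proof.
move=> p0; have [C C0 hC] := capsum_refine.
exists (C `^ (p / 4) * C `^ (p / 4)); first by rewrite mulr_gt0 ?powR_gt0.
move=> m Q u v sQ iu iv.
have q0 : 0 <= p / 4 by rewrite divr_ge0.
have h I := powR_le2 q0 (capsum_ge0 _ _ _ _ _ I) (hC m Q I u v sQ iu iv).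
apply: (le_trans (ler_pM (powR_ge0 _ _) (powR_ge0 _ _) (h I1) (h I2))).
rewrite /bimean; have D0 I := capsum_ge0 u v 2 Q (2 * m) I.
by rewrite (powRM (p / 4) (ltW C0) (D0 I1)) (powRM (p / 4) (ltW C0) (D0 I2)) mulrACA.
Qed.

(** The weights of the subsquares sum to a multiple of the weight of [Q]; n^2 is the ratio of the
    areas in the normalisation. *)
Lemma sum_mean_subsquare_le u v (q : R) Q s n : (0 < n)%N -> side Q = n%:R * 2 ^+ s -> 0 <= q ->
  integrable2 u -> integrable2 v ->
  \sum_(t : 'I_n * 'I_n) mean u v q (subsquare Q s t.1 t.2) <=
  subsquare_const * 65 * n%:R ^+ 2 * mean u v q Q.
Proof.
move=> n0 sQ q0 iu iv.
have p : 0 < 2 ^+ s :> R by rewrite exprn_gt0.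
have nR : 0 < n%:R :> R by rewrite ltr0n.
have L0 : 0 < side Q by rewrite sQ mulr_gt0.
have ieQ := integrable_energy q0 L0 iu iv.
pose f (t : 'I_n * 'I_n) x := amp u v x `^ q * wQ (subsquare Q s t.1 t.2) x.
have ie t : integrable2 (f t) by exact: integrable_energy.
have -> : \sum_(t : 'I_n * 'I_n) mean u v q (subsquare Q s t.1 t.2) =
    ((2 ^+ s) ^+ 2)^-1 * Rintegral leb2 setT (fun x => \sum_t f t x).
  by rewrite (@Rintegral_sum _ _ _ leb2 _ _ _ f (fun t _ => ie t)) mulr_sumr.
have aE : (sq_area Q)^-1 = (n%:R ^+ 2)^-1 * ((2 ^+ s) ^+ 2)^-1 :> R.
  by rewrite /sq_area sQ exprMn invfM.
have e (k a b E : R) : b != 0 -> k * b * (b^-1 * a * E) = a * (k * E) by move=> b0; field.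
rewrite /mean aE e ?expf_neq0 ?gt_eqF // ler_wpM2l ?invr_ge0 ?exprn_ge0 ?(ltW p) // /energy -RintegralZl //.
apply: le_Rintegral => //; [exact: integrable_sumR|exact: integrable_scale|move=> x _].
rewrite /f -mulr_sumr mulrCA ler_wpM2l ?powR_ge0 // -(pair_bigA _ (fun i j : 'I_n => wQ (subsquare Q s i j) x)) /=.
exact: sum_wQ_subsquare_le.
Qed.

Lemma sum_capmean_subsquare_le u v (q : R) Q s n sigma k : (0 < n)%N ->
  side Q = n%:R * 2 ^+ s -> 0 <= q -> integrable2 u -> integrable2 v ->
  \sum_(t : 'I_n * 'I_n) capmean u v q (subsquare Q s t.1 t.2) sigma k <=
  subsquare_const * 65 * n%:R ^+ 2 * capmean u v q Q sigma k.
Proof. by move=> n0 sQ q0 iu iv; apply: sum_mean_subsquare_le => //; exact: integrable_cut. Qed.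

(** Passing from energies to means multiplies by the areas: 4^m is the number of subsquares, so the
    mean over them of the product is bounded by the product on [Q]. *)
Lemma capmean_ball_inflation (q : R) : 1 <= q -> exists2 C : R, 0 < C &
  forall m Q delta u v, side Q = 2 ^+ (2 * m) -> delta <= 4 ^- m ->
  integrable2 u -> integrable2 v ->
  (forall xi, (u xi != 0) || (v xi != 0) -> Nbhd delta xi) ->
  forall i j, dyadic_in (@I1 R) m i -> dyadic_in (@I2 R) m j ->
  \sum_(t : 'I_(2 ^ m) * 'I_(2 ^ m))
    capmean u v q (subsquare Q m t.1 t.2) m i * capmean u v q (subsquare Q m t.1 t.2) m j
  <= C * 4 ^+ m * (capmean u v q Q m i * capmean u v q Q m j).
Proof.
move=> q1; have [C C0 hC] := ball_inflation q1.
exists C => // m Q delta u v sQ dm iu iv supp i j /andP[/= i0 i1] /andP[/= j0 j1].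
have kS (k : nat) : k%:R / 2 ^+ m <= k.+1%:R / 2 ^+ m :> R.
  by rewrite ler_wpM2r ?invr_ge0 ?exprn_ge0 // ler_nat.
have ci := @cap_supported_cut u v delta m i supp.
have cj := @cap_supported_cut u v delta m j supp.
have kSi := kS i; have kSj := kS j.
have a01 : 0 <= (i%:R / 2 ^+ m : R) <= 1 by apply/andP; split; lra.
have b01 : 0 <= (j%:R / 2 ^+ m : R) <= 1 by apply/andP; split; lra.
(* A cap inside [I1] starts at or before 1/4 and a cap inside [I2] at or after 1/2. *)
have ab : 2^-1 <= 2 * (j%:R / 2 ^+ m - i%:R / 2 ^+ m) :> R by lra.
have h := hC m Q delta _ _ _ _ _ _ sQ dm
  (integrable_cut _ _ iu) (integrable_cut _ _ iv) (integrable_cut _ _ iu) (integrable_cut _ _ iv)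
  a01 b01 ab ci cj.
have m4 : (4 : R) ^+ m != 0 by rewrite expf_neq0.
have m24 : 2 ^+ (2 * m) = 4 ^+ m :> R by rewrite exprM -(natrX _ 2 2).
have a1 : (sq_area Q)^-1 = (4 ^+ m)^-1 * (4 ^+ m)^-1.
  by rewrite /sq_area sQ m24 expr2 invfM.
pose q0 (t : 'I_(2 ^ m) * 'I_(2 ^ m)) := subsquare Q m t.1 t.2.
have a2 t : (sq_area (q0 t))^-1 = (4 ^+ m)^-1 :> R.
  by rewrite /sq_area /= -exprM mulnC m24.
have step t : capmean u v q (q0 t) m i * capmean u v q (q0 t) m j =
  (4 ^+ m)^-1 * (4 ^+ m)^-1 *
  (energy (cut (i%:R / 2 ^+ m) (i.+1%:R / 2 ^+ m) u) (cut (i%:R / 2 ^+ m) (i.+1%:R / 2 ^+ m) v) q (q0 t) *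
   energy (cut (j%:R / 2 ^+ m) (j.+1%:R / 2 ^+ m) u) (cut (j%:R / 2 ^+ m) (j.+1%:R / 2 ^+ m) v) q (q0 t)).
  by rewrite /capmean /mean a2 mulrACA.
rewrite (eq_bigr _ (fun t _ => step t)) -mulr_sumr.
have i4 : 0 <= (4 ^+ m)^-1 * (4 ^+ m)^-1 :> R by rewrite mulr_ge0 ?invr_ge0 ?exprn_ge0.
apply: (le_trans (ler_wpM2l i4 h)); rewrite /capmean /mean a1 le_eqVlt; apply/orP; left; apply/eqP.
by move: (energy _ _ q Q) (energy _ _ q Q) (4 ^+ m) m4 => E1 E2 c c0; field.
Qed.

(** At exponent p only the weight sums for individual caps are used, and 2/p * p/4 = 1/2 is exactly
    the Cauchy-Schwarz case of [bilinear_sum_factor]. *)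
Lemma sum_bimean_subsquare_le (p : R) Q s n sigma u v : 4 <= p -> (0 < n)%N ->
  side Q = n%:R * 2 ^+ s -> integrable2 u -> integrable2 v ->
  \sum_(t : 'I_n * 'I_n) bimean u v p p (subsquare Q s t.1 t.2) sigma <=
  subsquare_const * 65 * n%:R ^+ 2 * bimean u v p p Q sigma.
Proof.
move=> p4 n0 sQ iu iv; have p0 : 0 < p by lra.
have L0 : 0 < side Q by rewrite sQ mulr_gt0 ?exprn_gt0 // ltr0n.
have l0 (t : 'I_n * 'I_n) : 0 < side (subsquare Q s t.1 t.2) by rewrite exprn_gt0.
have hm k := sum_capmean_subsquare_le sigma k n0 sQ (ltW p0) iu iv.
have D0 : 0 <= subsquare_const * 65 * n%:R ^+ 2 :> R.
  by apply: mulr_ge0; [apply: mulr_ge0 => //; exact: subsquare_const_ge0|exact: sqr_ge0].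
move: (subsquare_const * 65 * n%:R ^+ 2) D0 hm => D D0 hm.
have th1 : 1 <= p / 4 by rewrite ler_pdivlMr // mul1r.
have eth : 2 / p * (p / 4) = 2^-1 by field; rewrite gt_eqF.
rewrite /bimean /capsum; apply: (@bilinear_sum_factor _ _ _ _ (fun k : 'I_(2 ^ sigma) => dyadic_in I1 sigma k) (fun k : 'I_(2 ^ sigma) => dyadic_in I2 sigma k)
  (fun (t : 'I_n * 'I_n) k => capmean u v p (subsquare Q s t.1 t.2) sigma k)
  (fun (t : 'I_n * 'I_n) k => capmean u v p (subsquare Q s t.1 t.2) sigma k)
  (fun k => capmean u v p Q sigma k) (fun k => capmean u v p Q sigma k) D (2 / p) (p / 4) th1 D0 _ _ _ _ eth).
- by move=> t i; exact: capmean_ge0.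
- by move=> t i; exact: capmean_ge0.
- by move=> i; exact: capmean_ge0.
- by move=> i; exact: capmean_ge0.
- by move=> i; exact: hm.
- by move=> i; exact: hm.
Qed.

(** The L^2 norms on small squares are first raised to L^(p/2), which p >= 4 permits. At that
    exponent 2/q * p/4 = 1, so [bilinear_sum_product] lifts the pair estimate to the full sums. *)
Lemma bimean_ball_inflation (p : R) : 4 <= p -> exists2 C : R, 0 < C &
  forall m Q delta u v, side Q = 2 ^+ (2 * m) -> delta <= 4 ^- m ->
  integrable2 u -> integrable2 v ->
  (forall xi, (u xi != 0) || (v xi != 0) -> Nbhd delta xi) ->
  \sum_(t : 'I_(2 ^ m) * 'I_(2 ^ m)) bimean u v p 2 (subsquare Q m t.1 t.2) m <=
  C * 4 ^+ m * bimean u v p (p / 2) Q m.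
Proof.
move=> p4; have p0 : 0 < p by lra.
have q1 : 1 <= p / 2 by rewrite ler_pdivlMr // mul1r; lra.
have q2 : 2 <= p / 2 by rewrite ler_pdivlMr //; lra.
have q4 : 0 <= p / 4 by rewrite divr_ge0 // ltW.
have [C C0 hC] := capmean_ball_inflation q1.
have [c c0 cE] : exists2 c : R, 0 <= c & (pi ^+ 2) `^ (1 - 2 / (p / 2)) = c.
  by eexists; last exact: erefl; exact: powR_ge0.
have d0 : 0 <= c `^ (p / 4) * c `^ (p / 4) by apply: mulr_ge0; exact: powR_ge0.
have [d dE] : exists d, d = c `^ (p / 4) by eexists.
rewrite -dE in d0.
exists (d * d * C + 1); first by apply: ltr_wpDl ltr01; apply: mulr_ge0 d0 (ltW C0).
move=> m Q delta u v sQ dm iu iv supp.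
have L0 : 0 < side Q by rewrite sQ exprn_gt0.
have l0 (t : 'I_(2 ^ m) * 'I_(2 ^ m)) : 0 < side (subsquare Q m t.1 t.2) by rewrite exprn_gt0.
have m0 : 0 <= 4 ^+ m :> R by rewrite exprn_ge0.
apply: (@le_trans _ _ (d * d * \sum_(t : 'I_(2 ^ m) * 'I_(2 ^ m)) bimean u v p (p / 2) (subsquare Q m t.1 t.2) m)).
  rewrite mulr_sumr; apply: ler_sum => t _.
  have h I := powR_le2 q4 (capsum_ge0 _ _ _ _ _ I) (capsum_hoelder iu iv m I (l0 t) q2).
  apply: (le_trans (ler_pM (powR_ge0 _ _) (powR_ge0 _ _) (h I1) (h I2))).
  rewrite cE (powRM (p / 4) c0 (capsum_ge0 _ _ _ _ _ _)) (powRM (p / 4) c0 (capsum_ge0 _ _ _ _ _ _)).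
  by rewrite -dE mulrACA.
apply: (@le_trans _ _ (d * d * (C * 4 ^+ m * bimean u v p (p / 2) Q m))); last first.
  move: (bimean u v p (p / 2) Q m) (bimean_ge0 u v p (p / 2) Q m) => E E0.
  rewrite !mulrA; apply: ler_wpM2r => //.
  by apply: ler_wpM2r => //; rewrite lerDl.
apply: ler_wpM2l => //.
have th1 : 1 <= p / 4 by rewrite ler_pdivlMr // mul1r.
have eth : 2 / (p / 2) * (p / 4) = 1 by field; rewrite gt_eqF.
rewrite /bimean /capsum; apply: (@bilinear_sum_product _ _ _ _ (fun k : 'I_(2 ^ m) => dyadic_in I1 m k) (fun k : 'I_(2 ^ m) => dyadic_in I2 m k)
  (fun (t : 'I_(2 ^ m) * 'I_(2 ^ m)) k => capmean u v (p / 2) (subsquare Q m t.1 t.2) m k)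
  (fun (t : 'I_(2 ^ m) * 'I_(2 ^ m)) k => capmean u v (p / 2) (subsquare Q m t.1 t.2) m k)
  (fun k => capmean u v (p / 2) Q m k) (fun k => capmean u v (p / 2) Q m k) (C * 4 ^+ m)
  (2 / (p / 2)) (p / 4) th1 _ _ _ _ _ eth).
- by apply: mulr_ge0 => //; exact: ltW.
- by move=> t i; exact: capmean_ge0.
- by move=> t i; exact: capmean_ge0.
- by move=> i; exact: capmean_ge0.
- by move=> i; exact: capmean_ge0.
- by move=> i j i1 j2; exact: (hC m Q delta u v sQ dm iu iv supp _ _ i1 j2).
Qed.

End Multiscale.

(** * Passing between the scales *)

Section Scales.
Context {R : realType}.
Notation leb2 := (@leb2 R).
Notation integrable2 a := (leb2.-integrable setT (EFin \o a)).
Implicit Types (u v : R * R -> R) (Q : @square R).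

Lemma subsquare_subsquare Q m i j i' j' :
  subsquare (subsquare Q (2 * m) i j) m i' j' =
  subsquare Q m (i * 2 ^ m + i') (j * 2 ^ m + j').
Proof.
have mE : (2 : R) ^+ (2 * m) = 2 ^+ m * 2 ^+ m by rewrite mul2n -addnn exprD.
rewrite /subsquare /= mE !natrD !natrM !natrX.
by congr (Square (_, _) _); rewrite -addrA; congr (_ + _); ring.
Qed.

Lemma sum_subsquare (f : @square R -> R) Q m n :
  \sum_(t : 'I_(n * 2 ^ m) * 'I_(n * 2 ^ m)) f (subsquare Q m t.1 t.2) =
  \sum_(t : 'I_n * 'I_n) \sum_(t' : 'I_(2 ^ m) * 'I_(2 ^ m))
    f (subsquare (subsquare Q (2 * m) t.1 t.2) m t'.1 t'.2).
Proof.
rewrite -(pair_bigA _ (fun i j : 'I_(n * 2 ^ m) => f (subsquare Q m i j))) /=.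
rewrite -(pair_bigA _ (fun i j : 'I_n => \sum_(t' : 'I_(2 ^ m) * 'I_(2 ^ m))
    f (subsquare (subsquare Q (2 * m) i j) m t'.1 t'.2))) /=.
rewrite (sum_ord_mul _ _ (fun i => \sum_(j < n * 2 ^ m) f (subsquare Q m i j))).
apply: eq_bigr => i _.
have -> : \sum_(i' < 2 ^ m) \sum_(j < n * 2 ^ m) f (subsquare Q m (i * 2 ^ m + i') j) =
  \sum_(i' < 2 ^ m) \sum_(j < n) \sum_(j' < 2 ^ m) f (subsquare Q m (i * 2 ^ m + i') (j * 2 ^ m + j')).
  by apply: eq_bigr => i' _; rewrite (sum_ord_mul _ _ (fun j => f (subsquare Q m (i * 2 ^ m + i') j))).
rewrite exchange_big /=; apply: eq_bigr => j _.
rewrite -(pair_bigA _ (fun i' j' : 'I_(2 ^ m) => f (subsquare (subsquare Q (2 * m) i j) m i' j'))) /=.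
by apply: eq_bigr => i' _; apply: eq_bigr => j' _; rewrite subsquare_subsquare.
Qed.

(** The p-th power of the claim, with [n] squares of side 4^m along each edge of [Q]. Interpolation
    takes place on those squares, Hoelder over them separates the two factors, and each factor is
    then treated on its own. *)
Lemma sum_bimean_le (p : R) : 4 <= p -> exists2 C : R, 0 < C &
  forall m n Q delta u v, (0 < n)%N -> side Q = n%:R * 2 ^+ (2 * m) -> delta <= 4 ^- m ->
  integrable2 u -> integrable2 v ->
  (forall xi, (u xi != 0) || (v xi != 0) -> Nbhd delta xi) ->
  (n%:R ^+ 2 * 4 ^+ m)^-1 *
    \sum_(t : 'I_(n * 2 ^ m) * 'I_(n * 2 ^ m)) bimean u v p 2 (subsquare Q m t.1 t.2) m <=
  C * ((n%:R ^+ 2)^-1 *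
    \sum_(t : 'I_n * 'I_n) bimean u v p 2 (subsquare Q (2 * m) t.1 t.2) (2 * m)) `^ (1 - kappa p) *
  bimean u v p p Q m `^ kappa p.
Proof.
move=> p4; have p0 : 0 <= p by lra.
have p2 : 0 < p - 2 by lra.
have k0 : 0 <= kappa p by rewrite divr_ge0 // ?(ltW p2) // subr_ge0.
have k1 : kappa p < 1 by rewrite /kappa ltr_pdivrMr // mul1r ltrD2l ltrN2 ltr_nat.
have [C1 C10 h1] := bimean_ball_inflation p4.
have [C2 C20 h2] := bimean_refine p0.
have [C3 C30 h3] : exists2 C3 : R, 0 < C3 & subsquare_const * 65 <= C3.
  by exists (subsquare_const * 65 + 1); rewrite ?lerDl // ltr_wpDl // mulr_ge0 ?subsquare_const_ge0.
exists (C1 * (C2 `^ (1 - kappa p) * C3 `^ kappa p)).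
  by apply: mulr_gt0 => //; apply: mulr_gt0; exact: powR_gt0.
move=> m n Q delta u v n0 sQ dm iu iv supp.
have h4 := sum_bimean_subsquare_le m p4 n0 sQ iu iv.
have L0 : 0 < side Q by rewrite sQ mulr_gt0 ?exprn_gt0 // ltr0n.
have N0 : 0 < n%:R ^+ 2 :> R by rewrite exprn_gt0 // ltr0n.
have M0 : 0 < 4 ^+ m :> R by rewrite exprn_gt0.
pose S q s := \sum_(t : 'I_n * 'I_n) bimean u v p q (subsquare Q (2 * m) t.1 t.2) s.
have S0 q s : 0 <= S q s by apply: sumr_ge0 => t _; exact: bimean_ge0.
have B0 := bimean_ge0 u v p p Q m.
have kk : 0 <= 1 - kappa p by rewrite subr_ge0 ltW.
have {}h4 : S p m <= C3 * n%:R ^+ 2 * bimean u v p p Q m.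
  apply: (le_trans h4); apply: ler_wpM2r => //; apply: ler_wpM2r h3; exact: ltW.
have h5 : S 2 m <= C2 * S 2 (2 * m)%N.
  by rewrite mulr_sumr; apply: ler_sum => t _; exact: h2.
have h6 : S (p / 2) m <= S 2 m `^ (1 - kappa p) * S p m `^ kappa p.
  apply: (@le_trans _ _ (\sum_(t : 'I_n * 'I_n) bimean u v p 2 (subsquare Q (2 * m) t.1 t.2) m `^ (1 - kappa p)
     * bimean u v p p (subsquare Q (2 * m) t.1 t.2) m `^ kappa p)).
    by apply: ler_sum => t _; apply: bimean_interpolation => //; rewrite exprn_gt0.
  by apply: hoelder_sum; [rewrite k0 k1|move=> t; exact: bimean_ge0|move=> t; exact: bimean_ge0].
rewrite (sum_subsquare (fun q => bimean u v p 2 q m)).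
apply: (@le_trans _ _ ((n%:R ^+ 2 * 4 ^+ m)^-1 * (C1 * 4 ^+ m * S (p / 2) m))).
  apply: ler_wpM2l; first by rewrite invr_ge0 ltW // mulr_gt0.
  rewrite mulr_sumr; apply: ler_sum => t _; exact: h1 dm iu iv supp.
have h7 : S (p / 2) m <= (C2 * S 2 (2 * m)%N) `^ (1 - kappa p) * (C3 * n%:R ^+ 2 * bimean u v p p Q m) `^ kappa p.
  apply: (le_trans h6); apply: ler_pM; [exact: powR_ge0|exact: powR_ge0| |].
    exact: powR_le2 h5.
  exact: powR_le2 h4.
rewrite -/(S 2 (2 * m)%N); move: (S (p / 2) m) (S 2 (2 * m)%N) (S0 2 (2 * m)%N) (bimean u v p p Q m) B0 h7.
move: (n%:R ^+ 2) (4 ^+ m) (kappa p) N0 M0 k0 k1 kk => N M k N0 M0 k0 k1 kk X Y Y0 Z Z0 h7.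
have NM : (N * M)^-1 * (C1 * M * X) = N^-1 * C1 * X.
  by field; rewrite !gt_eqF.
have NC : 0 <= N^-1 * C1 by rewrite mulr_ge0 ?invr_ge0 // ltW.
rewrite NM; apply: (le_trans (ler_wpM2l NC h7)).
have Ni : 0 <= N^-1 by rewrite invr_ge0 ltW.
rewrite (powRM (1 - k) (ltW C20) Y0) (powRM k _ Z0) ?mulr_ge0 ?(ltW C30) ?(ltW N0) //.
rewrite (powRM k (ltW C30) (ltW N0)) (powRM (1 - k) Ni Y0).
(* The L^p factor absorbs N^kappa when it moves to the single big square; what remains of 1 / N is
   just the normalisation of the mean inside the L^2 factor. *)
have NE : N^-1 * N `^ k = N^-1 `^ (1 - k).
  rewrite powR_invr ?(ltW N0) // powRB ?gt_eqF ?implybT // powRr1 ?(ltW N0) //.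
  by rewrite invfM invrK.
rewrite -NE le_eqVlt; apply/orP; left; apply/eqP.
by move: (C2 `^ _) (Y `^ _) (C3 `^ _) (N `^ _) (Z `^ _) N^-1 => a b c d e f; ring.
Qed.

(** Translates the quantity of the statement into [bimean]; the L^q norms enter squared, which
    produces the power 2/q of the moment. *)
Lemma Mpq_bimean (F : R * R -> R[i]) (delta p q : R) Rr QR s sigma :
  integrable2 (fun x => complex.Re (F x)) -> integrable2 (fun x => complex.Im (F x)) ->
  delta <= 1 -> support2 (fourier F) `<=` Nbhd delta ->
  Mpq p q Rr QR F s sigma = ((4 ^+ (Rr - s))^-1 *
    \sum_(t : 'I_(2 ^ (Rr - s)) * 'I_(2 ^ (Rr - s)))
      bimean (fourier_re F) (fourier_im F) p q (subsquare QR s t.1 t.2) sigma) `^ p^-1.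
Proof.
move=> iRe iIm d1 supp.
have aux (x : R) : (x `^ q^-1) ^+ 2 = x `^ (2 / q).
  by rewrite -powR_mulrn ?powR_ge0 // -powRrM mulrC.
have LE Q a b : Lqavg q Q (fproj a b F) ^+ 2 =
    mean (cut a b (fourier_re F)) (cut a b (fourier_im F)) q Q `^ (2 / q).
  apply: (etrans (aux _)).
  suff -> : Rintegral leb2 setT (fun x => cmod (fproj a b F x) `^ q * wQ Q x) =
    energy (cut a b (fourier_re F)) (cut a b (fourier_im F)) q Q by [].
  apply: eq_Rintegral => x _.
  by rewrite (cmod_fproj iRe iIm d1 supp a b x).
have DE Q I : dyadic_sum sigma I.1 I.2 (fun a b => Lqavg q Q (fproj a b F) ^+ 2) =
    capsum (fourier_re F) (fourier_im F) q Q sigma I.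
  by apply: eq_bigr => k _; exact: LE.
rewrite -(pair_bigA _ (fun i j : 'I_(2 ^ (Rr - s)) =>
  bimean (fourier_re F) (fourier_im F) p q (subsquare QR s i j) sigma)).
rewrite /Mpq natrX; congr ((_ * _) `^ _).
by apply: eq_bigr => i _; apply: eq_bigr => j _; rewrite !DE.
Qed.

End Scales.

Theorem theorem3p17 (R : realType) (p : R) (hp : 4 <= p) (eps : R) (heps : 0 < eps) :
  exists C : R, 0 < C /\
  forall (r m : nat), (1 <= m)%N -> (m <= r)%N ->
  forall (QR : square) (F : R * R -> R[i]),
    side QR = 2 ^+ (2 * r) ->
    leb2.-integrable setT (fun x => (complex.Re (F x))%:E) ->
    leb2.-integrable setT (fun x => (complex.Im (F x))%:E) ->
    support2 (fourier F) `<=` Nbhd (4 ^- r) ->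
    Mpq p 2 (2 * r) QR F m m <=
      C * 2 `^ (m%:R * eps) * Mpq p 2 (2 * r) QR F (2 * m) (2 * m) `^ (1 - kappa p)
        * Mpq p p (2 * r) QR F (2 * r) m `^ (kappa p).
Proof.
have p0 : 0 < p by lra.
have [C C0 hC] := sum_bimean_le hp.
(* [Mpq] is the p-th root of a mean, so the constant of the p-th power estimate enters through its
   root. *)
exists (C `^ p^-1); split; first exact: powR_gt0.
move=> r m _ mr QR F sQR iRe iIm supp.
have pw n : 4 ^- n <= 1 :> R by rewrite invf_le1 ?exprn_gt0 // exprn_ege1 // ler1n.
(* From m <= r: the neighbourhood of thickness 4^-r is thin enough at the scale of caps of length
   2^-m. *)
have dm : 4 ^- r <= 4 ^- m :> R.
  by rewrite lef_pV2 ?posrE ?exprn_gt0 // ler_weXn2l // ler1n.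
have [iu iv] := integrable_fourier iRe iIm (pw r) supp.
rewrite !(Mpq_bimean _ _ _ _ _ _ iRe iIm (pw r) supp).
set u := fourier_re F; set v := fourier_im F.
pose n := (2 ^ (2 * r - 2 * m))%N.
have n0 : (0 < n)%N by rewrite expn_gt0.
have sn : side QR = n%:R * 2 ^+ (2 * m).
  by rewrite sQR natrX -exprD subnK // leq_mul2l.
have e1 : (2 ^ (2 * r - m) = n * 2 ^ m)%N.
  by rewrite -expnD; congr (2 ^ _)%N; lia.
have f4 : 4 = 2 ^+ 2 :> R by rewrite -natrX.
have e2 : 4 ^+ (2 * r - m) = n%:R ^+ 2 * 4 ^+ m :> R.
  by rewrite natrX f4 -!exprM -exprD; congr (_ ^+ _); lia.
have e3 : 4 ^+ (2 * r - 2 * m) = n%:R ^+ 2 :> R.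
  by rewrite natrX f4 -!exprM mulnC.
have h := hC m n QR _ u v n0 sn dm iu iv (fourier_support supp).
(* At s = 2r the partition has a single member, the big square itself, so the last mean collapses to
   one term. *)
have QE : subsquare QR (2 * r) 0 0 = QR.
  by case: QR sQR {supp iRe iIm sn h} => [[c1 c2] l] /= ->; rewrite /subsquare /= !mul0r !addr0.
rewrite e1 e2 e3 subnn expr0 invr1 mul1r.
have -> : \sum_(t : 'I_(2 ^ 0) * 'I_(2 ^ 0)) bimean u v p p (subsquare QR (2 * r) t.1 t.2) m =
    bimean u v p p QR m.
  rewrite -(pair_bigA _ (fun i j : 'I_(2 ^ 0) => bimean u v p p (subsquare QR (2 * r) i j) m)) /=.
  by rewrite !big_ord1 QE.
set X := (n%:R ^+ 2 * 4 ^+ m)^-1 * _ in h *.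
set Y := (n%:R ^+ 2)^-1 * _ in h *.
have X0 : 0 <= X.
  by rewrite mulr_ge0 ?invr_ge0 ?mulr_ge0 ?exprn_ge0 //; apply: sumr_ge0 => t _; exact: bimean_ge0.
have Y0 : 0 <= Y.
  by rewrite mulr_ge0 ?invr_ge0 ?exprn_ge0 //; apply: sumr_ge0 => t _; exact: bimean_ge0.
move: (bimean u v p p QR m) (bimean_ge0 u v p p QR m) h => Z Z0 h.
have pi0 : 0 <= p^-1 by rewrite invr_ge0 ltW.
(* The estimate has been obtained with a constant independent of m, and this factor only enlarges
   the right side. *)
have g1 : 1 <= 2 `^ (m%:R * eps) :> R.
  apply: (@le_trans _ _ (2 `^ 0)); first by rewrite powRr0.
  by apply: ler_powR; rewrite ?ler1n // mulr_ge0 // ltW.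
apply: (le_trans (powR_le2 pi0 X0 h)).
move: (kappa p) => k; have P := @powR_ge0 R.
rewrite (powRM p^-1 (mulr_ge0 (ltW C0) (P _ _)) (P _ _)) (powRM p^-1 (ltW C0) (P _ _)).
have AC (x y z : R) : (x `^ y) `^ z = (x `^ z) `^ y by rewrite -!powRrM mulrC.
rewrite (AC Y (1 - k)) (AC Z k); apply: ler_wpM2r => //; apply: ler_wpM2r => //.
by rewrite ler_peMr.
Qed.
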